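(* Let $\alpha\in(1/2,1]$. There exists a family of random variables $\{\widetilde L^f_t : f\in\mathcal S_\alpha,\ t\in[0,1]\}$ such that for each $f\in\mathcal S_\alpha$, almost surely $\widetilde L^f_t=L^f_t$ for all $t\in[0,1]$, and such that, with probability one, the map $(f,t)\mapsto\widetilde L^f_t$ is jointly continuous on $\mathcal S_\alpha\times[0,1]$, where $\mathcal S_\alpha$ carries the supremum norm.
   Context: $W=(W_t)_{t\ge 0}$ is a one-dimensional Brownian motion started at $0$. For $\alpha\in(0,1]$, $\mathcal S_\alpha$ is the set of functions $f:[0,1]\to\mathbb R$ with $\sup_{0\le t\le 1}|f(t)|\le 1$ and $|f(s)-f(t)|\le|s-t|^\alpha$ for all $s,t\in[0,1]$. The supremum norm is $\|f\|=\sup_{0\le t\le1}|f(t)|$. For measurable $f:[0,1]\to\mathbb R$ and $\varepsilon>0$ put $D^f_t(\varepsilon)=\frac1{2\varepsilon}\int_0^t\mathbf 1_{(f(s)-\varepsilon,f(s)+\varepsilon)}(W_s)\,ds$. The local time $L^f=(L^f_t)_{0\le t\le1}$ of $W$ along the curve $f$ is the nondecreasing continuous process (unique up to indistinguishability) such that $\mathbb E\big[\sup_{0\le t\le1}|D^f_t(\varepsilon)-L^f_t|^2\big]\to0$ as $\varepsilon\to0$. *)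

(* Defs.v *)
From HB Require Import structures.
From mathcomp Require Import all_boot all_order all_algebra.
From mathcomp Require Import all_classical all_reals all_analysis.

Set Implicit Arguments.
Unset Strict Implicit.
Unset Printing Implicit Defensive.

Import Order.TTheory GRing.Theory Num.Theory.
Import numFieldNormedType.Exports.

Local Open Scope classical_set_scope.
Local Open Scope ring_scope.

(* A function on [0, 1] is represented by a total function R -> R of which only
   the values on [0, 1] are ever used. A process is a family of random variables
   indexed by R, of which only the indices t >= 0 (for the Brownian motion),
   resp. t in [0, 1] (for local times), are ever used. *)

(* The supremum norm over [0, 1], with values in [0, +oo], so that it is the
   true supremum for unbounded functions as well. *)
Definition supnorm {R : realType} (f : R -> R) : \bar R :=
  ereal_sup [set `|f t|%:E | t in `[0, 1]].

Definition holder_ball {R : realType} (alpha : R) : set (R -> R) :=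
  [set f | (supnorm f <= 1%:E)%E /\
    forall s t, 0 <= s <= 1 -> 0 <= t <= 1 ->
      `|f s - f t| <= `|s - t| `^ alpha].

Section processes.
Context {d : measure_display} {T : measurableType d} {R : realType}.
Variable P : probability T R.

(* A finite family is independent iff the product rule holds for all choices of
   Borel sets; the rule for a subfamily is the case B i = setT for the others.
   Times are given by a sequence of which only the first n.+1 terms matter. *)
Definition independent_increments (W : R -> {RV P >-> R}) :=
  forall (n : nat) (t : nat -> R) (B : nat -> set R),
    0 <= t 0%N ->
    (forall i, (i < n)%N -> t i <= t i.+1) ->
    (forall i, (i < n)%N -> measurable (B i)) ->
    P [set w | forall i, (i < n)%N -> B i (W (t i.+1) w - W (t i) w)] =
    (\prod_(i < n) P [set w | B i (W (t i.+1) w - W (t i) w)%R])%E.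

(* The second parameter of normal_prob is the standard deviation. *)
Definition brownian_motion (W : R -> {RV P >-> R}) :=
  [/\ {ae P, forall w, W 0 w = 0},
      independent_increments W,
      (forall s t, 0 <= s -> s < t -> forall A : set R, measurable A ->
        P [set w | A (W t w - W s w)] = normal_prob 0 (Num.sqrt (t - s)) A) &
      {ae P, forall w, {within `[0, +oo[, continuous (fun t => W t w)}}].

(* D^f_t(eps) *)
Definition occupation_density (W : R -> {RV P >-> R}) (f : R -> R)
    (eps t : R) (w : T) : R :=
  (2 * eps)^-1 *
  \int[lebesgue_measure]_(s in `[0, t]) \1_`]f s - eps, f s + eps[ (W s w).

Definition is_local_time (W : R -> {RV P >-> R}) (f : R -> R)
    (L : R -> {RV P >-> R}) :=
  [/\ {ae P, forall w, {within `[0, 1], continuous (fun t => L t w)}},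
      {ae P, forall w, forall s t, 0 <= s -> s <= t -> t <= 1 ->
        L s w <= L t w} &
      (\int[P]_w
         (supnorm (fun t => occupation_density W f eps t w - L t w)%R ^+ 2))%E
        @[eps --> 0^'+] --> 0%E].

End processes.

(* Continuity of (f, t) |-> F f t on S * [0, 1], where S carries the supremum
   norm. *)
Definition jointly_continuous {R : realType} (S : set (R -> R))
    (F : (R -> R) -> R -> R) :=
  forall f t, S f -> 0 <= t <= 1 ->
  forall e, 0 < e -> exists2 delta, 0 < delta &
  forall g s, S g -> 0 <= s <= 1 ->
    (supnorm (fun u => g u - f u)%R < delta%:E)%E -> `|s - t| < delta ->
    `|F g s - F f t| < e.

(* Main.v *)
Require Import Defs.
From HB Require Import structures.
From mathcomp Require Import all_boot all_order all_algebra.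
From mathcomp Require Import all_classical all_reals all_analysis.
From mathcomp Require Import ring lra zify measurable_realfun.

Set Implicit Arguments.
Unset Strict Implicit.
Unset Printing Implicit Defensive.

Import Order.TTheory GRing.Theory Num.Theory.
Import numFieldNormedType.Exports.
Local Open Scope classical_set_scope.
Local Open Scope ring_scope.

(* With h = 2^-N and G_h(x) = E|x + Z_h| - |x| for Z_h a centred Gaussian of
   variance h, the local time along f is approximated by the sums over j < t/h
   of G_h(W_(jh) - f(jh)). Passing from h to h/2 changes such a sum by a sum of
   terms which, for a constant curve, are martingale differences. Cut time into
   blocks of length eta = h 16^(4s) with s proportional to N. As alpha > 1/2 and
   s is a small enough multiple of N, a Hoelder curve stays so close to a
   constant over a block that it may be replaced by one of finitely many levels,
   at a cost smaller than sqrt(eta) by an exponential factor. Exponential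
   supermartingales and Borel-Cantelli bound the block sums at all levels at
   once, and the number of blocks that matter, those where W is within
   O(N sqrt(eta)) of f, is controlled by the approximations along vertical
   shifts of f at scale eta. Hence the approximations are Cauchy at a rate which
   is deterministic on each of countably many events with almost sure union,
   uniformly over all Hoelder curves and times: the limit is jointly
   continuous. Averaging the approximations over the shifts f + y with
   |y| <= eps turns them into Riemann sums of the occupation density, so that
   the limit is also the pathwise limit of the occupation densities, uniformly
   on each of these events; with the L^2 hypothesis it agrees with L^f. *)

(** * Gaussian integrals *)

(** The Hoelder ball is too large for a union bound over a net of curves: the logarithm of the size
    of a net is a power of the inverse mesh, while the tails used here are only exponential in N.
    Hence the union runs over constant levels, about 8^N events against tails below 256^-N, and the
    passage from a curve to a level is deterministic. It is cheap because [tanaka] is Lipschitz with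
    a constant independent of the variance. With n = 16^(4s) intervals per block, the predictable
    variation of a block sum is about sqrt(h) times a local time of order sqrt(eta), that is eta /
    16^(2s), so a block sum is of order sqrt(eta) / 16^s. Freezing the curve costs n eta^alpha;
    asking this to be at most sqrt(eta) / 16^s determines how large the ratio [K] of N to s must be.
    The number of blocks near the curve is bounded by the approximations themselves at the coarser
    scale eta, whence a recursive estimate of Gronwall type with summable factors [kappa]. It closes
    because it is run for all curves, hence all vertical shifts, and all coarser scales at once. *)

Section gaussian_mgf.
Context {R : realType}.
Local Notation mu := (@lebesgue_measure R).

(** The Radon-Nikodym derivative of [normal_prob] and [normal_pdf] have the same integral over every
    measurable set, so they agree almost everywhere. *)
Lemma ge0_integral_normal_prob (m s : R) (f : _ -> \bar R) :
  measurable_fun setT f -> (forall x, 0 <= f x)%E ->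
  (\int[normal_prob m s]_x f x = \int[mu]_x (f x * (normal_pdf m s x)%:E))%E.
Proof.
move=> mf f0; have dom := normal_prob_dominates m s.
rewrite -(Radon_Nikodym_SigmaFinite.change_of_variables dom)//.
apply: ae_eq_integral => //.
- apply: emeasurable_funM => //; apply: (measurable_int mu).
  exact: Radon_Nikodym_SigmaFinite.f_integrable.
- by apply: emeasurable_funM => //; apply/measurable_EFinP; exact: measurable_normal_pdf.
- apply: ae_eqe_mul2l => /=.
  apply: integral_ae_eq => //=.
  + exact: Radon_Nikodym_SigmaFinite.f_integrable.
  + by apply/measurable_EFinP; exact: measurable_normal_pdf.
  + by move=> E E01 mE; rewrite -Radon_Nikodym_SigmaFinite.f_integral.
Qed.

(** Completing the square: [expR (a * z)] times the centred density of variance [v] is the constant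
    on the right times the density centred at [a * v]. *)
Lemma normal_prob_mgf (v a : R) : 0 < v ->
  (\int[normal_prob 0 (Num.sqrt v)]_z (expR (a * z))%:E =
   (expR (a ^+ 2 * v / 2))%:E)%E.
Proof.
move=> v0; have s0 : Num.sqrt v != 0 by rewrite gt_eqF// sqrtr_gt0.
have mE : measurable_fun setT (fun z : R => (expR (a * z))%:E).
  apply/measurable_EFinP; apply: measurableT_comp => //.
rewrite ge0_integral_normal_prob//.
transitivity (\int[mu]_x ((expR (a ^+ 2 * v / 2))%:E *
    (normal_pdf (a * v) (Num.sqrt v) x)%:E))%E.
  apply: eq_integral => x _; rewrite -!EFinM; congr EFin.
  rewrite !normal_pdfE// mulrCA [RHS]mulrCA; congr (_ * _).
  rewrite /normal_fun -!expRD; congr expR.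
  rewrite sqr_sqrtr ?ltW//; field; exact: lt0r_neq0.
rewrite integralZl//; last exact: integrable_normal_pdf.
by rewrite integral_normal_pdf mule1.
Qed.

End gaussian_mgf.

(** * Elementary inequalities for the exponential *)

Section exponential_bounds.
Context {R : realType}.
Implicit Types x y u : R.

Lemma expR_sub1_le x : expR x - 1 <= x * expR x.
Proof.
have h := expR_ge1Dx (- x); have e0 := expR_gt0 x.
have : expR x * (1 - x) <= expR x * expR (- x) by rewrite ler_wpM2l// ltW.
by rewrite -expRD subrr expR0; lra.
Qed.

Lemma expR_taylor1 y : `|expR y - 1 - y| <= y ^+ 2 * expR `|y|.
Proof.
have h1 := expR_ge1Dx y; rewrite ger0_norm; last lra.
have [y0|y0] := lerP 0 y.
  have h2 := expR_sub1_le.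
  rewrite ger0_norm//; have := ler_wpM2l y0 (h2 y); have := h2 y.
  by rewrite mulrA -expr2; lra.
have e1 : 1 <= expR (- y) by rewrite -expR0 ler_expR; lra.
rewrite ltr0_norm//.
suff : expR y <= 1 + y + y ^+ 2 by have := ler_peMr (sqr_ge0 y) e1; lra.
have e2 := expR_ge1Dx (- y); have e0 := expR_gt0 y.
have e3 : expR y * expR (- y) = 1 by rewrite -expRD subrr expR0.
have y1 : 0 < 1 - y by lra.
rewrite -(ler_pM2r y1); have : expR y * (1 - y) <= 1.
  by rewrite -[leRHS]e3 ler_wpM2l// ltW.
have : 0 <= y ^+ 2 * - y by rewrite mulr_ge0 ?sqr_ge0//; lra.
have -> : (1 + y + y ^+ 2) * (1 - y) = 1 + y ^+ 2 * - y by ring.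
lra.
Qed.

Let sinh_bounds u : 0 <= u ->
  2 * u - u ^+ 2 <= expR u - expR (- u) <= 2 * u * expR u.
Proof.
move=> u0; have e0 := expR_gt0 u; have f0 := expR_gt0 (- u).
have e1 := expR_ge1Dx u; have f1 := expR_ge1Dx (- u).
have ef : expR u * expR (- u) = 1 by rewrite -expRD subrr expR0.
apply/andP; split; last first.
  have u1 : 1 <= expR u by rewrite -expR0 ler_expR.
  have := expR_sub1_le u; have := ler_peMr u0 u1; lra.
suff : expR (- u) <= 1 - u + u ^+ 2 by lra.
have h : expR (- u) * (1 + u) <= 1 by rewrite -[leRHS]ef mulrC ler_wpM2r// ltW.
have u1 : 0 < 1 + u by lra.
rewrite -(ler_pM2r u1); apply: (le_trans h).
have := exprn_ge0 3 u0; lra.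
Qed.

(** With u = y / 2 one has e^y + e^-y - 2 = (e^u - e^-u)^2, so that two-sided bounds on e^u - e^-u,
    squared, suffice. *)
Lemma expR_taylor2 y :
  `|expR y + expR (- y) - 2 - y ^+ 2| <= `|y| ^+ 3 * expR `|y|.
Proof.
wlog y0 : y / 0 <= y => [hw|].
  have [/hw //|/ltW y0] := lerP 0 y.
  have := hw (- y); rewrite oppr_ge0 => /(_ y0).
  by rewrite opprK normrN sqrrN (addrC (expR (- y))).
rewrite (ger0_norm y0); set u := y / 2.
have u0 : 0 <= u by rewrite /u; lra.
have yu : y = u + u by rewrite /u; lra.
have /andP[h1 h2] := sinh_bounds u0.
have e1 : 1 <= expR u by rewrite -expR0 ler_expR.
have ef : expR u * expR (- u) = 1 by rewrite -expRD subrr expR0.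
have -> : expR y + expR (- y) - 2 = (expR u - expR (- u)) ^+ 2.
  by rewrite yu opprD !expRD sqrrB ef; ring.
set s := expR u - expR (- u) in h1 h2 *.
have s0 : 0 <= s by rewrite subr_ge0 ler_expR; lra.
have ey : 1 + y <= expR y := expR_ge1Dx y.
have ey2 : expR y = expR u ^+ 2 by rewrite yu expRD expr2.
rewrite ler_norml; apply/andP; split.
  have sl : y ^+ 2 - y ^+ 3 / 2 <= s ^+ 2.
    have [u2|u2] := lerP u 2; last first.
      by have := sqr_ge0 s; rewrite yu; nra.
    have : (2 * u - u ^+ 2) ^+ 2 <= s ^+ 2 by rewrite ler_sqr ?nnegrE//; nra.
    by rewrite yu; nra.
  have y3 : 0 <= y ^+ 3 by rewrite exprn_ge0.
  nra.
have sl : s ^+ 2 <= y ^+ 2 * expR y.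
  rewrite ey2 -exprMn ler_sqr ?nnegrE ?mulr_ge0 ?expR_ge0//.
  by apply: (le_trans h2); rewrite yu; lra.
have := expR_sub1_le y; have := sqr_ge0 y; nra.
Qed.

Lemma exprn_le_fact_expR x n : 0 <= x -> x ^+ n <= n`!%:R * expR x.
Proof.
case: n => [|n] x0.
  by rewrite expr0 fact0 mul1r -expR0 ler_expR.
have := expR_ge1Dxn n x0 => h.
have f0 : 0 < n.+1`!%:R :> R by rewrite ltr0n fact_gt0.
by rewrite mulrC -ler_pdivrMr//; lra.
Qed.

(** Serves to read moments off the moment generating function without differentiating under the
    integral. The case a = 1 gives |x| <= C, so a = |x| / (2 C) is allowed and is contradictory
    unless x = 0. *)
Lemma eq0_small_norm (x C : R) :
  (forall a, 0 < a -> a <= 1 -> `|x| <= a * C) -> x = 0.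
Proof.
move=> h; apply/normr0_eq0/eqP; rewrite eq_le normr_ge0 andbT leNgt.
apply/negP => x0; have h1 := h 1 ltr01 (lexx _).
pose a := `|x| / (2 * C).
have C0 : 0 < C by lra.
have a0 : 0 < a by rewrite divr_gt0//; lra.
have a1 : a <= 1 by rewrite /a ler_pdivrMr; lra.
have := h a a0 a1; rewrite /a invfM !mulrA mulfVK ?gt_eqF//; lra.
Qed.

End exponential_bounds.

Notation gauss v := (normal_prob 0 (Num.sqrt v)).

Section gaussian_moments.
Context {R : realType}.
Implicit Types (v a x y z : R) (g h : R -> R).

(** The dominating function is C (e^(a z) + e^(- a z)), whose integral the moment generating
    function provides. *)
Lemma integrable_gauss v C a g : 0 < v -> measurable_fun setT g ->
  (forall z, `|g z| <= C * expR (a * `|z|)) ->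
  (gauss v).-integrable setT (EFin \o g).
Proof.
move=> v0 mg gC.
pose E z := expR (a * z) + expR (- a * z).
have mE b : measurable_fun setT (fun z : R => (expR (b * z))%:E).
  by apply/measurable_EFinP; apply: measurableT_comp => //; exact: measurable_funM.
have iE b : (gauss v).-integrable setT (fun z : R => (expR (b * z))%:E).
  apply/integrableP; split; first exact: mE.
  under eq_integral do rewrite gee0_abs ?lee_fin ?expR_ge0//.
  by rewrite normal_prob_mgf// ltry.
have C0 : 0 <= C.
  have := le_trans (normr_ge0 _) (gC 0).
  by rewrite normr0 mulr0 expR0 mulr1.
have iCE : (gauss v).-integrable setT (fun z => C%:E * (E z)%:E)%E.
  apply: integrableZl; first exact: measurableT.
  by under eq_fun do rewrite EFinD; apply: integrableD => //; exact: iE.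
apply: le_integrable iCE => //=.
- exact/measurable_EFinP.
- move=> z _; rewrite lee_fin (le_trans (gC z))//.
  have E0 : 0 <= C * E z by rewrite mulr_ge0// addr_ge0// expR_ge0.
  rewrite (ger0_norm E0) ler_wpM2l// /E.
  by case: ger0P => _; rewrite ?mulrN ?mulNr ?lerDl ?lerDr ?expR_ge0.
Qed.

Lemma le_Rintegral_gauss v C a g h : 0 < v -> measurable_fun setT g ->
  measurable_fun setT h ->
  (forall z, `|g z| <= C * expR (a * `|z|)) ->
  (forall z, `|h z| <= C * expR (a * `|z|)) ->
  (forall z, g z <= h z) ->
  \int[gauss v]_z g z <= \int[gauss v]_z h z.
Proof.
move=> v0 mg mh gC hC gh; apply: le_Rintegral => //.
- exact: (integrable_gauss v0 mg gC).
- exact: (integrable_gauss v0 mh hC).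
Qed.

Lemma Rintegral_gauss_cst v (c : R) : \int[gauss v]_z c = c.
Proof.
by rewrite Rintegral_cst//= probability_setT mulr1.
Qed.

Lemma Rintegral_gauss_exp v a : 0 < v ->
  \int[gauss v]_z expR (a * z) = expR (a ^+ 2 * v / 2).
Proof. by move=> v0; rewrite /Rintegral normal_prob_mgf. Qed.

Lemma norm_poly_exp_bound n z : `|z| ^+ n * expR `|z| <= n`!%:R * expR (2 * `|z|).
Proof.
rewrite mulr2n mulrDl mul1r expRD mulrA ler_wpM2r ?expR_ge0//.
exact: exprn_le_fact_expR.
Qed.

Lemma norm_expn_bound n z : `|z ^+ n| <= n`!%:R * expR (1 * `|z|).
Proof. by rewrite normrX mul1r; exact: exprn_le_fact_expR. Qed.

Lemma integrable_gauss_expn v n : 0 < v ->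
  (gauss v).-integrable setT (EFin \o (fun z : R => z ^+ n)).
Proof.
move=> v0; apply: (integrable_gauss v0 _ (norm_expn_bound n)).
exact: exprn_measurable.
Qed.

Lemma integrable_gauss_exp v a : 0 < v ->
  (gauss v).-integrable setT (EFin \o (fun z : R => expR (a * z))).
Proof.
move=> v0; apply: (@integrable_gauss v 1 `|a|) => //.
  by apply: measurableT_comp => //; exact: measurable_funM.
by move=> z; rewrite mul1r ger0_norm ?expR_ge0// ler_expR -normrM ler_norm.
Qed.

Lemma integrable_gauss_norm v : 0 < v ->
  (gauss v).-integrable setT (EFin \o (fun z : R => `|z|)).
Proof. by move=> v0; apply: integrable_norm; exact: (@integrable_gauss_expn v 1). Qed.

Lemma integrable_gauss_cst v (c : R) : (gauss v).-integrable setT (EFin \o (fun=> c)).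
Proof. exact: finite_measure_integrable_cst. Qed.

End gaussian_moments.

Section integrable_EFin.
Context d (T : measurableType d) (R : realType) (mu : {measure set T -> \bar R}).
Implicit Types f g : T -> R.

Lemma integrableZ_EFin f k : mu.-integrable setT (EFin \o f) ->
  mu.-integrable setT (EFin \o (fun x => k * f x)).
Proof. by move=> /(integrableZl measurableT k). Qed.

Lemma integrableD_EFin f g : mu.-integrable setT (EFin \o f) ->
  mu.-integrable setT (EFin \o g) ->
  mu.-integrable setT (EFin \o (fun x => f x + g x)).
Proof. by move=> /(integrableD measurableT) h /h. Qed.

Lemma integrableB_EFin f g : mu.-integrable setT (EFin \o f) ->
  mu.-integrable setT (EFin \o g) ->
  mu.-integrable setT (EFin \o (fun x => f x - g x)).
Proof. by move=> /(integrableB measurableT) h /h. Qed.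

End integrable_EFin.

Section gaussian_moments_values.
Context {R : realType}.
Implicit Types (v a x y z : R) (g h : R -> R).

Lemma measurable_exp_norm a : measurable_fun setT (fun z : R => expR (a * `|z|)).
Proof.
apply: measurableT_comp => //; exact: measurable_funM.
Qed.

Lemma Rintegral_gauss_exp_norm v a : 0 < v ->
  \int[gauss v]_z expR (a * `|z|) <= 2 * expR (a ^+ 2 * v / 2).
Proof.
move=> v0.
have -> : 2 * expR (a ^+ 2 * v / 2) =
    \int[gauss v]_z (expR (a * z) + expR (- a * z)).
  rewrite RintegralD//; try exact: integrable_gauss_exp.
  by rewrite !Rintegral_gauss_exp// sqrrN -mulr2n mulr_natl.
apply: (@le_Rintegral_gauss _ _ 2 `|a|) => //.
- exact: measurable_exp_norm.
- apply: measurable_funD; apply: measurableT_comp => //;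
    exact: measurable_funM.
- move=> z; rewrite ger0_norm ?expR_ge0//.
  have h : expR (a * `|z|) <= expR (`|a| * `|z|).
    by rewrite ler_expR ler_wpM2r// ler_norm.
  by have := expR_ge0 (`|a| * `|z|); lra.
- move=> z; rewrite ger0_norm ?addr_ge0 ?expR_ge0//.
  have h b : expR (b * z) <= expR (`|b| * `|z|).
    by rewrite ler_expR -normrM ler_norm.
  have := h a; have := h (- a); rewrite normrN; lra.
- move=> z; case: ger0P => _; rewrite ?mulrN ?mulNr ?lerDl ?lerDr ?expR_ge0//.
Qed.

Lemma norm_Rintegral_gauss v C a g : 0 < v -> measurable_fun setT g ->
  (forall z, `|g z| <= C * expR (a * `|z|)) ->
  `|\int[gauss v]_z g z| <= C * (2 * expR (a ^+ 2 * v / 2)).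
Proof.
move=> v0 mg gC; have ig := integrable_gauss v0 mg gC.
apply: (le_trans (le_normr_Rintegral _ ig)) => //.
have C0 : 0 <= C.
  by have := le_trans (normr_ge0 _) (gC 0); rewrite normr0 mulr0 expR0 mulr1.
apply: (@le_trans _ _ (\int[gauss v]_z (C * expR (a * `|z|)))).
  apply: (@le_Rintegral_gauss _ _ C a) => //.
  - exact: measurableT_comp.
  - by apply: measurable_funM => //; exact: measurable_exp_norm.
  - by move=> z; rewrite normr_id.
  - by move=> z; rewrite ger0_norm// mulr_ge0// expR_ge0.
rewrite RintegralZl//; first by rewrite ler_wpM2l// Rintegral_gauss_exp_norm.
apply: (@integrable_gauss _ _ 1 a) => //; first exact: measurable_exp_norm.
by move=> z; rewrite mul1r ger0_norm// expR_ge0.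
Qed.

(** Integrating the Taylor remainder of e^(a z), which is O(a^2), against the explicit moment
    generating function shows that a times the mean is O(a^2); then a tends to 0. *)
Lemma gauss_mean v : 0 < v -> \int[gauss v]_z z = 0.
Proof.
move=> v0; set m := Rintegral _ _ _.
pose K := 2 * (2 * expR (2 ^+ 2 * v / 2)) + v / 2 * expR (v / 2).
apply: (@eq0_small_norm _ _ K) => a a0 a1.
have iz : (gauss v).-integrable setT (EFin \o (fun z : R => z)) :=
  @integrable_gauss_expn _ v 1 v0.
have iaz : (gauss v).-integrable setT (EFin \o (fun z : R => a * z)).
  exact: integrableZ_EFin.
have ie1 : (gauss v).-integrable setT (EFin \o (fun z : R => expR (a * z) - 1)).
  apply: integrableB_EFin => //; [exact: integrable_gauss_exp|exact: integrable_gauss_cst].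
have h1 : \int[gauss v]_z (expR (a * z) - 1 - a * z) =
    expR (a ^+ 2 * v / 2) - 1 - a * m.
  rewrite RintegralB// RintegralB//; last 2 first.
    exact: integrable_gauss_exp.
    exact: integrable_gauss_cst.
  by rewrite Rintegral_gauss_exp// Rintegral_gauss_cst RintegralZl.
have h2 : `|\int[gauss v]_z (expR (a * z) - 1 - a * z)| <=
    (a ^+ 2 * 2) * (2 * expR (2 ^+ 2 * v / 2)).
  apply: norm_Rintegral_gauss => //.
    apply: measurable_funB; last exact: measurable_funM.
    apply: measurable_funB => //.
    by apply: measurableT_comp => //; exact: measurable_funM.
  move=> z; apply: (le_trans (expR_taylor1 _)).
  rewrite exprMn -[leLHS]mulrA -[leRHS]mulrA ler_wpM2l ?sqr_ge0//.
  rewrite -[z ^+ 2]real_normK ?num_real//.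
  apply: (le_trans _ (norm_poly_exp_bound 2 z)).
  by rewrite ler_wpM2l ?exprn_ge0// ler_expR normrM ler_piMl// gtr0_norm.
set E1 := expR _ in h1; have h3 := expR_sub1_le (a ^+ 2 * v / 2).
have av0 : 0 <= a ^+ 2 * v by rewrite mulr_ge0 ?sqr_ge0// ltW.
have av1 : a ^+ 2 * v <= v by rewrite ler_piMl ?expr_le1// ltW.
have h4 : E1 <= expR (v / 2) by rewrite ler_expR; lra.
have h5 : 1 <= E1 by rewrite -[leLHS]expR0 ler_expR; lra.
have h6 : E1 - 1 <= a ^+ 2 * (v / 2 * expR (v / 2)).
  apply: (le_trans h3); rewrite -/E1.
  have -> : a ^+ 2 * v / 2 * E1 = a ^+ 2 * (v / 2 * E1) by ring.
  by rewrite ler_wpM2l ?sqr_ge0// ler_wpM2l//; lra.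
have h7 : a * `|m| <= a * (a * K).
  rewrite -{1}(gtr0_norm a0) -normrM.
  have -> : a * m = (E1 - 1) - (E1 - 1 - a * m) by ring.
  rewrite (le_trans (ler_normB _ _))// -h1 ger0_norm ?subr_ge0//.
  by rewrite /K; rewrite expr2 in h2 h6; lra.
by move: h7; rewrite ler_pM2l.
Qed.

(** As for the mean, with the even combination e^(a z) + e^(- a z), in which the odd terms cancel:
    a^2 times the error is O(a^3). *)
Lemma gauss_variance v : 0 < v -> \int[gauss v]_z z ^+ 2 = v.
Proof.
move=> v0; set m := Rintegral _ _ _; apply/eqP; rewrite -subr_eq0; apply/eqP.
pose K := 6 * (2 * expR (2 ^+ 2 * v / 2)) + 2 * (v / 2) ^+ 2 * expR (v / 2).
apply: (@eq0_small_norm _ _ K) => a a0 a1.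
have iz := @integrable_gauss_expn R v 2 v0.
have iaz : (gauss v).-integrable setT (EFin \o (fun z : R => a ^+ 2 * z ^+ 2)).
  exact: integrableZ_EFin.
have ie1 : (gauss v).-integrable setT
    (EFin \o (fun z : R => expR (a * z) + expR (- a * z))).
  apply: integrableD_EFin => //; exact: integrable_gauss_exp.
have ie2 : (gauss v).-integrable setT
    (EFin \o (fun z : R => expR (a * z) + expR (- a * z) - 2)).
  apply: integrableB_EFin => //; exact: integrable_gauss_cst.
set E1 := expR (a ^+ 2 * v / 2).
have h1 : \int[gauss v]_z (expR (a * z) + expR (- a * z) - 2 - a ^+ 2 * z ^+ 2) =
    2 * E1 - 2 - a ^+ 2 * m.
  rewrite RintegralB// RintegralB//; last exact: integrable_gauss_cst.
  rewrite RintegralD//; try exact: integrable_gauss_exp.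
  rewrite !Rintegral_gauss_exp// sqrrN Rintegral_gauss_cst RintegralZl//.
  by rewrite /E1 /m; ring.
have h2 : `|\int[gauss v]_z (expR (a * z) + expR (- a * z) - 2 - a ^+ 2 * z ^+ 2)|
    <= (a ^+ 3 * 6) * (2 * expR (2 ^+ 2 * v / 2)).
  apply: norm_Rintegral_gauss => //.
    apply: measurable_funB; last by apply: measurable_funM => //; exact: exprn_measurable.
    apply: measurable_funB => //.
    by apply: measurable_funD; apply: measurableT_comp => //; exact: measurable_funM.
  move=> z; rewrite mulNr -exprMn; apply: (le_trans (expR_taylor2 _)).
  rewrite normrM exprMn (gtr0_norm a0) -[leLHS]mulrA -[leRHS]mulrA ler_wpM2l ?exprn_ge0 ?(ltW a0)//.
  have h := norm_poly_exp_bound 3 z; rewrite -[3`!]/6%N in h.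
  apply: (le_trans _ h).
  by rewrite ler_wpM2l ?exprn_ge0// ler_expR ler_piMl.
have av0 : 0 <= a ^+ 2 * v by rewrite mulr_ge0 ?sqr_ge0// ltW.
have av1 : a ^+ 2 * v <= v by rewrite ler_piMl ?expr_le1// ltW.
have h3 := expR_taylor1 (a ^+ 2 * v / 2); rewrite -/E1 in h3.
have av2 : 0 <= a ^+ 2 * v / 2 by lra.
rewrite (ger0_norm av2) in h3.
have h4 : E1 <= expR (v / 2) by rewrite ler_expR; lra.
have h6 : `|E1 - 1 - a ^+ 2 * v / 2| <= a ^+ 3 * ((v / 2) ^+ 2 * expR (v / 2)).
  apply: (le_trans h3); have -> : (a ^+ 2 * v / 2) ^+ 2 * E1 = a ^+ 3 * (a * ((v / 2) ^+ 2 * E1)) by ring.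
  rewrite ler_wpM2l ?exprn_ge0 ?(ltW a0)//.
  have X0 : 0 <= (v / 2) ^+ 2 * expR (v / 2).
    by rewrite mulr_ge0 ?sqr_ge0 ?expR_ge0.
  apply: (@le_trans _ _ (a * ((v / 2) ^+ 2 * expR (v / 2)))).
    by rewrite ler_wpM2l ?(ltW a0)// ler_wpM2l ?sqr_ge0.
  by rewrite ler_piMl.
have h7 : a ^+ 2 * `|m - v| <= a ^+ 2 * (a * K).
  rewrite -{1}(ger0_norm (sqr_ge0 a)) -normrM.
  have -> : a ^+ 2 * (m - v) = 2 * (E1 - 1 - a ^+ 2 * v / 2) - (2 * E1 - 2 - a ^+ 2 * m).
    by field.
  rewrite (le_trans (ler_normB _ _))// -h1 normrM ger0_norm//.
  have -> : a ^+ 2 * (a * K) = a ^+ 3 * K by ring.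
  by rewrite /K; lra.
by move: h7; rewrite ler_pM2l// exprn_gt0.
Qed.

End gaussian_moments_values.

(** * The Tanaka kernel *)

Section tanaka_kernel.
Context {R : realType}.
Implicit Types (v a x y z : R).

Definition gauss_abs v x := \int[gauss v]_z `|x + z|.

(* By Tanaka's formula this is the expected local time at 0, during a time
   interval of length v, of a Brownian motion started at x. It is locked,
   because unification would otherwise compare kernels of different variances
   by unfolding Lebesgue integrals. *)
Fact tanaka_key : unit. Proof. by []. Qed.
Definition tanaka := locked_with tanaka_key (fun v x => gauss_abs v x - `|x|).

Lemma tanakaE v x : tanaka v x = gauss_abs v x - `|x|.
Proof. by rewrite /tanaka unlock. Qed.

Lemma gauss_abs_bound x z : `| `|x + z| | <= (`|x| + 1) * expR (1 * `|z|).
Proof.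
rewrite normr_id (le_trans (ler_normD _ _))// mul1r.
have h := expR_ge1Dx `|z|; have z0 := normr_ge0 z.
have e1 : 1 <= expR `|z| by lra.
by have := ler_peMr (normr_ge0 x) e1; lra.
Qed.

Lemma measurable_abs_shift x : measurable_fun setT (fun z : R => `|x + z|).
Proof. by apply: measurableT_comp => //; exact: measurable_funD. Qed.

Lemma integrable_gauss_abs v x : 0 < v ->
  (gauss v).-integrable setT (EFin \o (fun z : R => `|x + z|)).
Proof.
move=> v0; apply: (integrable_gauss v0 _ (gauss_abs_bound x)).
exact: measurable_abs_shift.
Qed.

Lemma gauss_abs_lipschitz v x y : 0 < v ->
  `|gauss_abs v x - gauss_abs v y| <= `|x - y|.
Proof.
move=> v0.
wlog : x y / gauss_abs v y <= gauss_abs v x => [hw|xy].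
  have [/hw//|/hw h] := orP (le_total (gauss_abs v y) (gauss_abs v x)).
  by rewrite distrC (distrC x).
rewrite ger0_norm ?subr_ge0// lerBlDl.
rewrite -[X in _ + X](Rintegral_gauss_cst v) -RintegralD//; last 2 first.
  exact: integrable_gauss_abs.
  exact: integrable_gauss_cst.
apply: le_Rintegral => //; first exact: integrable_gauss_abs.
- apply: integrableD_EFin; first exact: integrable_gauss_abs.
  exact: integrable_gauss_cst.
- move=> z _; have -> : x + z = (y + z) + (x - y) by ring.
  exact: ler_normD.
Qed.

(** The constant does not depend on [v]: moving the curve by a small amount costs the same at every
    scale. *)
Lemma tanaka_lipschitz v x y : 0 < v ->
  `|tanaka v x - tanaka v y| <= 2 * `|x - y|.
Proof.
move=> v0; rewrite !tanakaE.
have := gauss_abs_lipschitz x y v0; have := ler_dist_dist x y.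
set A := gauss_abs v x; set B := gauss_abs v y => h1 h2.
have -> : A - `|x| - (B - `|y|) = (A - B) - (`|x| - `|y|) by ring.
by rewrite (le_trans (ler_normB _ _))//; lra.
Qed.

Lemma gauss_abs_ge v x : 0 < v -> `|x| <= gauss_abs v x.
Proof.
move=> v0; have iz : (gauss v).-integrable setT (EFin \o (fun z : R => z)) :=
  @integrable_gauss_expn R v 1 v0.
have h : \int[gauss v]_z (x + z) = x.
  rewrite RintegralD// ?Rintegral_gauss_cst ?gauss_mean ?addr0//.
  exact: integrable_gauss_cst.
rewrite -{1}h; apply: (le_trans (le_normr_Rintegral _ _)) => //.
by apply: integrableD_EFin => //; exact: integrable_gauss_cst.
Qed.

Lemma tanaka_ge0 v x : 0 < v -> 0 <= tanaka v x.
Proof. by move=> v0; rewrite tanakaE subr_ge0 gauss_abs_ge. Qed.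

(** With s = sqrt v, integrate |z| <= z^2 / (2 s) + s / 2, which is a completed square. *)
Lemma gauss_abs0_le v : 0 < v -> \int[gauss v]_z `|z| <= Num.sqrt v.
Proof.
move=> v0; pose s := Num.sqrt v; have s0 : 0 < s by rewrite sqrtr_gt0.
have sv : s ^+ 2 = v by rewrite sqr_sqrtr// ltW.
have hs : \int[gauss v]_z ((2 * s)^-1 * z ^+ 2 + s / 2) = s.
  rewrite RintegralD//; last 2 first.
    by apply: integrableZ_EFin; exact: integrable_gauss_expn.
    exact: integrable_gauss_cst.
  rewrite RintegralZl//; last exact: integrable_gauss_expn.
  rewrite gauss_variance// Rintegral_gauss_cst -sv; field; exact: lt0r_neq0.
rewrite -[leRHS]hs; apply: le_Rintegral => //; first exact: integrable_gauss_norm.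
- apply: integrableD_EFin; last exact: integrable_gauss_cst.
  by apply: integrableZ_EFin; exact: integrable_gauss_expn.
- move=> z _; rewrite -subr_ge0 -(@real_normK _ z) ?num_real//.
  have -> : (2 * s)^-1 * `|z| ^+ 2 + s / 2 - `|z| = (2 * s)^-1 * (`|z| - s) ^+ 2.
    by field; exact: lt0r_neq0.
  by rewrite mulr_ge0 ?sqr_ge0// invr_ge0 mulr_ge0// ltW.
Qed.

Lemma gauss_abs_le v x : 0 < v -> gauss_abs v x <= `|x| + Num.sqrt v.
Proof.
move=> v0; apply: le_trans (lerD (lexx _) (gauss_abs0_le v0)).
rewrite -[X in X + _](Rintegral_gauss_cst v) -RintegralD//; last 2 first.
  exact: integrable_gauss_cst.
  exact: integrable_gauss_norm.
apply: le_Rintegral => //; first exact: integrable_gauss_abs.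
- apply: integrableD_EFin; first exact: integrable_gauss_cst.
  exact: integrable_gauss_norm.
- by move=> z _; exact: ler_normD.
Qed.

Lemma tanaka_le v x : 0 < v -> tanaka v x <= Num.sqrt v.
Proof. by move=> v0; rewrite tanakaE lerBlDl gauss_abs_le. Qed.

Lemma expR1_half_le2 : expR (1 / 2) <= 2 :> R.
Proof.
have := expR_ge1Dx (- (1 / 2) : R) => h.
have e0 := expR_gt0 (1 / 2 : R).
have : expR (1 / 2) * expR (- (1 / 2)) = 1 :> R by rewrite -expRD subrr expR0.
have : expR (1 / 2) * (1 / 2) <= expR (1 / 2) * expR (- (1 / 2)) :> R.
  by rewrite ler_wpM2l ?(ltW e0)//; lra.
lra.
Qed.

(** From y^4 <= 4! e^y at y = |z| / sqrt v; the constant is 24 * 2 * 2, with e^(1/2) <= 2, instead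
    of the exact value 3. *)
Lemma gauss_fourth_moment_le v : 0 < v -> \int[gauss v]_z z ^+ 4 <= 96 * v ^+ 2.
Proof.
move=> v0; pose s := Num.sqrt v; have s0 : 0 < s by rewrite sqrtr_gt0.
have sv : s ^+ 2 = v by rewrite sqr_sqrtr// ltW.
rewrite (le_trans (ler_norm _))//.
have hb z : `|z ^+ 4| <= (24 * v ^+ 2) * expR (s^-1 * `|z|).
  have := @exprn_le_fact_expR R (s^-1 * `|z|) 4 _.
  rewrite mulr_ge0 ?invr_ge0 ?(ltW s0)// => /(_ isT).
  rewrite exprMn exprVn -[4%N]/(2 * 2)%N (exprM s) sv.
  rewrite mulrC ler_pdivrMr ?exprn_gt0// normrX => h.
  apply: (le_trans h); rewrite /factorial /=.
  by rewrite [leLHS]mulrAC.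
apply: (le_trans (norm_Rintegral_gauss v0 _ hb)); first exact: exprn_measurable.
have -> : s^-1 ^+ 2 * v / 2 = 1 / 2.
  by rewrite exprVn sv mulVf// lt0r_neq0.
have := expR1_half_le2; have := sqr_ge0 v; nra.
Qed.

(** For w = k |z| one has w^2 - w^4 <= w, so |z| is bounded below by a combination of its second and
    fourth powers. With k = 1 / (20 sqrt v) the moments give (1/20 - 96/8000) sqrt v. *)
Lemma tanaka0_ge v : 0 < v -> Num.sqrt v / 50 <= tanaka v 0.
Proof.
move=> v0; rewrite tanakaE normr0 subr0 -/(gauss_abs v 0).
pose s := Num.sqrt v; have s0 : 0 < s by rewrite sqrtr_gt0.
have sv : s ^+ 2 = v by rewrite sqr_sqrtr// ltW.
have i2 := @integrable_gauss_expn R v 2 v0.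
have i4 := @integrable_gauss_expn R v 4 v0.
have h4 := gauss_fourth_moment_le v0.
pose k := (20 * s)^-1; have k0 : 0 < k by rewrite invr_gt0 mulr_gt0.
have : \int[gauss v]_z (k * z ^+ 2 - k ^+ 3 * z ^+ 4) <= gauss_abs v 0.
  apply: le_Rintegral => //.
  - by apply: integrableB_EFin; exact: integrableZ_EFin.
  - exact: integrable_gauss_abs.
  - move=> z _; rewrite add0r.
    have -> : z ^+ 4 = `|z| ^+ 4 by rewrite -[RHS]normrX ger0_norm// exprn_even_ge0.
    rewrite -(@real_normK _ z) ?num_real//.
    set y := `|z|; have y0 : 0 <= y := normr_ge0 z.
    have ky : 0 <= k * y by rewrite mulr_ge0// ltW.
    rewrite -(ler_pM2l k0).
    have -> : k * (k * y ^+ 2 - k ^+ 3 * y ^+ 4) = (k * y) ^+ 2 - (k * y) ^+ 4 by ring.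
    set w := k * y in ky *.
    have [w1|w1] := lerP w 1.
      have : 0 <= w ^+ 4 by rewrite exprn_ge0.
      have : w ^+ 2 <= w by rewrite expr2 ler_piMl.
      lra.
    have : w ^+ 2 <= w ^+ 4 by rewrite ler_weXn2l// ltW.
    lra.
rewrite RintegralB//; try exact: integrableZ_EFin.
rewrite !RintegralZl// gauss_variance//.
have : k ^+ 3 * \int[gauss v]_z z ^+ 4 <= k ^+ 3 * (96 * v ^+ 2).
  by rewrite ler_wpM2l// exprn_ge0// ltW.
have -> : k * v = s / 20 by rewrite /k -sv; field; exact: lt0r_neq0.
have -> : k ^+ 3 * (96 * v ^+ 2) = s * (96 / 8000).
  by rewrite /k -sv; field; exact: lt0r_neq0.
rewrite -[Num.sqrt v]/s; lra.
Qed.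

(* |x + z| - |x| - sgn(x) z vanishes unless |z| >= |x|. *)
Lemma tanaka_decay v x : 0 < v ->
  tanaka v x <= 2 * Num.sqrt v * expR (- (`|x| / Num.sqrt v)) * (2 * expR 2).
Proof.
move=> v0; pose s := Num.sqrt v; have s0 : 0 < s by rewrite sqrtr_gt0.
have sv : s ^+ 2 = v by rewrite sqr_sqrtr// ltW.
pose C := 2 * s * expR (- (`|x| / s)).
have C0 : 0 <= C by rewrite !mulr_ge0 ?expR_ge0// ltW.
have iz : (gauss v).-integrable setT (EFin \o (fun z : R => z)) :=
  @integrable_gauss_expn R v 1 v0.
have iC : (gauss v).-integrable setT (EFin \o (fun z => C * expR (2 / s * `|z|))).
  apply: (@integrable_gauss _ _ C (2 / s)) => //.
    by apply: measurable_funM => //; exact: measurable_exp_norm.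
  by move=> z; rewrite ger0_norm// mulr_ge0// expR_ge0.
have h : \int[gauss v]_z (`|x + z| - `|x| - Num.sg x * z) = tanaka v x.
  rewrite RintegralB//; last 2 first.
  - by apply: integrableB_EFin; [exact: integrable_gauss_abs|exact: integrable_gauss_cst].
  - exact: integrableZ_EFin.
  rewrite RintegralB//; last 2 first.
  - exact: integrable_gauss_abs.
  - exact: integrable_gauss_cst.
  by rewrite RintegralZl// gauss_mean// Rintegral_gauss_cst mulr0 subr0 tanakaE.
rewrite -h; apply: (@le_trans _ _ (\int[gauss v]_z (C * expR (2 / s * `|z|)))).
  apply: le_Rintegral => //.
  - apply: integrableB_EFin; last exact: integrableZ_EFin.
    by apply: integrableB_EFin; [exact: integrable_gauss_abs|exact: integrable_gauss_cst].
  - move=> z _.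
    have [zx|xz] := ltP `|z| `|x|.
      have -> : `|x + z| - `|x| - Num.sg x * z = 0.
        case: (sgrP x) zx => x0; [by rewrite ltNge normr_ge0| |].
        - by rewrite ltr_norml => /andP[? ?]; rewrite gtr0_norm; lra.
        - by rewrite ltr_norml => /andP[? ?]; rewrite ltr0_norm; lra.
      by rewrite mulr_ge0// expR_ge0.
    have h1 : `|x + z| - `|x| - Num.sg x * z <= 2 * `|z|.
      have := ler_normD x z.
      have : - (Num.sg x * z) <= `|z|.
        rewrite -mulNr (le_trans (ler_norm _))// normrM normrN.
        by rewrite normr_sg ler_piMl// lern1 leq_b1.
      lra.
    apply: (le_trans h1); rewrite /C -[_ * _ * expR _ * _]mulrA -expRD -mulrA ler_pM2l//.
    have -> : `|z| = s * (`|z| / s) by rewrite mulrCA divff ?mulr1// lt0r_neq0.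
    rewrite ler_pM2l//; apply: (@le_trans _ _ (expR (`|z| / s))).
      by have := expR_ge1Dx (`|z| / s); lra.
    rewrite ler_expR.
    have : `|x| / s <= `|z| / s by rewrite ler_pM2r// invr_gt0.
    have -> : 2 / s * (s * (`|z| / s)) = 2 * (`|z| / s) by field; exact: lt0r_neq0.
    lra.
rewrite RintegralZl//; last first.
  apply: (@integrable_gauss _ _ 1 (2 / s)) => //; first exact: measurable_exp_norm.
  by move=> z; rewrite mul1r ger0_norm// expR_ge0.
rewrite ler_wpM2l//; apply: (le_trans (Rintegral_gauss_exp_norm _ v0)).
suff -> : (2 / s) ^+ 2 * v / 2 = 2 by [].
by rewrite exprMn exprVn sv; field; exact: lt0r_neq0.
Qed.

End tanaka_kernel.

(** * Integration over independent increments *)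

Section independent_integration.
Context d d' (T : measurableType d) (T' : measurableType d') (R : realType).
Variables (P : probability T R) (g : probability T' R).
Variables (G : set (set T)) (Z : T -> T').
Hypotheses (GI : setI_closed G) (GT : G setT).
Hypothesis Gm : G `<=` measurable.
Hypothesis mZ : measurable_fun setT Z.
Hypothesis indep : forall A B, G A -> measurable B ->
  P (A `&` Z @^-1` B) = (P A * g B)%E.

Local Notation TG := (g_sigma_algebraType G).

Lemma sigma_measurable (A : set T) : (measurable : set (set TG)) A -> measurable A.
Proof. exact: smallest_sub (@sigma_algebra_measurable _ T) Gm A. Qed.

(** For fixed [B] both sides are finite measures in [A] that agree on the pi-system [G], hence on
    the sigma-algebra that it generates. *)
Lemma indep_sigma (A : set TG) (B : set T') : measurable A -> measurable B ->
  P ((A : set T) `&` Z @^-1` B) = (P (A : set T) * g B)%E.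
Proof.
move=> mA mB.
have mZB : measurable (Z @^-1` B) by rewrite -[X in measurable X]setTI; exact: mZ.
have r0 : 0 <= fine (g B) by exact: fine_ge0.
pose m1 : {measure set T -> \bar R} := mrestr P mZB.
pose m2 : {measure set T -> \bar R} := mscale (NngNum r0) P.
have gB : g B = (fine (g B))%:E by rewrite fineK// fin_num_measure.
have m2E C : m2 C = (P C * g B)%E by rewrite muleC [in RHS]gB.
suff : m1 A = m2 A by rewrite m2E.
apply: (@g_sigma_algebra_measure_unique _ _ _ G Gm (fun=> setT) (fun=> GT) _ m1 m2) => //.
- exact: bigcup_const.
- by move=> C GC; rewrite m2E -indep.
- move=> _; apply: (@le_lt_trans _ _ (P setT)); last by rewrite probability_setT ltry.
  by apply: le_measure; rewrite ?inE ?setTI//.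
Qed.

(** Replaces conditional expectation given [G]: the space [T] is given the smaller sigma-algebra, so
    that measurability of [F] encodes adaptedness in the first variable, and the law of (w, Z w) is
    then a product measure to which Tonelli applies. *)
Lemma integral_indep (F : TG * T' -> \bar R) :
  measurable_fun setT F -> (forall p, 0 <= F p)%E ->
  (\int[P]_w F (w, Z w) = \int[P]_w \int[g]_z F (w, z))%E.
Proof.
move=> mF F0.
have mid : measurable_fun setT (fun w : T => w : TG).
  by move=> _ B mB; rewrite setTI; exact: sigma_measurable.
have mpair : measurable_fun setT (fun w : T => (w : TG, Z w)).
  exact: measurable_fun_pair.
pose X1 : {mfun T >-> TG} := HB.pack (fun w : T => w : TG) (isMeasurableFun.Build _ _ _ _ _ mid).
pose X2 : {mfun T >-> (TG * T')%type} :=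
  HB.pack (fun w : T => (w : TG, Z w)) (isMeasurableFun.Build _ _ _ _ _ mpair).
rewrite -[LHS](@ge0_integral_distribution _ _ _ _ _ P X2 F)//.
have -> : (\int[distribution P X2]_y F y = \int[distribution P X1 \x g]_y F y)%E.
  apply: eq_measure_integral => A mA _.
  apply/esym; apply: product_measure_unique => //.
  move=> B C mB mC; rewrite /distribution /pushforward /=.
  by rewrite -indep_sigma.
rewrite fubini_tonelli1//.
rewrite -[RHS](@ge0_integral_distribution _ _ _ _ _ P X1 (fun w => \int[g]_z F (w, z))%E)//.
- exact: measurable_fun_fubini_tonelli_F.
- by move=> w; exact: integral_ge0.
Qed.

End independent_integration.

(** * Brownian motion on a grid and its discrete past *)

Section brownian_steps.
Context d (T : measurableType d) (R : realType) (P : probability T R).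
Variables (W : R -> {RV P >-> R}).
Hypothesis hW : brownian_motion W.

(** [W 0] vanishes only almost surely. After the subtraction, grid positions are exactly sums of
    increments, hence measurable with respect to the past for every outcome. *)
Definition bm (t : R) (w : T) : R := W t w - W 0 w.

Definition incr (v : R) (i : nat) (w : T) : R :=
  W (v * i.+1%:R) w - W (v * i%:R) w.

(** Cylinder events of the first [j] increments: a pi-system generating the discrete filtration. *)
Definition past (v : R) (j : nat) : set (set T) :=
  [set A | exists2 B : nat -> set R, (forall i, measurable (B i)) &
    A = [set w | forall i, (i < j)%N -> B i (incr v i w)]].

Lemma bmS v i w : bm (v * i.+1%:R) w = bm (v * i%:R) w + incr v i w.
Proof. by rewrite /bm /incr; ring. Qed.

Lemma bm0 w : bm 0 w = 0. Proof. by rewrite /bm subrr. Qed.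

Lemma measurable_bm t : measurable_fun setT (bm t).
Proof. exact: measurable_funB. Qed.

Lemma measurable_incr v i : measurable_fun setT (incr v i).
Proof. exact: measurable_funB. Qed.

Lemma past_setI v j : setI_closed (past v j).
Proof.
move=> _ _ [A mA ->] [B mB ->]; exists (fun i => A i `&` B i).
  by move=> i; exact: measurableI.
apply/seteqP; split => w /=.
  by move=> [hA hB] i ij; split; [exact: hA|exact: hB].
by move=> h; split => i /h [].
Qed.

Lemma past_setT v j : past v j setT.
Proof.
by exists (fun=> setT) => //; apply/seteqP; split.
Qed.

Lemma past_measurable v j : past v j `<=` measurable.
Proof.
move=> _ [B mB ->].
have -> : [set w | forall i, (i < j)%N -> B i (incr v i w)] =
    \bigcap_(i in `I_j) (incr v i @^-1` B i) by [].
apply: fin_bigcap_measurable => // i _.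
by rewrite -[X in measurable X]setTI; exact: measurable_incr.
Qed.

Lemma incr_past v j i : (i < j)%N ->
  measurable_fun setT (incr v i : g_sigma_algebraType (past v j) -> R).
Proof.
move=> ij _ B mB; rewrite setTI; apply: sub_sigma_algebra.
exists (fun k => if k == i then B else setT).
  by move=> k; case: ifP.
apply/seteqP; split => w /=; first by move=> Bw k _; case: eqP => // ->.
by move=> /(_ _ ij); rewrite eqxx.
Qed.

Lemma bm_past v j k : (k <= j)%N ->
  measurable_fun setT (bm (v * k%:R) : g_sigma_algebraType (past v j) -> R).
Proof.
elim: k => [|k IH] kj.
  rewrite (_ : bm _ = cst 0); first exact: measurable_cst.
  by apply/funext => w; rewrite mulr0 bm0.
rewrite (_ : bm _ = (fun w => bm (v * k%:R) w + incr v k w)); last first.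
  by apply/funext => w; exact: bmS.
by apply: measurable_funD; [apply: IH; exact: ltnW|exact: incr_past].
Qed.

Lemma increment_law (s t : R) (B : set R) : 0 <= s -> s < t -> measurable B ->
  P [set w | B (W t w - W s w)] = gauss (t - s) B.
Proof. by case: hW => _ _ h _ s0 st mB; exact: h. Qed.

(** Compare the product rule for [j.+1] increments, with [B] as last set, to the rule for the first
    [j]. *)
Lemma incr_indep v j A (B : set R) : 0 < v -> past v j A -> measurable B ->
  P (A `&` incr v j @^-1` B) = (P A * gauss v B)%E.
Proof.
move=> v0 [C mC ->] mB; have [_ hI hN _] := hW.
have t0 : 0 <= v * 0%:R by rewrite mulr0.
have ti i n : (i < n)%N -> v * i%:R <= v * i.+1%:R.
  by move=> _; rewrite ler_wpM2l ?(ltW v0)// ler_nat.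
have -> : [set w | forall i, (i < j)%N -> C i (incr v i w)] `&` incr v j @^-1` B =
    [set w | forall i, (i < j.+1)%N ->
      (if i == j then B else C i) (W (v * i.+1%:R) w - W (v * i%:R) w)].
  apply/seteqP; split => w /=.
    move=> [h1 h2] i; rewrite ltnS leq_eqVlt; case: eqP => [->|_ /= ij] //.
    exact: h1.
  move=> h; split; last by have := h j (ltnSn j); rewrite eqxx.
  by move=> i ij; have := h i (ltnW ij); rewrite (ltn_eqF ij).
rewrite (hI j.+1 (fun i => v * i%:R) (fun i => if i == j then B else C i))//; last 2 first.
  by move=> i ij; exact: (ti _ j.+1).
  by move=> i _; case: ifP.
rewrite (hI j (fun i => v * i%:R) C)//; last by move=> i ij; exact: (ti _ j).
rewrite big_ord_recr; congr (_ * _)%E.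
  apply: eq_bigr => i _; congr (P _); apply/funext => w.
  by rewrite -[nat_of_ord (widen_ord _ i)]/(nat_of_ord i) (ltn_eqF (ltn_ord i)).
rewrite (_ : [set w | _] = [set w | B (W (v * j.+1%:R) w - W (v * j%:R) w)]); last first.
  by apply/funext => w; rewrite -[nat_of_ord ord_max]/j eqxx.
have hv : v * j.+1%:R - v * j%:R = v by rewrite -natr1; ring.
have s0 : 0 <= v * j%:R by rewrite mulr_ge0// ltW.
have st : v * j%:R < v * j.+1%:R by rewrite ltr_pM2l// ltr_nat.
by have := increment_law s0 st mB; rewrite hv.
Qed.

Lemma integral_incr v j (F : g_sigma_algebraType (past v j) * measurableTypeR R -> \bar R) :
  0 < v -> measurable_fun setT F -> (forall p, 0 <= F p)%E ->
  (\int[P]_w F (w, incr v j w) = \int[P]_w \int[gauss v]_z F (w, z))%E.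
Proof.
move=> v0 mF F0.
have h A B : past v j A -> measurable B ->
  P (A `&` incr v j @^-1` B) = (P A * gauss v B)%E by move=> *; exact: incr_indep.
exact: (@integral_indep _ _ _ (measurableTypeR R) _ P (gauss v) (past v j) (incr v j)
  (@past_setI v j) (past_setT v j) (@past_measurable v j)
  (measurable_incr v j) h F mF F0).
Qed.

Lemma integral_increment (s t : R) (f : R -> \bar R) : 0 <= s -> s < t ->
  measurable_fun setT f -> (forall x, 0 <= f x)%E ->
  (\int[P]_w f (W t w - W s w)%R = \int[gauss (t - s)]_z f z)%E.
Proof.
move=> s0 st mf f0.
have mD : @measurable_fun _ _ T (measurableTypeR R) setT (fun w => W t w - W s w).
  exact: measurable_funB.
pose X : {mfun T >-> measurableTypeR R} :=
  HB.pack (fun w => W t w - W s w) (isMeasurableFun.Build _ _ _ _ _ mD).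
rewrite -[LHS](@ge0_integral_distribution _ _ _ _ _ P X f)//.
by apply: eq_measure_integral => A mA _; have := increment_law s0 st mA.
Qed.

End brownian_steps.

(** * Exponential bounds for sums of kernels *)

Section gauss_iterates.
Context {R : realType}.
Implicit Types (v x y z : R).

Lemma lipschitz_measurable (f : R -> R) :
  (forall x y, `|f x - f y| <= `|x - y|) -> measurable_fun setT f.
Proof.
move=> hf; apply: continuous_measurable_fun => x.
apply/cvgrPdist_lt => e e0; near=> y.
apply: (le_lt_trans (hf x y)); near: y.
by apply/nbhs_ballP; exists e.
Unshelve. all: by end_near. Qed.

Lemma integral_gaussE v (g : R -> R) :
  (gauss v).-integrable setT (EFin \o g) ->
  (\int[gauss v]_z (g z)%:E = (\int[gauss v]_z g z)%:E)%E.
Proof. by move=> ig; rewrite /Rintegral fineK//; exact: integrable_fin_num. Qed.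

Lemma measurable_gauss_abs v : 0 < v -> measurable_fun setT (gauss_abs v).
Proof.
by move=> v0; apply: lipschitz_measurable => x y; exact: gauss_abs_lipschitz.
Qed.

Lemma measurable_tanaka v : 0 < v -> measurable_fun setT (tanaka v).
Proof.
move=> v0; rewrite (_ : tanaka v = fun x => gauss_abs v x - `|x|); last first.
  by apply/funext => x; exact: tanakaE.
apply: measurable_funB; first exact: measurable_gauss_abs.
exact: normr_measurable.
Qed.

Lemma integrable_lipschitz v (f : R -> R) x : 0 < v ->
  (forall x y, `|f x - f y| <= `|x - y|) ->
  (gauss v).-integrable setT (EFin \o (fun z => f (x + z))).
Proof.
move=> v0 hf; apply: (@integrable_gauss _ _ (`|f x| + 1) 1) => //.
  apply: measurableT_comp; first exact: lipschitz_measurable.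
  exact: measurable_funD.
move=> z; rewrite mul1r.
have h : `|f (x + z)| <= `|f x| + `|z|.
  have := hf (x + z) x; rewrite [x + z]addrC addrK => h.
  by rewrite -[f (z + x)](subrK (f x)) addrC (le_trans (ler_normD _ _))// lerD2l.
apply: (le_trans h); have := expR_ge1Dx `|z|; have z0 := normr_ge0 z => e1.
have e2 : 1 <= expR `|z| by lra.
by have := ler_peMr (normr_ge0 (f x)) e2; lra.
Qed.

Fixpoint gauss_iter v k x : R :=
  if k is k'.+1 then \int[gauss v]_z gauss_iter v k' (x + z) else `|x|.

Lemma gauss_iter_lipschitz v k x y : 0 < v ->
  `|gauss_iter v k x - gauss_iter v k y| <= `|x - y|.
Proof.
move=> v0; elim: k x y => [|k IH] x y /=; first exact: ler_dist_dist.
rewrite -RintegralB//; try by apply: integrable_lipschitz => // *; exact: IH.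
apply: (le_trans (le_normr_Rintegral _ _)) => //.
  by apply: integrableB_EFin; apply: integrable_lipschitz => // *; exact: IH.
rewrite -[leRHS](Rintegral_gauss_cst v); apply: le_Rintegral => //.
- apply: integrable_norm.
  by apply: integrableB_EFin; apply: integrable_lipschitz => // *; exact: IH.
- exact: integrable_gauss_cst.
- move=> z _; apply: (le_trans (IH _ _)).
  by have -> : x + z - (y + z) = x - y by ring.
Qed.

Lemma integrable_gauss_iter v k x : 0 < v ->
  (gauss v).-integrable setT (EFin \o (fun z => gauss_iter v k (x + z))).
Proof.
by move=> v0; apply: integrable_lipschitz => // ? ?; exact: gauss_iter_lipschitz.
Qed.

Lemma gauss_iter_ge v k x : 0 < v -> `|x| <= gauss_iter v k x.
Proof.
move=> v0; elim: k x => [//|k IH] x /=.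
apply: (le_trans (gauss_abs_ge x v0)); apply: le_Rintegral => //.
- exact: integrable_gauss_abs.
- exact: integrable_gauss_iter.
Qed.

(** Induction with the tangent bound sqrt y <= y / (2 b) + b / 2, where b is the target value; [q]
    is this bound as a polynomial in z and integrates exactly to b. *)
Lemma gauss_iter_le v k x : 0 < v ->
  gauss_iter v k x <= Num.sqrt (x ^+ 2 + v * k%:R).
Proof.
move=> v0; elim: k x => [|k IH] x /=.
  by rewrite mulr0 addr0 sqrtr_sqr.
pose b := Num.sqrt (x ^+ 2 + v * k.+1%:R).
have b0' : 0 < x ^+ 2 + v * k.+1%:R.
  by rewrite ltr_wpDl ?sqr_ge0// mulr_gt0// ltr0n.
have b0 : 0 < b by rewrite sqrtr_gt0.
have b2 : b ^+ 2 = x ^+ 2 + v * k.+1%:R by rewrite sqr_sqrtr// ltW.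
pose q z := (2 * b)^-1 * z ^+ 2 + (x / b * z + ((x ^+ 2 + v * k%:R) / (2 * b) + b / 2)).
have i2 : (gauss v).-integrable setT (EFin \o (fun z : R => z ^+ 2)) :=
  @integrable_gauss_expn R v 2 v0.
have i1 : (gauss v).-integrable setT (EFin \o (fun z : R => z)) :=
  @integrable_gauss_expn R v 1 v0.
have i3 : (gauss v).-integrable setT (EFin \o
    (fun z => x / b * z + ((x ^+ 2 + v * k%:R) / (2 * b) + b / 2))).
  by apply: integrableD_EFin; [exact: integrableZ_EFin|exact: integrable_gauss_cst].
have hq : \int[gauss v]_z q z = b.
  rewrite /q RintegralD//; last exact: integrableZ_EFin.
  rewrite RintegralD//; last 2 first.
    exact: integrableZ_EFin.
    exact: integrable_gauss_cst.
  rewrite !RintegralZl// gauss_variance// gauss_mean// Rintegral_gauss_cst.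
  rewrite mulr0 add0r.
  have -> : (2 * b)^-1 * v + ((x ^+ 2 + v * k%:R) / (2 * b) + b / 2) =
      (x ^+ 2 + v * k.+1%:R) / (2 * b) + b / 2.
    by rewrite -natr1; field; exact: lt0r_neq0.
  by rewrite -b2; field; exact: lt0r_neq0.
rewrite -/b -[leRHS]hq; apply: le_Rintegral => //.
- exact: integrable_gauss_iter.
- by apply: integrableD_EFin => //; exact: integrableZ_EFin.
- move=> z _; apply: (le_trans (IH _)).
  set y := (x + z) ^+ 2 + v * k%:R.
  have y0 : 0 <= y by rewrite addr_ge0 ?sqr_ge0// mulr_ge0// ltW.
  have -> : q z = y / (2 * b) + b / 2.
    by rewrite /q /y; field; exact: lt0r_neq0.
  have sy : Num.sqrt y ^+ 2 = y by rewrite sqr_sqrtr.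
  rewrite -subr_ge0 -{1}sy.
  have -> : Num.sqrt y ^+ 2 / (2 * b) + b / 2 - Num.sqrt y =
      (2 * b)^-1 * (Num.sqrt y - b) ^+ 2 by field; exact: lt0r_neq0.
  by rewrite mulr_ge0 ?sqr_ge0// invr_ge0 mulr_ge0// ltW.
Qed.

(** By [gauss_potential_step] this is the expected sum of [tanaka v] over the [k] successive
    positions, starting with x, of a Gaussian walk of step variance [v]. *)
Definition gauss_potential v k x := gauss_iter v k x - `|x|.

Lemma gauss_potential_ge0 v k x : 0 < v -> 0 <= gauss_potential v k x.
Proof. by move=> v0; rewrite subr_ge0 gauss_iter_ge. Qed.

Lemma gauss_potential_le v k x : 0 < v ->
  gauss_potential v k x <= Num.sqrt (v * k%:R).
Proof.
move=> v0; rewrite lerBlDl (le_trans (gauss_iter_le _ _ v0))//.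
have s0 : 0 <= Num.sqrt (v * k%:R) by exact: sqrtr_ge0.
have vk : 0 <= v * k%:R by rewrite mulr_ge0// ltW.
rewrite -ler_sqr ?nnegrE ?addr_ge0 ?sqrtr_ge0// sqr_sqrtr ?addr_ge0 ?sqr_ge0//.
rewrite sqrrD real_normK ?num_real// sqr_sqrtr//.
by rewrite lerD2r lerDl mulrn_wge0// mulr_ge0.
Qed.

Lemma gauss_potential_step v k x : 0 < v ->
  \int[gauss v]_z gauss_potential v k (x + z) =
  gauss_potential v k.+1 x - tanaka v x.
Proof.
move=> v0; rewrite RintegralB//; last 2 first.
  exact: integrable_gauss_iter.
  exact: integrable_gauss_abs.
by rewrite /gauss_potential tanakaE /gauss_abs /=; ring.
Qed.

Lemma integrable_gauss_potential v k x : 0 < v ->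
  (gauss v).-integrable setT (EFin \o (fun z => gauss_potential v k (x + z))).
Proof.
move=> v0; apply: integrableB_EFin; first exact: integrable_gauss_iter.
exact: integrable_gauss_abs.
Qed.

Lemma integrable_tanaka v u x : 0 < v -> 0 < u ->
  (gauss v).-integrable setT (EFin \o (fun z => tanaka u (x + z))).
Proof.
move=> v0 u0.
rewrite (_ : (fun z => _) = (fun z => gauss_abs u (x + z) - `|x + z|)); last first.
  by apply/funext => z; exact: tanakaE.
apply: integrableB_EFin; last exact: integrable_gauss_abs.
by apply: integrable_lipschitz => // ? ?; exact: gauss_abs_lipschitz.
Qed.

Lemma measurable_gauss_potential v k : 0 < v ->
  measurable_fun setT (gauss_potential v k).
Proof.
move=> v0; apply: measurable_funB; last exact: normr_measurable.
by apply: lipschitz_measurable => x y; exact: gauss_iter_lipschitz.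
Qed.

End gauss_iterates.

Section exponential_supermartingales.
Context d (T : measurableType d) (R : realType) (P : probability T R).
Variables (W : R -> {RV P >-> R}).
Hypothesis hW : brownian_motion W.
Local Notation X := (bm W).
Local Notation zeta := (incr W).
Local Notation Past := (past W).

(** One step of a supermartingale argument: [rho] bounds the integral over the next increment with
    the past frozen. *)
Lemma integral_incr_le (v : R) j (F : g_sigma_algebraType (Past v j) * measurableTypeR R -> R)
    (rho : T -> R) : 0 < v -> measurable_fun setT F -> (forall p, 0 <= F p) ->
  measurable_fun setT rho ->
  (forall w, (gauss v).-integrable setT (EFin \o (fun z => F (w, z)))) ->
  (forall w, \int[gauss v]_z F (w, z) <= rho w) ->
  (\int[P]_w (F (w, zeta v j w))%:E <= \int[P]_w (rho w)%:E)%E.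
Proof.
move=> v0 mF F0 mr iF Fr.
have -> : (\int[P]_w (F (w, zeta v j w))%:E =
    \int[P]_w \int[gauss v]_z (F (w, z))%:E)%E.
  apply: (integral_incr hW (F := EFin \o F)) => //.
  exact/measurable_EFinP.
have hE : (fun w => \int[gauss v]_z (F (w, z))%:E)%E =
    (fun w => (\int[gauss v]_z F (w, z))%:E).
  by apply/funext => w; rewrite (integral_gaussE (iF w)).
rewrite hE.
apply: ge0_le_integral => //.
- by move=> w _; rewrite lee_fin; apply: Rintegral_ge0.
- rewrite -hE.
  have mid : measurable_fun setT (fun w : T => w : g_sigma_algebraType (Past v j)).
    by move=> _ B mB; rewrite setTI; apply: sigma_measurable mB; exact: past_measurable.
  have mE : measurable_fun setT (EFin \o F) by exact/measurable_EFinP.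
  apply: (measurableT_comp (f := fun w : g_sigma_algebraType (Past v j) =>
    \int[gauss v]_z (F (w, z))%:E)%E) mid.
  apply: (measurable_fun_fubini_tonelli_F (m2 := gauss v) (EFin \o F)) => //.
- exact/measurable_EFinP.
- by move=> w _; rewrite lee_fin.
Qed.

(** No convolution of densities is computed: both sides are the expectation of |x + W (2v) - W 0|,
    taken in one step or in two independent steps. *)
Lemma gauss_abs_halving (v x : R) : 0 < v ->
  \int[gauss v]_z gauss_abs v (x + z) = gauss_abs (v + v) x.
Proof.
move=> v0; apply: EFin_inj.
have iA : (gauss v).-integrable setT (EFin \o (fun z => gauss_abs v (x + z))).
  by apply: integrable_lipschitz => // ? ?; exact: gauss_abs_lipschitz.
rewrite -[LHS](integral_gaussE iA).
have vv : 0 < v + v by rewrite addr_gt0.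
rewrite [RHS](_ : _ = (\int[gauss (v + v)]_z (`|x + z|)%:E)%E); last first.
  exact: esym (integral_gaussE (integrable_gauss_abs x vv)).
have m0 : measurable_fun setT (fun z : R => (`|x + z|)%:E).
  by apply/measurable_EFinP; exact: measurable_abs_shift.
have := @integral_increment _ _ _ P W hW 0 (v + v) (fun z => (`|x + z|)%:E) (lexx _) vv m0.
rewrite subr0 => e2v; rewrite -[RHS]e2v; last by move=> z; rewrite lee_fin.
have m1 : measurable_fun setT (fun z : R => (gauss_abs v (x + z))%:E).
  apply/measurable_EFinP; apply: measurableT_comp; first exact: measurable_gauss_abs.
  exact: measurable_funD.
have := @integral_increment _ _ _ P W hW 0 v (fun z => (gauss_abs v (x + z))%:E) (lexx _) v0 m1.
rewrite subr0 => ev; rewrite -[LHS]ev; last first.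
  by move=> z; rewrite lee_fin (le_trans _ (gauss_abs_ge _ v0)).
pose F (p : g_sigma_algebraType (Past v 1) * measurableTypeR R) : \bar R :=
  (`|(x + X (v * 1%:R) p.1) + p.2|)%:E.
have mF : measurable_fun setT F.
  apply/measurable_EFinP; apply: measurableT_comp; first exact: normr_measurable.
  apply: measurable_funD; last exact: measurable_snd.
  apply: measurable_funD; first exact: measurable_cst.
  by apply: measurableT_comp; [exact: (@bm_past _ _ _ P W v 1 1)|exact: measurable_fst].
have F0 p : (0 <= F p)%E by rewrite lee_fin.
transitivity (\int[P]_w F (w, zeta v 1 w))%E; last first.
  apply: eq_integral => w _; rewrite /F /= /bm /incr mulr1.
  by congr (`|_|%:E); rewrite [v * 2]mulrDr mulr1; ring.
rewrite (integral_incr hW v0 mF F0); apply: eq_integral => w _.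
rewrite -integral_gaussE; last exact: integrable_gauss_abs.
by rewrite /F /= /bm mulr1.
Qed.

End exponential_supermartingales.

Section halving.
Context d (T : measurableType d) (R : realType) (P : probability T R).
Variables (W : R -> {RV P >-> R}).
Hypothesis hW : brownian_motion W.

(** This exact additivity is why this kernel is used: refining the time grid at a constant level
    produces no bias. *)
Lemma tanaka_step (v x : R) : 0 < v ->
  \int[gauss v]_z tanaka v (x + z) = tanaka (v + v) x - tanaka v x.
Proof.
move=> v0; rewrite (_ : (fun z => _) = (fun z => gauss_abs v (x + z) - `|x + z|)); last first.
  by apply/funext => z; exact: tanakaE.
rewrite RintegralB//; last 2 first.
- by apply: integrable_lipschitz => // ? ?; exact: gauss_abs_lipschitz.
- exact: integrable_gauss_abs.
rewrite [X in X - _](gauss_abs_halving hW x v0) -[X in _ - X]/(gauss_abs v x).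
rewrite !tanakaE; move: (gauss_abs (v + v) x) (gauss_abs v x) => A B; ring.
Qed.

End halving.

Section exponential_martingale_bounds.
Context d (T : measurableType d) (R : realType) (P : probability T R).
Variables (W : R -> {RV P >-> R}).
Hypothesis hW : brownian_motion W.
Local Notation X := (bm W).
Implicit Types (v c theta x y z : R).

(** Here g is theta times the kernel at the present position and rho is theta times the potential
    still to come. It combines e^g (1 - g) <= 1 with (1 - g) (1 + 2 rho) >= 1 + 2 rho - 2 g. *)
Lemma exp_potential_step g rho : 0 <= g -> 0 <= rho -> rho <= 1 / 2 ->
  expR g * (1 + 2 * rho - 2 * g) <= 1 + 2 * rho :> R.
Proof.
move=> g0 r0 r1; have e0 := expR_gt0 g.
have h : expR g * (1 - g) <= 1.
  have ee : expR g * expR (- g) = 1 by rewrite -expRD subrr expR0.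
  by rewrite -[leRHS]ee ler_wpM2l ?(ltW e0)//; exact: expR_ge1Dx.
apply: (@le_trans _ _ (expR g * ((1 - g) * (1 + 2 * rho)))).
  rewrite ler_wpM2l ?(ltW e0)//.
  have h2 : 0 <= g * (1 - 2 * rho) by rewrite mulr_ge0//; lra.
  lra.
by rewrite mulrA ler_piMl//; lra.
Qed.

Lemma measurable_tanaka_past v u c j i : 0 < u -> (i <= j)%N ->
  measurable_fun setT ((fun w => tanaka u (X (v * i%:R) w - c)) :
    g_sigma_algebraType (past W v j) -> R).
Proof.
move=> u0 ij; apply: (measurableT_comp (measurable_tanaka u0)).
by apply: measurable_funB; [exact: bm_past|exact: measurable_cst].
Qed.

(** A discrete Khasminskii lemma: an additive functional whose expected total is small from every
    starting point has a bounded exponential moment. *)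
Lemma exp_tanaka_sum_le v c theta a k : 0 < v -> 0 <= theta ->
  theta * Num.sqrt (v * k%:R) <= 1 / 4 ->
  (\int[P]_w (expR (theta * \sum_(i < k) tanaka v (X (v * (a + i)%:R) w - c)))%:E
     <= 2%:E)%E.
Proof.
move=> v0 t0 tk.
pose S j w := \sum_(i < j) tanaka v (X (v * (a + i)%:R) w - c).
(* The weight compensates the growth of the exponential: [M] decreases in mean, dominates the
   exponential of the full sum at j = k, and is at most 1 + 2/4 at j = 0. *)
pose M j w := expR (theta * S j w) *
  (1 + 2 * theta * gauss_potential v (k - j) (X (v * (a + j)%:R) w - c)).
have r_le j y : (j <= k)%N -> theta * gauss_potential v j y <= 1 / 4.
  move=> jk; apply: le_trans tk; rewrite ler_wpM2l//.
  apply: (le_trans (gauss_potential_le _ _ v0)); rewrite ler_sqrt.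
    by rewrite ler_wpM2l ?(ltW v0)// ler_nat.
  by rewrite mulr_ge0// ltW.
have r_ge j y : 0 <= theta * gauss_potential v j y.
  by rewrite mulr_ge0// gauss_potential_ge0.
have mS i j : (j <= i.+1)%N ->
    measurable_fun setT (S j : g_sigma_algebraType (past W v (a + i)) -> R).
  move=> ji; apply: measurable_sum => l.
  apply: measurable_tanaka_past => //.
  by rewrite leq_add2l -ltnS (leq_trans (ltn_ord l)).
have sigT i (f : T -> R) :
    measurable_fun setT (f : g_sigma_algebraType (past W v (a + i)) -> R) ->
    measurable_fun setT f.
  move=> mf; have mid : measurable_fun setT (fun w : T => w : g_sigma_algebraType (past W v (a + i))).
    by move=> _ B mB; rewrite setTI; apply: sigma_measurable mB; exact: past_measurable.
  exact: (measurableT_comp mf mid).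
have mM' i : measurable_fun setT (M i : g_sigma_algebraType (past W v (a + i)) -> R).
  apply: measurable_funM.
    by apply: measurableT_comp => //; apply: measurable_funM => //; exact: mS.
  apply: measurable_funD => //; apply: measurable_funM => //.
  apply: (measurableT_comp (measurable_gauss_potential _ v0)).
  by apply: measurable_funB => //; exact: bm_past.
have mM i : measurable_fun setT (M i) by apply: (sigT i); exact: mM'.
have M0 i w : 0 <= M i w.
  by rewrite mulr_ge0 ?expR_ge0// addr_ge0// -mulrA mulr_ge0.
have step j : (j < k)%N -> (\int[P]_w (M j.+1 w)%:E <= \int[P]_w (M j w)%:E)%E.
  move=> jk.
  pose F (p : g_sigma_algebraType (past W v (a + j)) * measurableTypeR R) :=
    expR (theta * S j.+1 p.1) *
    (1 + 2 * theta * gauss_potential v (k - j.+1) (X (v * (a + j)%:R) p.1 - c + p.2)).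
  have mF : measurable_fun setT F.
    apply: measurable_funM.
      apply: measurableT_comp => //; apply: measurable_funM => //.
      by apply: measurableT_comp; [exact: mS|exact: measurable_fst].
    apply: measurable_funD => //; apply: measurable_funM => //.
    apply: (measurableT_comp (measurable_gauss_potential _ v0)).
    apply: measurable_funD; last exact: measurable_snd.
    apply: measurable_funB => //.
    by apply: measurableT_comp; [exact: bm_past|exact: measurable_fst].
  have F0 p : 0 <= F p.
    by rewrite mulr_ge0 ?expR_ge0// addr_ge0// -mulrA mulr_ge0.
  have iF w : (gauss v).-integrable setT (EFin \o (fun z => F (w, z))).
    rewrite /F /=; apply: integrableZ_EFin; apply: integrableD_EFin.
      exact: integrable_gauss_cst.
    by apply: integrableZ_EFin; exact: integrable_gauss_potential.
  have -> : (\int[P]_w (M j.+1 w)%:E = \int[P]_w (F (w, incr W v (a + j) w))%:E)%E.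
    apply: eq_integral => w _; congr EFin; rewrite /M /F /=; congr (_ * (_ + _ * gauss_potential _ _ _)).
    by rewrite addnS bmS; ring.
  apply: (integral_incr_le hW v0 mF F0 (mM j) iF) => w.
  rewrite /F /=.
  rewrite RintegralZl//; last first.
    apply: integrableD_EFin; first exact: integrable_gauss_cst.
    by apply: integrableZ_EFin; exact: integrable_gauss_potential.
  rewrite RintegralD//; last 2 first.
    exact: integrable_gauss_cst.
    by apply: integrableZ_EFin; exact: integrable_gauss_potential.
  rewrite Rintegral_gauss_cst RintegralZl//; last exact: integrable_gauss_potential.
  rewrite gauss_potential_step// subnSK//.
  rewrite /M /S big_ord_recr /= -/(S j w).
  set y := X _ w - c; rewrite [theta * (_ + _)]mulrDr expRD -mulrA ler_wpM2l ?expR_ge0//.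
  have := @exp_potential_step (theta * tanaka v y) (theta * gauss_potential v (k - j) y).
  rewrite mulr_ge0 ?tanaka_ge0// r_ge => /(_ isT isT).
  have -> : theta * gauss_potential v (k - j) y <= 1 / 2.
    by have := r_le (k - j)%N y (leq_subr _ _); lra.
  move=> /(_ isT); rewrite -[2 * theta * gauss_potential _ _ _]mulrA.
  by apply: le_trans; rewrite le_eqVlt; apply/orP; left; apply/eqP; congr (_ * _); ring.
have Mk j : (j <= k)%N -> (\int[P]_w (M j w)%:E <= \int[P]_w (M 0%N w)%:E)%E.
  elim: j => [//|j IH] jk; apply: (le_trans (step j jk)); apply: IH; exact: ltnW.
apply: (@le_trans _ _ (\int[P]_w (M k w)%:E)%E).
  apply: ge0_le_integral => //.
  - apply/measurable_EFinP/measurableT_comp => //; apply: measurable_funM => //.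
    by apply: (sigT k); apply: mS; exact: leqnSn.
  - exact/measurable_EFinP.
  - move=> w _; rewrite lee_fin /M -/(S k w) ler_peMr ?expR_ge0//.
    by rewrite lerDl -mulrA mulr_ge0.
apply: (le_trans (Mk k (leqnn k))).
apply: (@le_trans _ _ (\int[P]_w (2%:E))%E).
  apply: ge0_le_integral => //.
  - by move=> w _; rewrite lee_fin.
  - exact/measurable_EFinP.
  - move=> w _; rewrite lee_fin /M /S big_ord0 mulr0 expR0 mul1r subn0.
    by have := r_le k (X (v * (a + 0)%:R) w - c) (leqnn k); lra.
by rewrite integral_cst//= probability_setT mule1.
Qed.

Lemma expR_le_quadratic x : `|x| <= 1 / 4 -> expR x <= 1 + x + x ^+ 2.
Proof.
move=> hx; have /andP[x1 x2] : - (1 / 4) <= x <= 1 / 4 by rewrite -ler_norml.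
pose u := x / 2; have xu : x = u + u by rewrite /u; lra.
have h : expR u * (1 - u) <= 1.
  have ee : expR u * expR (- u) = 1 by rewrite -expRD subrr expR0.
  by rewrite -[leRHS]ee ler_wpM2l ?expR_ge0//; exact: expR_ge1Dx.
have u1 : 0 < (1 - u) ^+ 2 by rewrite exprn_gt0//; rewrite /u; lra.
rewrite -(ler_pM2r u1); apply: (@le_trans _ _ 1).
  rewrite {1}xu expRD.
  have -> : expR u * expR u * (1 - u) ^+ 2 = (expR u * (1 - u)) ^+ 2 by ring.
  rewrite expr_le1// mulr_ge0 ?expR_ge0//; rewrite /u; lra.
have -> : (1 + x + x ^+ 2) * (1 - u) ^+ 2 =
   1 + x ^+ 2 / 4 * (1 - 3 * x + x ^+ 2) by rewrite /u; field.
rewrite lerDl mulr_ge0//; first by rewrite mulr_ge0 ?sqr_ge0.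
by have := sqr_ge0 x; lra.
Qed.

(* A martingale difference, by [tanaka_step]. *)
Definition tanaka_increment v c i w : R :=
  tanaka v (X (v * i.*2%:R) w - c) + tanaka v (X (v * i.*2.+1%:R) w - c)
  - tanaka (v + v) (X (v * i.*2%:R) w - c).

(** The increment is t - m, where t = [tanaka v (x + z)] lies in [0, sqrt v] and has mean m. Its
    variance is at most sqrt v times m, which is proportional to the kernel instead of being merely
    of order v, so that it is small away from the level. *)
Lemma exp_tanaka_increment_le v theta x : 0 < v ->
  `|theta| * Num.sqrt v <= 1 / 4 ->
  \int[gauss v]_z expR (theta * (tanaka v x + tanaka v (x + z) - tanaka (v + v) x))
    <= expR (theta ^+ 2 * Num.sqrt v * tanaka (v + v) x).
Proof.
move=> v0 hth; have vv : 0 < v + v by rewrite addr_gt0.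
have sv0 : 0 <= Num.sqrt v := sqrtr_ge0 v.
pose m := tanaka (v + v) x - tanaka v x.
have it : (gauss v).-integrable setT (EFin \o (fun z => tanaka v (x + z))).
  exact: integrable_tanaka.
have mt : measurable_fun setT (fun z : R => tanaka v (x + z)).
  apply: (measurableT_comp (measurable_tanaka v0)); exact: measurable_funD.
have tb y : 0 <= tanaka v y <= Num.sqrt v by rewrite tanaka_ge0// tanaka_le.
have hm : \int[gauss v]_z tanaka v (x + z) = m by exact: (tanaka_step hW).
have mb : 0 <= m <= Num.sqrt v.
  rewrite -hm; apply/andP; split.
    by apply: Rintegral_ge0 => z _; case/andP: (tb (x + z)).
  rewrite -[leRHS](Rintegral_gauss_cst v); apply: le_Rintegral => //.
    exact: integrable_gauss_cst.
  by move=> z _; case/andP: (tb (x + z)).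
(* The quadratic bound of the exponential, with t^2 replaced by sqrt v * t: [q] is affine in t, so
   only the mean of t is needed. *)
pose q z := 1 + theta * (tanaka v (x + z) - m) +
   theta ^+ 2 * (Num.sqrt v * tanaka v (x + z) - m * (2 * tanaka v (x + z) - m)).
have i1 : (gauss v).-integrable setT (EFin \o (fun z => theta * (tanaka v (x + z) - m))).
  apply: integrableZ_EFin; apply: integrableB_EFin => //; exact: integrable_gauss_cst.
have i2 : (gauss v).-integrable setT (EFin \o (fun z => m * (2 * tanaka v (x + z) - m))).
  apply: integrableZ_EFin; apply: integrableB_EFin; last exact: integrable_gauss_cst.
  exact: integrableZ_EFin.
have i3 : (gauss v).-integrable setT (EFin \o (fun z =>
    Num.sqrt v * tanaka v (x + z) - m * (2 * tanaka v (x + z) - m))).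
  by apply: integrableB_EFin => //; exact: integrableZ_EFin.
have i4 : (gauss v).-integrable setT (EFin \o (fun z =>
   1 + theta * (tanaka v (x + z) - m))).
  by apply: integrableD_EFin => //; exact: integrable_gauss_cst.
have iq : (gauss v).-integrable setT (EFin \o q).
  by apply: integrableD_EFin => //; exact: integrableZ_EFin.
have Eq : \int[gauss v]_z q z = 1 + theta ^+ 2 * (Num.sqrt v * m - m ^+ 2).
  rewrite /q RintegralD//; last exact: integrableZ_EFin.
  rewrite RintegralD//; last exact: integrable_gauss_cst.
  rewrite Rintegral_gauss_cst RintegralZl//; last first.
    by apply: integrableB_EFin => //; exact: integrable_gauss_cst.
  rewrite RintegralB//; last exact: integrable_gauss_cst.
  rewrite hm Rintegral_gauss_cst subrr mulr0 addr0 RintegralZl//.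
  rewrite RintegralB//; last exact: integrableZ_EFin.
  rewrite RintegralZl// hm RintegralZl//; last first.
    by apply: integrableB_EFin; [exact: integrableZ_EFin|exact: integrable_gauss_cst].
  rewrite RintegralB//; last 2 first.
    exact: integrableZ_EFin.
    exact: integrable_gauss_cst.
  by rewrite RintegralZl// hm Rintegral_gauss_cst; ring.
have mE : measurable_fun setT (fun z : R =>
    expR (theta * (tanaka v x + tanaka v (x + z) - tanaka (v + v) x))).
  apply: measurableT_comp => //; apply: measurable_funM => //.
  by apply: measurable_funB => //; exact: measurable_funD.
have small z : `|theta * (tanaka v (x + z) - m)| <= 1 / 4.
  rewrite normrM; apply: le_trans hth; rewrite ler_wpM2l//.
  by have := tb (x + z); rewrite ler_norml; move: mb => /andP[? ?] /andP[? ?]; lra.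
have xiE z : tanaka v x + tanaka v (x + z) - tanaka (v + v) x = tanaka v (x + z) - m.
  by rewrite /m; ring.
apply: (@le_trans _ _ (\int[gauss v]_z q z)).
  apply: le_Rintegral => //.
    apply: (@integrable_gauss _ _ (expR (1 / 4)) 0) => // z.
    rewrite mul0r expR0 mulr1 ger0_norm ?expR_ge0// ler_expR xiE.
    by apply: (le_trans (ler_norm _)).
  move=> z _; rewrite xiE; apply: (le_trans (expR_le_quadratic (small z))).
  rewrite /q lerD2l exprMn ler_wpM2l ?sqr_ge0//.
  have /andP[t0 t1] := tb (x + z); set t := tanaka v (x + z) in t0 t1 *.
  have : t * t <= Num.sqrt v * t by rewrite ler_wpM2r.
  rewrite expr2; lra.
rewrite Eq; apply: (le_trans _ (expR_ge1Dx _)); rewrite lerD2l -mulrA ler_wpM2l ?sqr_ge0//.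
have : Num.sqrt v * m <= Num.sqrt v * tanaka (v + v) x.
  by rewrite ler_wpM2l// /m gerBl tanaka_ge0.
by have := sqr_ge0 m; lra.
Qed.

(** The compensator is itself a sum of kernels, at variance [v + v], so [exp_tanaka_sum_le] controls
    it in turn. *)
Lemma exp_tanaka_martingale_le v c theta a k : 0 < v ->
  `|theta| * Num.sqrt v <= 1 / 4 ->
  (\int[P]_w (expR (theta * \sum_(i < k) tanaka_increment v c (a + i) w -
     theta ^+ 2 * Num.sqrt v *
       \sum_(i < k) tanaka (v + v) (X (v * (a + i).*2%:R) w - c)))%:E <= 1%:E)%E.
Proof.
move=> v0 hth; have vv : 0 < v + v by rewrite addr_gt0.
elim: k => [|k IH].
  under eq_integral do rewrite !big_ord0 !mulr0 subr0 expR0.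
  by rewrite integral_cst//= probability_setT mule1.
set E := (X in (\int[P]_w (expR (X w))%:E <= _)%E) in IH.
pose j := (a + k).*2.
have mE : measurable_fun setT (E : g_sigma_algebraType (past W v j) -> R).
  have ij (i : 'I_k) : ((a + i).*2.+1 <= j)%N.
    by rewrite /j ltn_double ltn_add2l.
  apply: measurable_funB; apply: measurable_funM => //; apply: measurable_sum => i.
    apply: measurable_funB; first apply: measurable_funD.
    - by apply: measurable_tanaka_past => //; exact/ltnW.
    - exact: measurable_tanaka_past.
    - by apply: measurable_tanaka_past => //; exact/ltnW.
  by apply: measurable_tanaka_past => //; exact/ltnW.
pose Y w := X (v * j%:R) w - c.
have mY : measurable_fun setT (Y : g_sigma_algebraType (past W v j) -> R).
  by apply: measurable_funB => //; exact: bm_past.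
pose xi x z := tanaka v x + tanaka v (x + z) - tanaka (v + v) x.
pose F (p : g_sigma_algebraType (past W v j) * measurableTypeR R) :=
  expR (E p.1 - theta ^+ 2 * Num.sqrt v * tanaka (v + v) (Y p.1)) *
  expR (theta * xi (Y p.1) p.2).
have m1 : measurable_fun setT (fun p : g_sigma_algebraType (past W v j) * measurableTypeR R => Y p.1).
  by apply: measurableT_comp; [exact: mY|exact: measurable_fst].
have mF : measurable_fun setT F.
  apply: measurable_funM; apply: measurableT_comp => //.
    apply: measurable_funB.
      by apply: measurableT_comp; [exact: mE|exact: measurable_fst].
    apply: measurable_funM => //.
    exact: (measurableT_comp (measurable_tanaka vv)).
  apply: measurable_funM => //; apply: measurable_funB.
    apply: measurable_funD; first exact: (measurableT_comp (measurable_tanaka v0)).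
    apply: (measurableT_comp (measurable_tanaka v0)).
    by apply: measurable_funD => //; exact: measurable_snd.
  exact: (measurableT_comp (measurable_tanaka vv)).
have F0 p : 0 <= F p by rewrite mulr_ge0// expR_ge0.
have ixi x : (gauss v).-integrable setT (EFin \o (fun z => expR (theta * xi x z))).
  apply: (@integrable_gauss _ _ (expR (`|theta| * (Num.sqrt v + Num.sqrt v + Num.sqrt (v + v)))) 0) => //.
    apply: measurableT_comp => //; apply: measurable_funM => //.
    apply: measurable_funB => //; apply: measurable_funD => //.
    by apply: (measurableT_comp (measurable_tanaka v0)); exact: measurable_funD.
  move=> z; rewrite mul0r expR0 mulr1 ger0_norm ?expR_ge0// ler_expR.
  rewrite (le_trans (ler_norm _))// normrM ler_wpM2l//.
  have := tanaka_ge0 x v0; have := tanaka_le x v0.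
  have := tanaka_ge0 (x + z) v0; have := tanaka_le (x + z) v0.
  have := tanaka_ge0 x vv; have := tanaka_le x vv.
  by rewrite ler_norml /xi; lra.
have iF w : (gauss v).-integrable setT (EFin \o (fun z => F (w, z))).
  by rewrite /F /=; exact: integrableZ_EFin.
apply: le_trans IH.
rewrite (_ : (\int[P]_w _)%E = (\int[P]_w (F (w, incr W v j w))%:E)%E); last first.
  apply: eq_integral => w _; congr EFin; rewrite /F /= -expRD !big_ord_recr /=.
  congr expR; rewrite /tanaka_increment /xi /Y /E -/j bmS.
  by rewrite [X (v * j%:R) w + _ - c]addrAC; ring.
have mE' : measurable_fun setT (fun w => expR (E w)).
  apply: measurableT_comp => //.
  have mid : measurable_fun setT (fun w : T => w : g_sigma_algebraType (past W v j)).
    by move=> _ B mB; rewrite setTI; apply: sigma_measurable mB; exact: past_measurable.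
  exact: (measurableT_comp mE mid).
apply: (integral_incr_le hW v0 mF F0 mE' iF) => w; rewrite /F /=.
rewrite RintegralZl//.
apply: (@le_trans _ _ (expR (E w - theta ^+ 2 * Num.sqrt v * tanaka (v + v) (Y w)) *
   expR (theta ^+ 2 * Num.sqrt v * tanaka (v + v) (Y w)))).
  by rewrite ler_wpM2l ?expR_ge0//; exact: exp_tanaka_increment_le.
by rewrite -expRD subrK.
Qed.

End exponential_martingale_bounds.

(** * Tail bounds for increments and block sums *)

Section tail_bounds.
Context d (T : measurableType d) (R : realType) (P : probability T R).
Variables (W : R -> {RV P >-> R}).
Hypothesis hW : brownian_motion W.
Local Notation X := (bm W).
Implicit Types (f : T -> R) (v c eta q l : R).

Lemma exp_markov f (C l : R) : measurable_fun setT f ->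
  (\int[P]_w (expR (f w))%:E <= C%:E)%E ->
  (P [set w | (l <= f w)%R] <= (C * expR (- l))%:E)%E.
Proof.
move=> mf hC.
have mE : measurable_fun setT (fun w => (expR (f w))%:E).
  by apply/measurable_EFinP/measurableT_comp.
have e0 := expR_gt0 l.
have := @le_integral_abse _ _ _ P setT measurableT (fun w => (expR (f w))%:E) (expR l) mE e0.
under eq_integral do rewrite gee0_abs ?lee_fin ?expR_ge0//.
move=> h.
have -> : [set w | (l <= f w)%R] =
    setT `&` [set x | ((expR l)%:E <= `|(expR (f x))%:E|)%E].
  rewrite setTI; apply/seteqP; split => w /=;
    by rewrite lee_fin ger0_norm ?expR_ge0// ler_expR.
have {h} := le_trans h hC.
by rewrite expRN EFinM lee_pdivlMr// muleC.
Qed.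

Lemma measurable_ge f l : measurable_fun setT f -> measurable [set w | l <= f w].
Proof.
move=> mf; rewrite -[X in measurable X]setTI.
rewrite (_ : [set w | l <= f w] = f @^-1` `[l, +oo[); first exact: mf.
by apply/seteqP; split => w /=; rewrite in_itv/= andbT.
Qed.

Lemma measurable_gt f l : measurable_fun setT f -> measurable [set w | l < f w].
Proof.
move=> mf; rewrite -[X in measurable X]setTI.
rewrite (_ : [set w | l < f w] = f @^-1` `]l, +oo[); first exact: mf.
by apply/seteqP; split => w /=; rewrite in_itv/= andbT.
Qed.

Lemma increment_tail (s t eta l : R) : 0 <= s -> s <= t -> t - s <= eta ->
  0 < eta -> 0 <= l ->
  (P [set w | (l * Num.sqrt eta < `|W t w - W s w|)%R] <= (4 * expR (- l))%:E)%E.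
Proof.
move=> s0; rewrite le_eqVlt => /predU1P[<- _ eta0 l0|st ts eta0 l0].
  rewrite (_ : [set w | _] = set0) ?measure0 ?lee_fin ?mulr_ge0 ?expR_ge0//.
  apply/seteqP; split => w //=; rewrite subrr normr0 ltNge.
  by rewrite mulr_ge0 ?sqrtr_ge0.
have sq0 : 0 < Num.sqrt eta by rewrite sqrtr_gt0.
have sq2 : Num.sqrt eta ^+ 2 = eta by rewrite sqr_sqrtr// ltW.
have mD : measurable_fun setT (fun w => W t w - W s w) by exact: measurable_funB.
have mf : measurable_fun setT (fun w => (Num.sqrt eta)^-1 * `|W t w - W s w|).
  by apply: measurable_funM => //; exact: measurableT_comp.
have hC : (\int[P]_w (expR ((Num.sqrt eta)^-1 * `|W t w - W s w|))%:E <= 4%:E)%E.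
  have me : measurable_fun setT (fun z : R => (expR ((Num.sqrt eta)^-1 * `|z|))%:E).
    by apply/measurable_EFinP; exact: measurable_exp_norm.
  rewrite (integral_increment hW (f := fun z => (expR ((Num.sqrt eta)^-1 * `|z|))%:E) s0 st me); last first.
    by move=> z; rewrite lee_fin expR_ge0.
  have st0 : 0 < t - s by rewrite subr_gt0.
  rewrite integral_gaussE; last first.
    apply: (@integrable_gauss _ _ 1 (Num.sqrt eta)^-1) => //; first exact: measurable_exp_norm.
    by move=> z; rewrite mul1r ger0_norm ?expR_ge0.
  rewrite lee_fin (le_trans (Rintegral_gauss_exp_norm _ st0))//.
  have : expR ((Num.sqrt eta)^-1 ^+ 2 * (t - s) / 2) <= expR (1 / 2).
    rewrite ler_expR ler_pM2r// exprVn sq2.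
    by rewrite mulrC ler_pdivrMr// mul1r.
  by have := @expR1_half_le2 R; lra.
apply: le_trans (exp_markov l mf hC); apply: le_measure.
- rewrite inE; apply: measurable_gt.
  exact: measurableT_comp.
- by rewrite inE; exact: measurable_ge.
- by move=> w /= h; rewrite mulrC ler_pdivlMr// ltW.
Qed.

Lemma measurable_tanaka_bm (u t c : R) : 0 < u ->
  measurable_fun setT (fun w => tanaka u (X t w - c)).
Proof.
move=> u0; apply: (measurableT_comp (measurable_tanaka u0)).
by apply: measurable_funB => //; exact: measurable_bm.
Qed.

Lemma measurable_tanaka_increment v c i : 0 < v ->
  measurable_fun setT (tanaka_increment W v c i).
Proof.
move=> v0; apply: measurable_funB; first apply: measurable_funD.
- exact: measurable_tanaka_bm.
- exact: measurable_tanaka_bm.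
- by apply: measurable_tanaka_bm; rewrite addr_gt0.
Qed.

(** Three exceptional events, of probability at most 2, 1 and 1 times e^-l: a large compensator, and
    a large exponential supermartingale for each sign of the parameter. *)
Lemma tanaka_increment_tail v c eta q l a k : 0 < v -> 0 < eta -> 4 <= q -> 0 <= l ->
  Num.sqrt v * q ^+ 2 <= Num.sqrt eta -> (v + v) * k%:R <= eta ->
  (P [set w | (5 * l * (Num.sqrt eta / q) <
     `|\sum_(i < k) tanaka_increment W v c (a + i) w|)%R] <= (4 * expR (- l))%:E)%E.
Proof.
move=> v0 eta0 q4 l0 vq vk; have vv : 0 < v + v by rewrite addr_gt0.
have e0 : 0 < Num.sqrt eta by rewrite sqrtr_gt0.
have e2 : Num.sqrt eta ^+ 2 = eta by rewrite sqr_sqrtr// ltW.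
have q0 : 0 < q by apply: lt_le_trans q4.
pose Z w := \sum_(i < k) tanaka_increment W v c (a + i) w.
pose S w := \sum_(i < k) tanaka (v + v) (X ((v + v) * (a + i)%:R) w - c).
have SE w : \sum_(i < k) tanaka (v + v) (X (v * (a + i).*2%:R) w - c) = S w.
  apply: eq_bigr => i _; congr (tanaka _ (X _ _ - _)).
  by rewrite -mul2n natrM; ring.
have mZ : measurable_fun setT Z.
  by apply: measurable_sum => i; exact: measurable_tanaka_increment.
have mS : measurable_fun setT S.
  by apply: measurable_sum => i; exact: measurable_tanaka_bm.
(* As sqrt v * q^2 <= sqrt eta, the factor th^2 sqrt v of the compensator is at most 1 / sqrt eta.
   Off [A0] the sum [S] is below 4 l sqrt eta, so the compensator costs at most 4 l; the
   supermartingale adds l, and th |Z| <= 5 l. *)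
pose th := q / Num.sqrt eta.
have th0 : 0 < th by rewrite divr_gt0.
have thv : th ^+ 2 * Num.sqrt v <= (Num.sqrt eta)^-1.
  rewrite /th expr_div_n -[(Num.sqrt eta)^-1]mul1r mulrAC expr2 invfM mulrA.
  rewrite ler_pM2r ?invr_gt0// ler_pdivrMr// mul1r.
  by rewrite mulrC.
have thq : th * Num.sqrt v <= 1 / 4.
  rewrite /th mulrAC ler_pdivrMr//.
  have : q * (q * Num.sqrt v) <= Num.sqrt eta by rewrite mulrA -expr2 mulrC.
  have : 4 * (q * Num.sqrt v) <= q * (q * Num.sqrt v).
    by rewrite ler_wpM2r// mulr_ge0 ?sqrtr_ge0// ltW.
  lra.
have tS : (P [set w | (l <= (4 * Num.sqrt eta)^-1 * S w)%R] <= (2 * expR (- l))%:E)%E.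
  apply: exp_markov; first exact: measurable_funM.
  apply: (exp_tanaka_sum_le hW c a vv); first by rewrite invr_ge0 mulr_ge0// ltW.
  rewrite invfM -mulrA mul1r ler_piMr ?invr_ge0//.
  by rewrite mulrC ler_pdivrMr// mul1r ler_sqrt// ltW.
have tZ (sg : R) : `|sg| = 1 ->
    (P [set w | (l <= sg * th * Z w - (sg * th) ^+ 2 * Num.sqrt v * S w)%R]
      <= (1 * expR (- l))%:E)%E.
  move=> sg1; apply: exp_markov.
    by apply: measurable_funB; exact: measurable_funM.
  have := @exp_tanaka_martingale_le _ _ _ P W hW v c (sg * th) a k v0.
  have -> : `|sg * th| = th by rewrite normrM sg1 mul1r gtr0_norm.
  move=> /(_ thq); apply: le_trans.
  by rewrite le_eqVlt; apply/orP; left; apply/eqP; apply: eq_integral => w _; rewrite SE.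
pose A0 := [set w | (l <= (4 * Num.sqrt eta)^-1 * S w)%R].
pose A1 := [set w | (l <= 1 * th * Z w - (1 * th) ^+ 2 * Num.sqrt v * S w)%R].
pose A2 := [set w | (l <= -1 * th * Z w - (-1 * th) ^+ 2 * Num.sqrt v * S w)%R].
have mA0 : measurable A0 by apply: measurable_ge; exact: measurable_funM.
have mA1 : measurable A1.
  by apply: measurable_ge; apply: measurable_funB; exact: measurable_funM.
have mA2 : measurable A2.
  by apply: measurable_ge; apply: measurable_funB; exact: measurable_funM.
apply: (@le_trans _ _ (P (A0 `|` (A1 `|` A2)))).
  apply: le_measure; rewrite ?inE.
  - apply: measurable_gt; exact: measurableT_comp.
  - by apply: measurableU => //; exact: measurableU.
  move=> w /= hw.
  have [hS|hS] := lerP l ((4 * Num.sqrt eta)^-1 * S w); first by left.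
  right.
  have S4 : S w <= 4 * l * Num.sqrt eta.
    move: hS; rewrite mulrC ltr_pdivrMr ?mulr_gt0//; lra.
  have S0 : 0 <= S w by apply: sumr_ge0 => i _; exact: tanaka_ge0.
  have hq : th ^+ 2 * Num.sqrt v * S w <= 4 * l.
    apply: (@le_trans _ _ ((Num.sqrt eta)^-1 * (4 * l * Num.sqrt eta))).
      by rewrite ler_pM// mulr_ge0 ?sqr_ge0 ?sqrtr_ge0.
    by rewrite mulrC mulfK// lt0r_neq0.
  have hZ : 5 * l < th * `|Z w|.
    have -> : 5 * l = th * (5 * l * (Num.sqrt eta / q)).
      by rewrite /th; field; rewrite !gt_eqF.
    by rewrite ltr_pM2l.
  move: hZ; case: ger0P => Z0 hZ; [left|right]; rewrite /A1 /A2 /=.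
    by rewrite mul1r; lra.
  by rewrite mulN1r sqrrN; lra.
apply: (le_trans (measureU2 _ mA0 (measurableU _ _ mA1 mA2))).
apply: (@le_trans _ _ ((2 * expR (- l))%:E + ((1 * expR (- l))%:E + (1 * expR (- l))%:E))%E).
  apply: leeD => //; apply: (le_trans (measureU2 _ mA1 mA2)).
  by apply: leeD; [apply: tZ; rewrite normr1|apply: tZ; rewrite normrN1].
by rewrite -!EFinD lee_fin; lra.
Qed.

End tail_bounds.

Section finite_union.
Context d (T : measurableType d) (R : realType) (P : probability T R).

Lemma measure_finite_union_le (I : finType) (B : I -> set T) (b : R) :
  (forall i, measurable (B i)) -> (forall i, (P (B i) <= b%:E)%E) ->
  measurable [set w | exists i, B i w] /\
  (P [set w | exists i, B i w] <= (#|I|%:R * b)%:E)%E.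
Proof.
move=> mB hB.
have h (s : seq I) : measurable [set w | exists2 i, i \in s & B i w] /\
    (P [set w | exists2 i, i \in s & B i w] <= ((size s)%:R * b)%:E)%E.
  elim: s => [|i s [ms IH]].
    rewrite (_ : [set w | _] = set0) ?measure0 ?mul0r; last first.
      by apply/seteqP; split => w //= -[].
    by split => //; exact: measurable0.
  rewrite (_ : [set w | _] = B i `|` [set w | exists2 i, i \in s & B i w]); last first.
    apply/seteqP; split => w /=.
      move=> [j]; rewrite inE => /orP[/eqP -> ?|js ?]; first by left.
      by right; exists j.
    move=> [Bi|[j js Bj]]; first by exists i => //; rewrite mem_head.
    by exists j => //; rewrite inE js orbT.
  split; first exact: measurableU.
  apply: (le_trans (measureU2 _ (mB i) ms)).
  by rewrite /= -natr1 mulrDl mul1r addrC EFinD; apply: leeD.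
have [mE PE] := h (enum I).
have hE : [set w | exists i, B i w] = [set w | exists2 i, i \in enum I & B i w].
  apply/seteqP; split => w /= [i]; last by exists i.
  by exists i => //; rewrite mem_enum.
by rewrite hE cardE.
Qed.

End finite_union.

(** * Good events *)

Section good_event.
Context d (T : measurableType d) (R : realType) (P : probability T R).
Variables (W : R -> {RV P >-> R}).
Hypothesis hW : brownian_motion W.
Local Notation X := (bm W).

Lemma bmB s t w : X t w - X s w = W t w - W s w.
Proof. by rewrite /bm; ring. Qed.

Definition mesh (N : nat) : R := (2 ^+ N)^-1.

Lemma mesh_gt0 N : 0 < mesh N.
Proof. by rewrite invr_gt0 exprn_gt0. Qed.

Lemma meshS N : mesh N.+1 + mesh N.+1 = mesh N.
Proof. by rewrite /mesh exprS invfM; field; rewrite expf_neq0. Qed.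

Lemma mesh_mul N n : (n <= N)%N -> mesh N * (2 ^ n)%:R = mesh (N - n).
Proof.
move=> nN; rewrite /mesh natrX -{1}(subnK nN) exprD; field.
by rewrite !expf_neq0.
Qed.

Lemma sqrt_mesh N n : (n.*2 <= N)%N -> Num.sqrt (mesh N) * 2 ^+ n = Num.sqrt (mesh (N - n.*2)).
Proof.
move=> nN; rewrite -(mesh_mul nN) sqrtrM ?(ltW (mesh_gt0 _))//; congr (_ * _).
by rewrite -mul2n mulnC expnM natrX sqrtr_sqr natrX ger0_norm// exprn_ge0.
Qed.

(* Time is cut into blocks of length mesh (blk K N) = 16 ^ (4 * (N %/ K)) mesh N. *)
Definition blk (K N : nat) : nat := (N - 16 * (N %/ K))%N.
Definition blk_size (K N : nat) : nat := (2 ^ (16 * (N %/ K)))%N.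

Variable K : nat.
Hypothesis K16 : (16 <= K)%N.

Lemma blk_le N : (16 * (N %/ K) <= N)%N.
Proof.
apply: leq_trans (leq_trunc_div N K); rewrite mulnC leq_mul2l.
by rewrite K16 orbT.
Qed.

Lemma blk_mul N : mesh N * (blk_size K N)%:R = mesh (blk K N).
Proof. exact/mesh_mul/blk_le. Qed.

Lemma blk_num N : (2 ^ (blk K N) * blk_size K N = 2 ^ N)%N.
Proof. by rewrite -expnD subnK// blk_le. Qed.

(** For i up to 2 * 4^N the levels run from -2^N to 2^N with spacing [mesh N]. On a good event a
    curve close to the path is bounded by 32 N at that time, well inside this range. *)
Definition level N i : R := (i%:R - (4 ^ N)%:R) * mesh N.

(* The last bound is only required at finitely many levels: over one block a
   Hoelder curve is close enough to a constant to be replaced by a level. *)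
Definition good (N : nat) : set T :=
  [set w | [/\ forall k j, (k < 2 ^ blk K N)%N -> (j <= (blk_size K N).*2)%N ->
      `|X (mesh N.+1 * ((blk_size K N).*2 * k + j)%:R) w -
        X (mesh N.+1 * ((blk_size K N).*2 * k)%:R) w|
      <= (8 * N)%:R * Num.sqrt (mesh (blk K N)),
    forall k, (k <= 2 ^ blk K N)%N ->
      `|X (mesh N.+1 * ((blk_size K N).*2 * k)%:R) w| <= (8 * N)%:R &
    forall k j i, (k < 2 ^ blk K N)%N -> (j <= blk_size K N)%N -> (i <= 2 * 4 ^ N)%N ->
      `|\sum_(u < j) tanaka_increment W (mesh N.+1) (level N i) (blk_size K N * k + u) w|
      <= 5 * (8 * N)%:R * (Num.sqrt (mesh (blk K N)) / 16 ^+ (N %/ K))]].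

(** At most 11 * 8^N exceptional events, each of probability at most 4 e^(-8 N) <= 4 * 256^-N; the
    factor 8 N in [good] is chosen so that this is summable with room to spare. *)
Lemma good_prob N : (K <= N)%N ->
  measurable (good N) /\ (P (~` good N) <= (44 * mesh N)%:E)%E.
Proof.
move=> KN.
have v0 := mesh_gt0 N.+1.
set v := mesh N.+1 in v0 *; set n := blk_size K N; set m := blk K N.
set l : R := (8 * N)%:R; have l0 : 0 <= l by [].
have eta0 := mesh_gt0 m; set eta := mesh m in eta0 *.
have vn : v * n.*2%:R = eta.
  by rewrite /eta -blk_mul -(meshS N) -/v -/n -muln2 natrM; ring.
pose bA (p : 'I_(2 ^ m) * 'I_n.*2.+1) :=
  [set w | l * Num.sqrt eta < `|W (v * (n.*2 * p.1 + p.2)%:R) w - W (v * (n.*2 * p.1)%:R) w|].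
pose bC (k : 'I_(2 ^ m).+1) :=
  [set w | l * Num.sqrt 1 < `|W (v * (n.*2 * k)%:R) w - W 0 w|].
pose bB (p : 'I_(2 ^ m) * 'I_n.+1 * 'I_(2 * 4 ^ N).+1) :=
  [set w | 5 * l * (Num.sqrt eta / 16 ^+ (N %/ K)) <
   `|\sum_(u < p.1.2) tanaka_increment W v (level N p.2) (n * p.1.1 + u) w|].
have mA p : measurable (bA p).
  apply: measurable_gt; apply: measurableT_comp => //; exact: measurable_funB.
have mC p : measurable (bC p).
  apply: measurable_gt; apply: measurableT_comp => //; exact: measurable_funB.
have mB p : measurable (bB p).
  apply: measurable_gt; apply: measurableT_comp => //; apply: measurable_sum => i.
  exact: measurable_tanaka_increment.
have PA p : (P (bA p) <= (4 * expR (- l))%:E)%E.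
  apply: (increment_tail hW) => //.
  - by rewrite mulr_ge0// ltW.
  - by rewrite ler_wpM2l ?(ltW v0)// ler_nat leq_addr.
  - rewrite natrD mulrDr addrC addKr -vn ler_wpM2l ?(ltW v0)// ler_nat.
    by rewrite -ltnS.
have PC p : (P (bC p) <= (4 * expR (- l))%:E)%E.
  apply: (increment_tail hW) => //.
    by rewrite mulr_ge0// ltW.
  rewrite subr0 natrM mulrA vn -[leRHS](mulVf (_ : (2 ^+ m != 0 :> R))) ?expf_neq0//.
  rewrite ler_wpM2l ?(ltW eta0)//. by rewrite -natrX ler_nat -ltnS.
have s1 : (1 <= N %/ K)%N by rewrite divn_gt0// (leq_trans _ K16).
(* The tail bound is used with q = 16^s for s = [N %/ K]. It needs q >= 4, hence s >= 1, which is
   where [K <= N] enters; q^2 is the ratio of sqrt eta to sqrt (mesh N). *)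
have PB p : (P (bB p) <= (4 * expR (- l))%:E)%E.
  apply: (tanaka_increment_tail hW) => //.
  - have h16 : 16 ^+ 1 <= 16 ^+ (N %/ K) :> R by rewrite ler_weXn2l// ler1n.
    by apply: le_trans h16; rewrite expr1 ler_nat.
  - have -> : Num.sqrt eta = Num.sqrt (mesh N) * (16 ^+ (N %/ K)) ^+ 2.
      have := @sqrt_mesh N (8 * (N %/ K))%N.
      rewrite -mul2n mulnA blk_le => /(_ isT) <-; congr (_ * _).
      have -> : 16 = 2 ^+ 4 :> R by rewrite -natrX.
      by rewrite -!exprM; congr (_ ^+ _); lia.
    rewrite ler_wpM2r ?exprn_ge0// ler_sqrt ?(ltW (mesh_gt0 _))//.
    by rewrite -(meshS N) lerDl ltW// mesh_gt0.
  - rewrite meshS /eta -blk_mul ler_wpM2l ?(ltW (mesh_gt0 _))// ler_nat.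
    by rewrite -ltnS.
have [mUA PUA] := measure_finite_union_le mA PA.
have [mUC PUC] := measure_finite_union_le mC PC.
have [mUB PUB] := measure_finite_union_le mB PB.
set UA := [set w | _] in mUA PUA; set UB := [set w | _] in mUB PUB.
set UC := [set w | _] in mUC PUC.
have goodE : good N = ~` (UA `|` (UC `|` UB)).
  have lo a (i : 'I_a.+1) : (i <= a)%N by rewrite -ltnS.
  apply/seteqP; split => w /=.
    move=> [hA hC hB] [[p]|[[k]|[p]]].
    - have := hA p.1 p.2 (ltn_ord _) (lo _ _); rewrite -/m -/n -/eta -/v -/l => h.
      rewrite /bA /= ltNge => /negP; apply; move: h.
      by rewrite bmB.
    - have := hC k (lo _ _); rewrite -/m -/n -/eta -/v -/l => h.
      by rewrite /bC /= sqrtr1 mulr1 ltNge => /negP; apply.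
    - have := hB p.1.1 p.1.2 p.2 (ltn_ord _) (lo _ _) (lo _ _).
      rewrite -/m -/n -/eta -/v -/l => h.
      by rewrite /bB /= ltNge => /negP; apply.
  move=> h; split.
  - move=> k j km jn; rewrite leNgt; apply/negP => hw; apply: h; left.
    exists (Ordinal km, @Ordinal n.*2.+1 j jn); rewrite /bA /=; move: hw.
    by rewrite bmB.
  - move=> k km; rewrite leNgt; apply/negP => hw; apply: h; right; left.
    by exists (@Ordinal (2 ^ m).+1 k km); rewrite /bC /= sqrtr1 mulr1.
  - move=> k j i km jn iN; rewrite leNgt; apply/negP => hw; apply: h; right; right.
    by exists (Ordinal km, @Ordinal n.+1 j jn, @Ordinal (2 * 4 ^ N).+1 i iN).
have mU : measurable (UA `|` (UC `|` UB)) by apply: measurableU => //; exact: measurableU.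
rewrite goodE setCK; split; first exact: measurableC.
apply: (le_trans (measureU2 _ mUA (measurableU _ _ mUC mUB))).
apply: (le_trans (leeD (lexx _) (measureU2 _ mUC mUB))).
apply: (le_trans (leeD PUA (leeD PUC PUB))).
rewrite -!EFinD lee_fin -!mulrDl !card_prod !card_ord -!natrD.
have e1 : expR (- l) <= (256 ^+ N)^-1.
  rewrite expRN lef_pV2 ?posrE ?exprn_gt0 ?expR_gt0//.
  rewrite /l -[X in expR X]mulr1 expRM_natl exprM.
  rewrite lerXn2r ?nnegrE ?exprn_ge0 ?expR_ge0//.
  have -> : 256 = 2 ^+ 8 :> R by rewrite -natrX.
  rewrite lerXn2r ?nnegrE ?expR_ge0//.
  by have := expR_ge1Dx (1 : R); lra.
have n1 : (1 <= n)%N by rewrite expn_gt0.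
have hAn : (2 ^ m * n = 2 ^ N)%N := blk_num N.
have hB8 : (2 ^ N * 4 ^ N = 8 ^ N)%N by rewrite -expnMn.
have hle : (2 ^ N <= 8 ^ N)%N by rewrite leq_exp2r// (leq_trans _ KN)// (leq_trans _ K16).
have hAB : (2 ^ m <= 2 ^ N)%N by rewrite -hAn leq_pmulr.
have hA1 : (1 <= 2 ^ m)%N by rewrite expn_gt0.
have hQ : (1 <= 4 ^ N)%N by rewrite expn_gt0.
have hcount : (2 ^ m * n.*2.+1 + ((2 ^ m).+1 + 2 ^ m * n.+1 * (2 * 4 ^ N).+1) <= 11 * 8 ^ N)%N.
  have h1 : (2 ^ m * n.*2.+1 <= 3 * 2 ^ N)%N.
    by rewrite -hAn mulnCA leq_mul2l; apply/orP; right; lia.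
  have h2 : (2 ^ m * n.+1 <= 2 * 2 ^ N)%N.
    by rewrite -hAn mulnCA leq_mul2l; apply/orP; right; lia.
  have h3 : (2 ^ m * n.+1 * (2 * 4 ^ N).+1 <= (2 * 2 ^ N) * (3 * 4 ^ N))%N.
    by apply: leq_mul => //; lia.
  move: h3; rewrite mulnACA hB8; lia.
apply: (@le_trans _ _ ((11 * 8 ^ N)%:R * (4 * (256 ^+ N)^-1))).
  apply: ler_pM; rewrite ?ler_nat ?ler_wpM2l ?ler0n//.
rewrite natrM natrX mulrACA -natrM ler_wpM2l// /mesh.
rewrite ler_pdivrMr ?exprn_gt0// mulrC ler_pdivlMr ?exprn_gt0// -exprMn.
by rewrite lerXn2r ?nnegrE// -natrM ler_nat.
Qed.

End good_event.

(** * Refinement of the partition on a good event *)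

Section scale_estimates.
Context {R : realType}.
Implicit Types (x y : R).

Local Notation mesh := (@mesh R).

Lemma mesh_powR m : mesh m = 2 `^ (- m%:R).
Proof. by rewrite powR_invn. Qed.

Lemma mesh_le1 m : mesh m <= 1.
Proof. by rewrite /mesh invf_le1 ?exprn_gt0// exprn_ege1// ler1n. Qed.

Lemma mesh_le m n : (m <= n)%N -> mesh n <= mesh m.
Proof.
by move=> mn; rewrite /mesh lef_pV2 ?posrE ?exprn_gt0// ler_weXn2l// ler1n.
Qed.

(** In powers of 2, with m = [blk K N], the claim reads 16 s - alpha m <= - m / 2 - 4 s, that is 20
    s <= (alpha - 1/2) m. As m = N - 16 s >= (K - 16) s, this is the hypothesis on [K], and the
    place where alpha > 1/2 is decisive. *)
Lemma blk_pow (alpha : R) K N : 1 / 2 < alpha ->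
  20 <= (K%:R - 16) * (alpha - 1 / 2) ->
  (blk_size K N)%:R * mesh (blk K N) `^ alpha <=
  Num.sqrt (mesh (blk K N)) / 16 ^+ (N %/ K).
Proof.
move=> a12 hK; set s := (N %/ K)%N.
have a0 : 0 < alpha - 1 / 2 by lra.
have KR : 16 < K%:R :> R.
  rewrite ltNge; apply/negP => hk.
  have : (K%:R - 16) * (alpha - 1 / 2) <= 0 by rewrite mulr_le0_ge0//; lra.
  lra.
have K16 : (16 <= K)%N by rewrite -(ler_nat R) ltW.
rewrite -powR12_sqrt ?(ltW (mesh_gt0 _ _))// mesh_powR -!powRrM.
have -> : (blk_size K N)%:R = 2 `^ (16 * s%:R) :> R.
  by rewrite /blk_size natrX -natrM powR_mulrn.
have -> : (16 ^+ s)^-1 = 2 `^ (- (4 * s%:R)) :> R.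
  rewrite powRN -natrM powR_mulrn// exprM; congr (_ ^+ _)^-1.
  by rewrite -natrX.
rewrite -!powRD; last 2 first.
  by apply/implyP => _; rewrite pnatr_eq0.
  by apply/implyP => _; rewrite pnatr_eq0.
rewrite ler_powR ?ler1n//.
have mE : (blk K N)%:R = N%:R - 16 * s%:R :> R.
  by rewrite /blk natrB ?blk_le// natrM.
have sN : K%:R * s%:R <= N%:R :> R.
  by rewrite -natrM ler_nat mulnC leq_trunc_div.
have s0 : 0 <= s%:R :> R by [].
rewrite mE; move: sN hK s0; set S : R := s%:R; set k : R := K%:R; set n : R := N%:R.
move=> sN hK s0.
have h1 : 20 * S <= (k - 16) * (alpha - 1 / 2) * S by rewrite ler_wpM2r.
have h2 : (k * S - 16 * S) * (alpha - 1 / 2) <= (n - 16 * S) * (alpha - 1 / 2).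
  by rewrite ler_wpM2r// ?(ltW a0)//; lra.
lra.
Qed.

Lemma tanaka_far u eta l y : 0 < u -> u <= eta -> eta <= 1 -> 0 <= l ->
  l * Num.sqrt eta <= `|y| -> tanaka u y <= 64 * expR (- l) :> R.
Proof.
move=> u0 ue e1 l0 ly.
have e0 : 0 < eta by apply: lt_le_trans ue.
have su : 0 < Num.sqrt u by rewrite sqrtr_gt0.
have s1 : Num.sqrt u <= 1 by rewrite -sqrtr1 ler_sqrt// (le_trans ue).
apply: (le_trans (tanaka_decay _ u0)).
have h1 : expR (- (`|y| / Num.sqrt u)) <= expR (- l).
  rewrite ler_expR lerN2 ler_pdivlMr//; apply: le_trans ly.
  by rewrite ler_wpM2l// ler_sqrt// ltW.
have h2 : expR 2 <= 16 :> R.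
  have -> : 2 = (1 / 2) * 4%:R :> R by field.
  rewrite expRM_natr (_ : 16 = 2 ^+ 4); last by rewrite -natrX.
  by rewrite lerXn2r ?nnegrE ?expR_ge0// expR1_half_le2.
have el := expR_ge0 (- l).
apply: (@le_trans _ _ (2 * 1 * expR (- l) * (2 * 16))); last lra.
by apply: ler_pM; rewrite ?mulr_ge0 ?expR_ge0 ?sqrtr_ge0// ?ler_wpM2l//;
  apply: ler_pM; rewrite ?mulr_ge0 ?expR_ge0 ?sqrtr_ge0// ler_wpM2l.
Qed.

(* The kernel at scale eta is bounded below near 0; shifts of it cover a
   larger neighbourhood. *)
Lemma tanaka_cover eta (I : nat) y : 0 < eta ->
  `|y| <= I%:R * (Num.sqrt eta / 200) ->
  Num.sqrt eta / 100 <=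
    \sum_(i < I.*2.+1) tanaka eta (y - (i%:R - I%:R) * (Num.sqrt eta / 200)).
Proof.
move=> e0 hy; have s0 : 0 < Num.sqrt eta by rewrite sqrtr_gt0.
set tau := Num.sqrt eta / 200 in hy *; have t0 : 0 < tau by rewrite divr_gt0.
have /andP[y1 y2] : - (I%:R * tau) <= y <= I%:R * tau by rewrite -ler_norml.
pose q := y / tau + I%:R.
have yq : y = (q - I%:R) * tau by rewrite /q addrK divfK// gt_eqF.
have q0 : 0 <= q.
  rewrite /q -(ler_pM2r t0) mul0r mulrDl divfK ?gt_eqF//; lra.
have qI : q <= I.*2%:R.
  rewrite -addnn natrD /q lerD2r ler_pdivrMr//.
have /andP[i1 i2] := truncn_itv q0; set i := Num.truncn q in i1 i2.
have iI : (i < I.*2.+1)%N by rewrite ltnS -(ler_nat R) (le_trans i1).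
rewrite (bigD1 (Ordinal iI)) //=.
apply: (@le_trans _ _ (tanaka eta (y - (i%:R - I%:R) * tau))); last first.
  by rewrite lerDl sumr_ge0// => j _; exact: tanaka_ge0.
set z := y - _; have hz : `|z - 0| <= tau.
  rewrite subr0 /z yq -mulrBl opprB addrA subrK normrM (gtr0_norm t0).
  rewrite ler_piMl ?(ltW t0)// ger0_norm ?subr_ge0//.
  by move: i2; rewrite -natr1; lra.
(* The kernel is at least sqrt eta / 50 at 0, and a displacement by the spacing sqrt eta / 200 loses
   at most twice that. *)
have h1 := tanaka_lipschitz z 0 e0; have h2 := @tanaka0_ge R eta e0.
have := ler_norm (tanaka eta 0 - tanaka eta z); rewrite distrC => h3.
have tE : Num.sqrt eta = 200 * tau by rewrite /tau; field.
lra.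
Qed.

(** [J] may end inside a block. The truncated difference [J - n * k] gives the partial length there
    and 0 in all later blocks. *)
Lemma sum_blocks (V : zmodType) (F : nat -> V) n M J : (J <= n * M)%N ->
  \sum_(j < J) F j = \sum_(k < M) \sum_(j < minn n (J - n * k)) F (n * k + j)%N.
Proof.
elim: M J => [|M IH] J hJ.
  by move: hJ; rewrite muln0 leqn0 => /eqP ->; rewrite !big_ord0.
rewrite big_ord_recr /=.
have [h|h] := leqP J (n * M).
  rewrite -IH// (_ : J - n * M = 0)%N; last by apply/eqP; rewrite subn_eq0.
  by rewrite minn0 big_ord0 addr0.
have -> : minn n (J - n * M) = (J - n * M)%N.
  by apply/minn_idPr; rewrite leq_subLR -mulnSr.
rewrite -(big_mkord xpredT F) (@big_cat_nat _ _ _ (n * M))//= ?(ltnW h)//.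
congr (_ + _); last first.
  rewrite -{1}[(n * M)%N]add0n big_addn big_mkord.
  by apply: eq_bigr => j _; rewrite addnC.
rewrite big_mkord (IH (n * M)%N)//; apply: eq_bigr => k _.
have hk : (n * k + n <= n * M)%N by rewrite -mulnSr leq_mul2l ltn_ord orbT.
have -> : minn n (n * M - n * k) = n by apply/minn_idPl; rewrite leq_subRL ?(leq_trans _ hk) ?leq_addr.
have -> // : minn n (J - n * k) = n.
apply/minn_idPl; rewrite leq_subRL; first exact: leq_trans hk (ltnW h).
by rewrite (leq_trans _ (ltnW h))// (leq_trans _ hk)// leq_addr.
Qed.

End scale_estimates.

Lemma leq_32_expn N : (8 <= N)%N -> (32 * N <= 2 ^ N)%N.
Proof.
move=> /subnK <-; elim: (N - 8)%N => [//|k IH].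
rewrite addSn expnS mulnS mul2n -addnn; apply: leq_add => //.
by apply: leq_trans IH; rewrite leq_pmulr// addn_gt0 orbT.
Qed.

Section one_step.
Context d (T : measurableType d) (R : realType) (P : probability T R).
Variables (W : R -> {RV P >-> R}) (alpha : R) (K : nat).
Hypothesis alpha_gt : 1 / 2 < alpha.
Hypothesis K_large : 20 <= (K%:R - 16) * (alpha - 1 / 2).
Hypothesis K16 : (16 <= K)%N.
Local Notation mesh := (@mesh R).

(** Only the modulus of continuity, so that the class is stable under vertical shifts. *)
Definition holder (f : R -> R) := forall s t, 0 <= s <= 1 -> 0 <= t <= 1 ->
  `|f s - f t| <= `|s - t| `^ alpha.

Definition local_sum (x f : R -> R) (N J : nat) : R :=
  \sum_(j < J) tanaka (mesh N) (x (mesh N * j%:R) - f (mesh N * j%:R)).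

Definition refinement (v : R) (x f : R -> R) (j : nat) : R :=
  tanaka v (x (v * j.*2%:R) - f (v * j.*2%:R)) +
  tanaka v (x (v * j.*2.+1%:R) - f (v * j.*2.+1%:R)) -
  tanaka (v + v) (x (v * j.*2%:R) - f (v * j.*2%:R)).

Lemma local_sum_refine x f N J :
  local_sum x f N.+1 J.*2 - local_sum x f N J =
  \sum_(j < J) refinement (mesh N.+1) x f j.
Proof.
rewrite /local_sum; elim: J => [|J IH]; first by rewrite !big_ord0 subr0.
rewrite doubleS 3!big_ord_recr [in RHS]big_ord_recr /= -IH /refinement meshS.
have -> : mesh N.+1 * J.*2%:R = mesh N * J%:R.
  by rewrite -(meshS _ N) -addnn natrD; ring.
set A := \sum_(_ < _) _; set B := \sum_(_ < _) _.
by rewrite opprD !addrA; do ![rewrite [_ - B]addrAC]; rewrite ?addrA.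
Qed.

Section fixed_path.
Variables (w : T) (N : nat) (f : R -> R) (B : R).
Let x t := bm W t w.
Let n := blk_size K N.
Let m := blk K N.
Let s := (N %/ K)%N.
Let v := mesh N.+1.
Let eta := mesh m.
Let sg := Num.sqrt eta.
Let l : R := (8 * N)%:R.
Let om := eta `^ alpha.
Hypothesis NK : (K <= N)%N.
Hypothesis hf : holder f.
Hypothesis gw : good W K N w.
Hypothesis alpha_le : alpha <= 1.

Let v0 : 0 < v. Proof. exact: mesh_gt0. Qed.
Let eta0 : 0 < eta. Proof. exact: mesh_gt0. Qed.
Let sg0 : 0 < sg. Proof. by rewrite sqrtr_gt0. Qed.
Let l0 : 0 <= l. Proof. by []. Qed.
Let om0 : 0 <= om. Proof. exact: powR_ge0. Qed.
Let n0 : (0 < n)%N. Proof. by rewrite expn_gt0. Qed.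

Let vn : v * n.*2%:R = eta.
Proof. by rewrite /eta -blk_mul// -(meshS R N) -/v -/n -muln2 natrM; ring. Qed.

Let n_om : n%:R * om <= sg / 16 ^+ s.
Proof. exact: blk_pow. Qed.

Let om_sg : om <= sg.
Proof.
have h : om <= n%:R * om by rewrite ler_peMl// ler1n.
apply: (le_trans h); apply: (le_trans n_om).
by rewrite ler_pdivrMr ?exprn_gt0// ler_peMr ?(ltW sg0)// exprn_ege1// ler1n.
Qed.

Let mesh_om : mesh N <= om.
Proof.
apply: (@le_trans _ _ eta); first by apply: mesh_le; exact: leq_subr.
by apply: ger1_powR => //; rewrite eta0 mesh_le1.
Qed.

Let block_time k j : (k < 2 ^ m)%N -> (j <= n.*2)%N ->
  [/\ 0 <= v * (n.*2 * k + j)%:R <= 1,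
      `|x (v * (n.*2 * k + j)%:R) - x (eta * k%:R)| <= l * sg &
      `|f (v * (n.*2 * k + j)%:R) - f (eta * k%:R)| <= om].
Proof.
move=> km jn.
have hk : eta * k%:R = v * (n.*2 * k)%:R by rewrite natrM mulrA vn.
have h1 q : (q <= n.*2 * 2 ^ m)%N -> 0 <= v * q%:R <= 1.
  move=> hq; rewrite mulr_ge0 ?(ltW v0)//=.
  apply: (@le_trans _ _ (v * (n.*2 * 2 ^ m)%:R)).
    by rewrite ler_wpM2l ?(ltW v0)// ler_nat.
  by rewrite natrM mulrA vn natrX /eta /mesh mulVf// expf_neq0.
have hq : (n.*2 * k + j <= n.*2 * 2 ^ m)%N.
  apply: (@leq_trans (n.*2 * k.+1)); first by rewrite mulnS addnC leq_add2r.
  by rewrite leq_mul2l km orbT.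
have hq' : (n.*2 * k <= n.*2 * 2 ^ m)%N by apply: leq_trans hq; rewrite leq_addr.
split; first exact: h1.
  by have [h _ _] := gw; rewrite hk; exact: h.
rewrite hk; apply: (le_trans (hf (h1 _ hq) (h1 _ hq'))).
rewrite -mulrBr natrD addrC addKr ger0_norm ?mulr_ge0 ?(ltW v0)//.
apply: ge0_ler_powR; rewrite ?nnegrE ?mulr_ge0 ?(ltW v0) ?(ltW eta0)//.
  by apply: ltW; apply: lt_trans alpha_gt.
by rewrite -vn ler_wpM2l ?(ltW v0)// ler_nat.
Qed.

(** The factor 3 leaves room: during a block the path moves by at most l sg and the curve by at most
    om <= sg <= l sg, so in the other blocks their distance stays at least l sg. *)
Let relevant k := `|x (eta * k%:R) - f (eta * k%:R)| <= 3 * l * sg.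

Let index_even k j : (n * k + j).*2 = (n.*2 * k + j.*2)%N.
Proof. by rewrite doubleD doubleMl. Qed.

Let index_odd k j : (n * k + j).*2.+1 = (n.*2 * k + j.*2.+1)%N.
Proof. by rewrite index_even addnS. Qed.

(** The curve stays within 2 om of one level, so each refinement, made of three 2-Lipschitz kernels,
    changes by at most 12 om when the level replaces the curve. Since n om <= sg / 16^s, this adds
    12 to the 40 N of the good event. *)
Let relevant_block k j0 : (k < 2 ^ m)%N -> (j0 <= n)%N -> relevant k ->
  `|\sum_(j < j0) refinement v x f (n * k + j)%N| <= 52 * N%:R * (sg / 16 ^+ s).
Proof.
move=> km jn rk; have [_ _ gB] := gw.
have [_ gC _] := gw.
have NN : (16 <= N)%N := leq_trans K16 NK.
have fk : `|f (eta * k%:R)| <= (32 * N)%:R.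
  have hk : eta * k%:R = v * (n.*2 * k)%:R by rewrite natrM mulrA vn.
  have := gC k (ltnW km); rewrite -/v -/n -hk -/(x (eta * k%:R)) => xk.
  have sg1 : sg <= 1 by rewrite -sqrtr1 ler_sqrt// mesh_le1.
  have : 3 * l * sg <= 3 * l by rewrite ler_piMr// mulr_ge0.
  have := ler_normB (x (eta * k%:R)) (x (eta * k%:R) - f (eta * k%:R)).
  rewrite opprB addrC subrK; move: rk xk; rewrite /relevant /l !natrM.
  lra.
pose h := mesh N; have h0 : 0 < h := mesh_gt0 R N.
(* The position of the curve on the scale of level indices; truncation selects the level just below,
   at distance at most [mesh N]. *)
pose q := f (eta * k%:R) / h + (4 ^ N)%:R.
have N32 : (32 * N <= 2 ^ N)%N by apply: leq_32_expn; exact: leq_trans NN.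
have fk2 : `|f (eta * k%:R) / h| <= (4 ^ N)%:R.
  rewrite normrM [`|h^-1|]gtr0_norm ?invr_gt0// /h /mesh invrK.
  rewrite (_ : (4 ^ N)%:R = (2 ^ N)%:R * 2 ^+ N); last first.
    by rewrite -natrX -natrM -expnMn.
  by rewrite ler_wpM2r ?exprn_ge0// (le_trans fk)// ler_nat.
have /andP[fa fb] : - (4 ^ N)%:R <= f (eta * k%:R) / h <= (4 ^ N)%:R by rewrite -ler_norml.
have q0 : 0 <= q by rewrite /q; lra.
have q2 : q <= (2 * 4 ^ N)%:R by rewrite /q natrM; lra.
have /andP[i1 i2] := truncn_itv q0; set i := Num.truncn q in i1 i2.
have iN : (i <= 2 * 4 ^ N)%N by rewrite -(ler_nat R) (le_trans i1).
pose c := level R N i.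
have hc : `|f (eta * k%:R) - c| <= h.
  have -> : f (eta * k%:R) - c = (q - i%:R) * h.
    by rewrite /q /c /level -/h; field; exact: lt0r_neq0.
  rewrite normrM (gtr0_norm h0) ler_piMl ?(ltW h0)// ger0_norm ?subr_ge0//.
  by move: i2; rewrite -natr1; lra.
have fc j : (j <= n.*2)%N -> `|f (v * (n.*2 * k + j)%:R) - c| <= 2 * om.
  move=> hj; have [_ _ h1] := block_time km hj.
  have := ler_normD (f (v * (n.*2 * k + j)%:R) - f (eta * k%:R)) (f (eta * k%:R) - c).
  by rewrite addrA subrK; have := mesh_om; rewrite -/h; lra.
have tk u (j : nat) : 0 < u -> (j <= n.*2)%N ->
    `|tanaka u (x (v * (n.*2 * k + j)%:R) - f (v * (n.*2 * k + j)%:R)) -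
      tanaka u (x (v * (n.*2 * k + j)%:R) - c)| <= 4 * om.
  move=> u0 hj; apply: (le_trans (tanaka_lipschitz _ _ u0)).
  have -> : x (v * (n.*2 * k + j)%:R) - f (v * (n.*2 * k + j)%:R) -
     (x (v * (n.*2 * k + j)%:R) - c) = - (f (v * (n.*2 * k + j)%:R) - c) by ring.
  by rewrite normrN; have := fc j hj; lra.
have dj (j : 'I_j0) : `|refinement v x f (n * k + j)%N - tanaka_increment W v c (n * k + j)%N w|
    <= 12 * om.
  have j1 : (j.*2 <= n.*2)%N by rewrite leq_double (leq_trans _ jn)// ltnW.
  have j2 : (j.*2.+1 <= n.*2)%N by rewrite ltn_double (leq_trans _ jn).
  have t1 := tk v _ v0 j1; have t2 := tk v _ v0 j2.
  have t3 := tk (v + v) _ (addr_gt0 v0 v0) j1.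
  rewrite /refinement /tanaka_increment index_odd index_even -/(x _) -/(x _).
  move: t1 t2 t3; set a1 := tanaka _ _; set b1 := tanaka _ _; set a2 := tanaka _ _.
  set b2 := tanaka _ _; set a3 := tanaka _ _; set b3 := tanaka _ _ => t1 t2 t3.
  have -> : a1 + a2 - a3 - (b1 + b2 - b3) = (a1 - b1) + (a2 - b2) - (a3 - b3) by ring.
  have := ler_normB (a1 - b1 + (a2 - b2)) (a3 - b3).
  by have := ler_normD (a1 - b1) (a2 - b2); lra.
have Z := gB k j0 i km jn iN; rewrite -/v -/n -/m -/s -/eta -/sg -/l -/c in Z.
have -> : \sum_(j < j0) refinement v x f (n * k + j)%N =
   \sum_(j < j0) tanaka_increment W v c (n * k + j)%N w +
   \sum_(j < j0) (refinement v x f (n * k + j)%N - tanaka_increment W v c (n * k + j)%N w).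
  by rewrite -big_split; apply: eq_bigr => j _; rewrite /= addrC subrK.
apply: (le_trans (ler_normD _ _)).
have h2 : `|\sum_(j < j0) (refinement v x f (n * k + j)%N - tanaka_increment W v c (n * k + j)%N w)|
   <= 12 * (sg / 16 ^+ s).
  apply: (le_trans (ler_norm_sum _ _ _)).
  apply: (@le_trans _ _ (\sum_(j < j0) (12 * om))); first exact: ler_sum.
  rewrite sumr_const card_ord -[leLHS]mulr_natr -mulrA ler_wpM2l//.
  apply: le_trans n_om; rewrite mulrC ler_wpM2r// ler_nat//.
have N1 : 1 <= N%:R :> R by rewrite ler1n (leq_trans _ NN).
have X0 : 0 <= sg / 16 ^+ s by rewrite divr_ge0 ?(ltW sg0)// exprn_ge0.
have : sg / 16 ^+ s <= N%:R * (sg / 16 ^+ s) by rewrite ler_peMl.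
by move: Z h2; rewrite /l natrM; lra.
Qed.

(** Each of the three kernels of a refinement is at most 64 e^-l by [tanaka_far]. *)
Let irrelevant_block k j0 : (k < 2 ^ m)%N -> (j0 <= n)%N -> ~~ relevant k ->
  `|\sum_(j < j0) refinement v x f (n * k + j)%N| <= n%:R * (192 * expR (- l)).
Proof.
move=> km jn; rewrite /relevant -ltNge => rk.
have NN : (16 <= N)%N := leq_trans K16 NK.
have l1 : 1 <= l by rewrite /l ler1n muln_gt0 (leq_trans _ NN).
have tk u (j : nat) : 0 < u -> u <= eta -> (j <= n.*2)%N ->
    0 <= tanaka u (x (v * (n.*2 * k + j)%:R) - f (v * (n.*2 * k + j)%:R)) <= 64 * expR (- l).
  move=> u0 ue hj; rewrite tanaka_ge0//=.
  apply: (@tanaka_far _ u eta) => //; first exact: mesh_le1.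
  have [_ h1 h2] := block_time km hj; rewrite -/sg.
  have : sg <= l * sg by rewrite ler_peMl// ltW.
  move: h1 h2 rk om_sg.
  set a := x _; set b := f _; set c := x _; set e := f _ => h1 h2 rk h3.
  have := ler_normD (c - a) (a - b + (b - e)).
  have -> : c - a + (a - b + (b - e)) = c - e by ring.
  by have := ler_normD (a - b) (b - e); rewrite (distrC c a); lra.
apply: (le_trans (ler_norm_sum _ _ _)).
apply: (@le_trans _ _ (\sum_(j < j0) (192 * expR (- l)))).
  apply: ler_sum => j _.
  have j1 : (j.*2 <= n.*2)%N by rewrite leq_double (leq_trans _ jn)// ltnW.
  have j2 : (j.*2.+1 <= n.*2)%N by rewrite ltn_double (leq_trans _ jn).
  have vv : v + v <= eta by rewrite meshS; apply: mesh_le; exact: leq_subr.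
  have ve : v <= eta by apply: le_trans vv; rewrite lerDl ltW.
  have := tk v _ v0 ve j1; have := tk v _ v0 ve j2.
  have := tk (v + v) _ (addr_gt0 v0 v0) vv j1.
  rewrite /refinement index_odd index_even.
  set a1 := tanaka _ _; set a2 := tanaka _ _; set a3 := tanaka _ _.
  by have := expR_ge0 (- l); rewrite ler_norml; lra.
rewrite sumr_const card_ord -[leLHS]mulr_natl ler_wpM2r//; by rewrite ler_nat.
Qed.

Hypothesis hB : forall y, local_sum x (fun t => f t + y) m (2 ^ m) <= B.

(** Chosen so that [I] steps of size sg / 200 make up the relevance radius 3 l sg = 24 N sg. *)
Let I := (24 * 200 * N)%N.

(** By [tanaka_cover] every relevant block contributes at least sg / 100 to the kernels at scale
    eta, summed over the 2 I + 1 shifts. Exchanging the sums leaves one local sum per shift, each at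
    most [B]. *)
Let relevant_count : \sum_(k < 2 ^ m | relevant k) sg <= 100 * I.*2.+1%:R * B.
Proof.
rewrite -mulrA mulrC -ler_pdivrMr// mulr_suml big_mkcond /=.
apply: (@le_trans _ _ (\sum_(k < 2 ^ m) \sum_(i < I.*2.+1)
    tanaka eta (x (eta * k%:R) - f (eta * k%:R) - (i%:R - I%:R) * (sg / 200)))).
  apply: ler_sum => k _; case: ifPn => rk.
    apply: tanaka_cover => //; apply: (le_trans rk).
    by rewrite -/sg /l /I !natrM le_eqVlt; apply/orP; left; apply/eqP; field.
  by apply: sumr_ge0 => i _; exact: tanaka_ge0.
rewrite exchange_big /=.
apply: (@le_trans _ _ (\sum_(i < I.*2.+1) B)).
  apply: ler_sum => i _; apply: le_trans (hB ((i%:R - I%:R) * (sg / 200))).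
  rewrite /local_sum le_eqVlt; apply/orP; left; apply/eqP.
  by apply: eq_bigr => k _; rewrite -/eta opprD addrA.
by rewrite sumr_const card_ord -[leLHS]mulr_natl.
Qed.

(** One factor N comes from the bound per block and the other from the number of shifts; 100^4
    absorbs the numerical constants. *)
Definition kappa (N : nat) : R := 100 ^+ 4 * N%:R ^+ 2 / 16 ^+ (N %/ K).

(** The relevant blocks give the part proportional to [B]. The others give at most 2^N * 192 e^(-8
    N) in total, which is the term 1 in 1 + B. An arbitrary [J] is allowed in order to treat all
    times at once. *)
Lemma local_sum_step J : 0 <= B -> (J <= 2 ^ N)%N ->
  `|local_sum x f N.+1 J.*2 - local_sum x f N J| <= kappa N * (1 + B).
Proof.
move=> B0 JN; have NN : (16 <= N)%N := leq_trans K16 NK.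
rewrite local_sum_refine -/v (sum_blocks _ (n := n) (M := 2 ^ m)); last first.
  by rewrite mulnC blk_num.
apply: (le_trans (ler_norm_sum _ _ _)).
pose c1 : R := 52 * N%:R / 16 ^+ s; pose c2 : R := n%:R * (192 * expR (- l)).
have c20 : 0 <= c2 by rewrite !mulr_ge0// expR_ge0.
have c10 : 0 <= c1 by rewrite divr_ge0// exprn_ge0.
apply: (@le_trans _ _ (\sum_(k < 2 ^ m) (c1 * (if relevant k then sg else 0) + c2))).
  apply: ler_sum => k _; case: ifPn => rk.
    rewrite (le_trans (relevant_block _ _ rk)) ?geq_minl//.
    by rewrite /c1 -[leLHS]addr0 lerD// le_eqVlt; apply/orP; left; apply/eqP; ring.
  by rewrite mulr0 add0r irrelevant_block ?geq_minl.
rewrite big_split /= -mulr_sumr -big_mkcond /= [X in _ + X]sumr_const card_ord.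
have h1 : c1 * \sum_(k < 2 ^ m | relevant k) sg <= c1 * (100 * I.*2.+1%:R * B).
  by rewrite ler_wpM2l// relevant_count.
have N1 : 1 <= N%:R :> R by rewrite ler1n (leq_trans _ NN).
have i0 : 0 < (16 ^+ s)^-1 :> R by rewrite invr_gt0 exprn_gt0.
have h2 : c1 * (100 * I.*2.+1%:R * B) <= kappa N * B.
  rewrite mulrA ler_wpM2r// /c1 /kappa -/s mulrAC ler_wpM2r ?(ltW i0)//.
  have -> : I.*2.+1%:R = 2 * (24 * 200 * N%:R) + 1 :> R.
    by rewrite -natr1 -mul2n /I !natrM.
  set z : R := N%:R in N1 *.
  have z2 : z <= z ^+ 2 by rewrite expr2 ler_peMl; lra.
  have -> : 52 * z * (100 * (2 * (24 * 200 * z) + 1)) =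
     52 * 100 * (2 * 24 * 200) * z ^+ 2 + 52 * 100 * z by ring.
  have -> : 100 ^+ 4 = 100 * 100 * (100 * 100) :> R by rewrite !exprS expr0 mulr1 !mulrA.
  nra.
have h3 : c2 *+ 2 ^ m <= kappa N.
  rewrite /c2 -[leLHS]mulr_natl mulrA -natrM blk_num// /kappa -/s.
  have e1 : expR (- l) <= (256 ^+ N)^-1.
    rewrite expRN lef_pV2 ?posrE ?exprn_gt0 ?expR_gt0//.
    rewrite /l -[X in expR X]mulr1 expRM_natl exprM.
    rewrite lerXn2r ?nnegrE ?exprn_ge0 ?expR_ge0//.
    have -> : 256 = 2 ^+ 8 :> R by rewrite -natrX.
    rewrite lerXn2r ?nnegrE ?expR_ge0//.
    by have := expR_ge1Dx (1 : R); lra.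
  apply: (@le_trans _ _ ((2 ^ N)%:R * (192 * (256 ^+ N)^-1))).
    by rewrite ler_wpM2l// ler_wpM2l.
  have e2 : (2 ^ N)%:R * (256 ^+ N)^-1 <= (16 ^+ s)^-1 :> R.
    rewrite natrX -exprVn -exprMn (_ : 2 / 256 = 128^-1); last by field.
    rewrite exprVn lef_pV2 ?posrE ?exprn_gt0//.
    apply: (@le_trans _ _ (16 ^+ N)).
      by rewrite ler_weXn2l ?ler1n// leq_div.
    by rewrite lerXn2r ?nnegrE// ler_nat.
  rewrite mulrCA; apply: ler_pM => //.
  have z2 : 1 <= N%:R ^+ 2 :> R by rewrite exprn_ege1.
  have -> : 100 ^+ 4 = 100 * 100 * (100 * 100) :> R by rewrite !exprS expr0 mulr1 !mulrA.
  lra.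
have -> : kappa N * (1 + B) = kappa N * B + kappa N by ring.
by apply: lerD => //; apply: (le_trans h1).
Qed.

End fixed_path.
End one_step.

(** * Gronwall bound and uniform Cauchy rate *)

Section uniform_convergence.
Context d (T : measurableType d) (R : realType) (P : probability T R).
Variables (W : R -> {RV P >-> R}) (alpha : R) (K : nat).
Hypothesis alpha_gt : 1 / 2 < alpha.
Hypothesis alpha_le : alpha <= 1.
Hypothesis K_large : 20 <= (K%:R - 16) * (alpha - 1 / 2).
Hypothesis K16 : (16 <= K)%N.
Local Notation mesh := (@mesh R).
Local Notation kappa := (@kappa R K).

Lemma kappa_ge0 N : 0 <= kappa N.
Proof. by rewrite divr_ge0 ?mulr_ge0 ?exprn_ge0. Qed.

(** An inverse square suffices to telescope. It follows from N + 1 <= K (s + 1) <= K 2^s, whose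
    fourth power is K^4 16^s. *)
Lemma kappa_le N : kappa N <= 100 ^+ 4 * K%:R ^+ 4 / N.+1%:R ^+ 2.
Proof.
rewrite /kappa ler_pdivrMr ?exprn_gt0// [leRHS]mulrAC ler_pdivlMr ?exprn_gt0 ?ltr0n//.
rewrite -[leLHS]mulrA -[leRHS]mulrA ler_wpM2l ?exprn_ge0//.
rewrite -!natrX -!natrM ler_nat.
have h1 : (N.+1 <= K * (N %/ K).+1)%N.
  by rewrite mulnC; apply: ltn_ceil; apply: leq_trans K16.
have h2 : ((N %/ K).+1 <= 2 ^ (N %/ K))%N by exact: ltn_expl.
apply: (@leq_trans ((K * (N %/ K).+1) ^ 4)).
  have -> : (N ^ 2 * N.+1 ^ 2 = (N * N.+1) ^ 2)%N by rewrite expnMn.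
  rewrite -[4%N]/(2 * 2)%N expnM leq_exp2r// expnS expn1 leq_mul//.
  exact: leq_trans (leqnSn _) h1.
rewrite expnMn leq_mul2l; apply/orP; right.
have -> : (16 = 2 ^ 4)%N by [].
by rewrite -expnM mulnC expnM leq_exp2r.
Qed.

(** Uses 1 / (n + 1)^2 <= 1 / n - 1 / (n + 1). *)
Lemma telescope_bound (u : nat -> R) (C : R) M N : 0 <= C -> (0 < M)%N -> (M <= N)%N ->
  (forall i, (M <= i)%N -> `|u i.+1 - u i| <= C / i.+1%:R ^+ 2) ->
  `|u N - u M| <= C / M%:R.
Proof.
move=> C0 M0 MN hu.
suff : `|u N - u M| <= C / M%:R - C / N%:R.
  by move=> h; apply: (le_trans h); rewrite gerBl divr_ge0.
rewrite -(subnK MN); elim: (N - M)%N => [|k IH].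
  by rewrite add0n !subrr normr0.
rewrite addSn; set n := (k + M)%N in IH *.
have n0 : 0 < n%:R :> R by rewrite ltr0n /n addn_gt0 M0 orbT.
have n1 : 0 < n.+1%:R :> R by rewrite ltr0n.
have h := hu n (leq_addl _ _).
have -> : u n.+1 - u M = (u n.+1 - u n) + (u n - u M) by ring.
apply: (le_trans (ler_normD _ _)).
have hc : C / n.+1%:R ^+ 2 <= C / n%:R - C / n.+1%:R.
  have -> : C / n%:R - C / n.+1%:R = C / (n%:R * n.+1%:R).
    by rewrite -natr1; field; rewrite natr1 !gt_eqF.
  rewrite ler_wpM2l// lef_pV2 ?posrE ?mulr_gt0 ?exprn_gt0//.
  by rewrite expr2 ler_wpM2r ?(ltW n1)// ler_nat.
apply: (le_trans (lerD (le_trans h hc) IH)).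
by rewrite le_eqVlt; apply/orP; left; apply/eqP; ring.
Qed.

Lemma sum_kappa_le M N : (0 < M)%N -> (M <= N)%N ->
  \sum_(M <= i < N) kappa i <= 100 ^+ 4 * K%:R ^+ 4.
Proof.
move=> M0 MN; set C := 100 ^+ 4 * _.
have C0 : 0 <= C by rewrite mulr_ge0 ?exprn_ge0.
pose u k := \sum_(M <= i < k) kappa i.
have := @telescope_bound u C M N C0 M0 MN.
rewrite /u [X in _ - X]big_geq// subr0 => h.
apply: (le_trans (ler_norm _)); apply: (le_trans (h _)).
  move=> i Mi; rewrite big_nat_recr//= addrAC subrr add0r ger0_norm ?kappa_ge0//.
  exact: kappa_le.
by rewrite ler_pdivrMr ?ltr0n// ler_peMr// ler1n.
Qed.

Lemma sqrt_mesh_le N : Num.sqrt (mesh N.+1) <= 16 / N.+1%:R ^+ 2.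
Proof.
set n := N.+1; have n0 : 0 < n%:R :> R by rewrite ltr0n.
have b0 : 0 <= 16 / n%:R ^+ 2 :> R by rewrite divr_ge0 ?exprn_ge0.
rewrite -ler_sqr ?nnegrE ?sqrtr_ge0// sqr_sqrtr ?(ltW (mesh_gt0 _ _))//.
rewrite expr_div_n -exprM ler_pdivlMr ?exprn_gt0// mulrC /mesh.
rewrite ler_pdivrMr ?exprn_gt0// -!natrX -natrM ler_nat.
have h1 : (n <= 4 * (n %/ 4).+1)%N by rewrite mulnC ltnW// ltn_ceil.
have h2 : ((n %/ 4).+1 <= 2 ^ (n %/ 4))%N by exact: ltn_expl.
apply: (@leq_trans ((4 * (n %/ 4).+1) ^ 4)); first by rewrite leq_exp2r.
rewrite expnMn -[(4 ^ 4)%N]/(16 ^ 2)%N leq_mul2l; apply/orP; right.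
apply: (@leq_trans ((2 ^ (n %/ 4)) ^ 4)); first by rewrite leq_exp2r.
by rewrite -expnM leq_exp2l// leq_trunc_div.
Qed.

Definition eventually_good N0 : set T := [set w | forall N, (N0 <= N)%N -> good W K N w].

Lemma holder_shift f y : holder alpha f -> holder alpha (fun t => f t + y).
Proof. by move=> hf s t hs ht; rewrite opprD addrACA subrr addr0; exact: hf. Qed.

(** A discrete Gronwall inequality. The step from N to N + 1 calls the bound at the coarser scale
    [blk K N] for shifted curves, so the induction carries all k <= N and all curves. It starts from
    the trivial bound: at most 2^N0 kernels, each at most 1. *)
Lemma local_sum_bounded N0 w : (K <= N0)%N -> eventually_good N0 w ->
  forall N, (N0 <= N)%N -> forall k, (k <= N)%N -> forall f, holder alpha f ->
  1 + local_sum (fun t => bm W t w) f k (2 ^ k) <=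
  (1 + 2 ^+ N0) * expR (\sum_(N0 <= i < N) kappa i).
Proof.
move=> KN0 gw N; set x := fun t => _.
elim: N => [|N IH].
  rewrite leqn0 => /eqP N00; move: KN0; rewrite N00 leqNgt => /negP[].
  exact: leq_trans K16.
rewrite leq_eqVlt => /predU1P[N0E|N0N] k kN f hf.
  rewrite -N0E big_geq// expR0 mulr1 lerD2l.
  have kN0 : (k <= N0)%N by rewrite N0E.
  apply: (@le_trans _ _ (\sum_(j < 2 ^ k) (1 : R))).
    apply: ler_sum => j _; apply: (le_trans (tanaka_le _ (mesh_gt0 _ _))).
    by rewrite -sqrtr1 ler_sqrt// mesh_le1.
  by rewrite sumr_const card_ord natrX ler_weXn2l// ler1n.
have {}N0N : (N0 <= N)%N by rewrite -ltnS.
have IHN := IH N0N; rewrite big_nat_recr//= expRD.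
set E := expR _ in IHN *.
have E0 : 0 <= (1 + 2 ^+ N0) * E by rewrite mulr_ge0 ?expR_ge0// addr_ge0// exprn_ge0.
have e1 : 1 + kappa N <= expR (kappa N) by exact: expR_ge1Dx.
have hE : (1 + 2 ^+ N0) * E * (1 + kappa N) <= (1 + 2 ^+ N0) * (E * expR (kappa N)).
  by rewrite mulrA ler_wpM2l.
have kp := kappa_ge0 N.
apply: le_trans hE.
move: kN; rewrite leq_eqVlt => /predU1P[->|kN]; last first.
  apply: (le_trans (IHN k _ f hf)) => //.
  by rewrite ler_peMr// lerDl.
have B0 : 0 <= (1 + 2 ^+ N0) * E - 1.
  have := IHN 0%N (leq0n _) f hf; rewrite lerBrDl addr0.
  by apply: le_trans; rewrite lerDl sumr_ge0// => j _; exact: tanaka_ge0 (mesh_gt0 _ _).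
have KN : (K <= N)%N by exact: leq_trans N0N.
have hb y : local_sum x (fun t => f t + y) (blk K N) (2 ^ blk K N) <= (1 + 2 ^+ N0) * E - 1.
  rewrite lerBrDl; apply: IHN; first exact: leq_subr.
  exact: holder_shift.
have st := local_sum_step alpha_gt K_large K16 KN hf (gw N N0N) alpha_le hb B0 (leqnn _).
have := IHN N (leqnn N) f hf.
have := ler_norm (local_sum x f N.+1 (2 ^ N).*2 - local_sum x f N (2 ^ N)).
rewrite -mul2n -expnS in st *; move: st; rewrite -/x.
set a := local_sum _ _ _ _; set b := local_sum _ _ _ _ => st h1 h2.
have -> : (1 + 2 ^+ N0) * E * (1 + kappa N) =
  (1 + 2 ^+ N0) * E + kappa N * (1 + ((1 + 2 ^+ N0) * E - 1)) by ring.
lra.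
Qed.

Definition approx (x f : R -> R) (N : nat) (t : R) : R := local_sum x f N (Num.truncn (t * 2 ^+ N)).

(** The sum of [kappa] times the Gronwall bound; the final 16, from [sqrt_mesh_le], pays for
    rounding the time to the grid. *)
Definition cauchy_const N0 : R :=
  100 ^+ 4 * K%:R ^+ 4 * ((1 + 2 ^+ N0) * expR (100 ^+ 4 * K%:R ^+ 4)) + 16.

Lemma cauchy_const_ge0 N0 : 0 <= cauchy_const N0.
Proof.
by rewrite addr_ge0// !mulr_ge0 ?exprn_ge0 ?expR_ge0// addr_ge0// exprn_ge0.
Qed.

Lemma truncn_double (t : R) : 0 <= t ->
  Num.truncn (2 * t) = (Num.truncn t).*2 \/ Num.truncn (2 * t) = (Num.truncn t).*2.+1.
Proof.
move=> t0; have /andP[h1 h2] := truncn_itv t0.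
have t20 : 0 <= 2 * t by rewrite mulr_ge0.
have /andP[h3 h4] := truncn_itv t20.
move: h1 h2 h3 h4; set a := Num.truncn t; set b := Num.truncn (2 * t) => h1 h2 h3 h4.
have l1 : (a.*2 < b.+1)%N.
  by rewrite -(ltr_nat R) -mul2n natrM; apply: le_lt_trans h4; rewrite ler_wpM2l.
have l2 : (b < a.*2.+2)%N.
  rewrite -(ltr_nat R) -doubleS -mul2n natrM; apply: (le_lt_trans h3).
  by rewrite ltr_pM2l.
by have [e|e] : b = a.*2 \/ b = a.*2.+1 by [lia]; [left|right].
Qed.

(** The rate depends on the outcome only through [N0], and not on the curve or on the time; the
    joint continuity and the identification of the limit both rest on this. *)
Lemma approx_cauchy N0 w f (t : R) M N : (K <= N0)%N -> eventually_good N0 w ->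
  holder alpha f -> 0 <= t <= 1 -> (N0 <= M)%N -> (M <= N)%N ->
  `|approx (fun t => bm W t w) f N t - approx (fun t => bm W t w) f M t|
    <= cauchy_const N0 / M%:R.
Proof.
move=> KN0 gw hf /andP[t0 t1] N0M MN; set x := fun t => _.
have N00 : (0 < N0)%N by apply: leq_trans KN0; apply: leq_trans K16.
have M0 : (0 < M)%N by exact: leq_trans N0M.
pose C := 100 ^+ 4 * K%:R ^+ 4 : R.
have C0 : 0 <= C by rewrite mulr_ge0 ?exprn_ge0.
apply: (telescope_bound (u := fun N => approx x f N t) (cauchy_const_ge0 N0) M0 MN) => i Mi.
have N0i := leq_trans N0M Mi; have Ki := leq_trans KN0 N0i.
pose D : R := (1 + 2 ^+ N0) * expR C.
have bD k y : (k <= i)%N -> 1 + local_sum x (fun t => f t + y) k (2 ^ k) <= D.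
  move=> ki; apply: (le_trans (local_sum_bounded KN0 gw N0i ki (holder_shift y hf))).
  rewrite ler_wpM2l ?addr_ge0 ?exprn_ge0// ler_expR.
  exact: sum_kappa_le.
have D1 : 0 <= D - 1.
  have := bD 0%N 0 (leq0n _); rewrite subr_ge0; apply: le_trans.
  by rewrite lerDl sumr_ge0// => j _; exact: tanaka_ge0 (mesh_gt0 _ _).
have hb y : local_sum x (fun t => f t + y) (blk K i) (2 ^ blk K i) <= D - 1.
  by rewrite lerBrDl; apply: bD; exact: leq_subr.
pose J := Num.truncn (t * 2 ^+ i).
have Ji : (J <= 2 ^ i)%N.
  rewrite -(ler_nat R) natrX; apply: (@le_trans _ _ (t * 2 ^+ i)).
    by rewrite truncn_le mulr_ge0// exprn_ge0.
  by rewrite ler_piMl// exprn_ge0.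
have st := local_sum_step alpha_gt K_large K16 Ki hf (gw i N0i) alpha_le hb D1 Ji.
rewrite /approx -/J exprS mulrCA.
have ti0 : 0 <= t * 2 ^+ i by rewrite mulr_ge0// exprn_ge0.
(* Halving the mesh doubles the rounded index of t, up to one extra term, which is at most sqrt
   (mesh i.+1). *)
have step : `|local_sum x f i.+1 (Num.truncn (2 * (t * 2 ^+ i))) - local_sum x f i.+1 J.*2|
    <= Num.sqrt (mesh i.+1).
  case: (truncn_double ti0) => ->; rewrite -/J; first by rewrite subrr normr0 sqrtr_ge0.
  rewrite /local_sum big_ord_recr /= addrAC subrr add0r.
  by rewrite ger0_norm ?tanaka_ge0 ?tanaka_le ?mesh_gt0.
set a := local_sum _ _ _ _ in step *; set b := local_sum _ _ _ J.*2 in step st.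
set c := local_sum _ _ _ J in st *.
have -> : a - c = (a - b) + (b - c) by ring.
apply: (le_trans (ler_normD _ _)).
apply: (@le_trans _ _ (16 / i.+1%:R ^+ 2 + C / i.+1%:R ^+ 2 * D)).
  apply: lerD; first by apply: (le_trans step); exact: sqrt_mesh_le.
  apply: (le_trans st); rewrite [1 + _]addrC subrK ler_wpM2r ?kappa_le//.
  by lra.
by rewrite /cauchy_const -/C -/D le_eqVlt; apply/orP; left; apply/eqP; ring.
Qed.

End uniform_convergence.

(** * Identification with the occupation density *)

Section continuity_on_sets.
Context {R : realType}.
Implicit Types (A : set R) (g : R -> R).

Lemma within_continuousP A g : {within A, continuous g} <->
  (forall x, A x -> forall e, 0 < e -> exists2 d, 0 < d &
     forall y, A y -> `|x - y| < d -> `|g x - g y| < e).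
Proof.
split.
  move=> /subspace_continuousP cg x Ax e e0.
  have := cg x Ax; move=> /cvgrPdist_lt/(_ e e0); rewrite near_withinE.
  move=> /nbhs_ballP[d/= d0 hd]; exists d => // y Ay xy.
  by apply: hd.
move=> h; apply/subspace_continuousP => x Ax; apply/cvgrPdist_lt => e e0.
rewrite near_withinE; have [d d0 hd] := h x Ax e e0.
by apply/nbhs_ballP; exists d => //= y xy Ay; exact: hd.
Qed.

Lemma segment_uniform_continuous g (a b : R) : {within `[a, b], continuous g} ->
  forall e, 0 < e -> exists2 d, 0 < d &
    forall x y, a <= x <= b -> a <= y <= b -> `|x - y| < d -> `|g x - g y| < e.
Proof.
move=> /within_continuousP cg e e0.
have := @segment_compact R a b; rewrite compact_near_coveringP => ncov.
pose Q (d x : R) := forall y, a <= x <= b -> a <= y <= b -> `|x - y| < d -> `|g x - g y| < e.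
have : \forall d \near 0^'+, `[a, b]%classic `<=` Q d.
  apply: ncov => x xab.
  have [d d0 hd] := cg x xab (e / 2) ltac:(by rewrite divr_gt0).
  exists (ball x (d / 2), [set r | 0 < r < d / 2]) => /=.
    split; first by apply: nbhsx_ballx; rewrite divr_gt0.
    have d20 : 0 < d / 2 by rewrite divr_gt0.
    near=> r; apply/andP; split; near: r; first exact: nbhs_right_gt.
    exact: nbhs_right_lt.
  move=> [x' r] /= [xx' /andP[r0 rd]] y x'ab yab x'y.
  have h1 : `|g x - g x'| < e / 2.
    apply: hd; first by rewrite /= in_itv.
    by apply: (lt_trans xx'); rewrite ltr_pdivrMr// ltr_pMr// ltr1n.
  have h2 : `|g x - g y| < e / 2.
    apply: hd; first by rewrite /= in_itv.
    have := ler_normD (x - x') (x' - y); rewrite addrA subrK.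
    by move: xx'; rewrite /ball /=; lra.
  have := ler_normD (g x' - g x) (g x - g y); rewrite addrA subrK.
  by rewrite distrC in h1; lra.
move=> [d/= d0 hd]; exists (d / 2); first by rewrite divr_gt0.
move=> x y xab yab xy; apply: (hd (d / 2)) => //=.
- by rewrite sub0r normrN gtr0_norm ?divr_gt0// ltr_pdivrMr// ltr_pMr// ltr1n.
- by rewrite divr_gt0.
Unshelve. all: by end_near. Qed.

End continuity_on_sets.

Section occupation_time.
Context {R : realType}.
Local Notation mesh := (@mesh R).
Local Notation mu := (@lebesgue_measure R).
Implicit Types (g : R -> R).

Lemma mesh_small (e : R) : 0 < e -> exists n0, forall N, (n0 <= N)%N -> mesh N < e.
Proof.
move=> e0; exists (Num.truncn e^-1).+1 => N hN.
have ei : 0 <= e^-1 by rewrite invr_ge0 ltW.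
have /andP[_ h] := truncn_itv ei.
rewrite /mesh -[ltRHS]invrK ltf_pV2 ?posrE ?invr_gt0 ?exprn_gt0//.
apply: (lt_trans h); rewrite -natrX ltr_nat; apply: (leq_ltn_trans hN).
exact: ltn_expl.
Qed.

Definition occupation (g : R -> R) (eps t : R) : R :=
  fine (mu (`[0, t] `&` [set s | `|g s| < eps])).

Lemma measurable_occupation_set g eps t : t <= 1 -> {within `[0, 1], continuous g} ->
  measurable (`[0, t] `&` [set s | `|g s| < eps]).
Proof.
move=> t1 cg; have mg : measurable_fun (`[0, 1]%classic : set R) g.
  exact: subspace_continuous_measurable_fun.
have mgt : measurable_fun (`[0, t]%classic : set R) (fun s => `|g s|).
  apply: measurableT_comp => //; apply: measurable_funS mg => //.
  by apply: subset_itvl; rewrite bnd_simp.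
rewrite (_ : [set s | _] = (fun s => `|g s|) @^-1` `]-oo, eps[); last first.
  by apply/seteqP; split => s /=; rewrite in_itv.
exact: mgt.
Qed.

Definition hits g (N J : nat) (eps : R) : nat :=
  (\sum_(j < J) (`|g (mesh N * j%:R)| < eps)%R)%N.

Let cell N j : set R := `[mesh N * j%:R, mesh N * j.+1%:R[%classic.

Let cellP N j s : s \in (cell N j) -> `|mesh N * j%:R - s| <= mesh N.
Proof.
rewrite inE /cell /= in_itv/= => /andP[h1 h2].
rewrite distrC ger0_norm ?subr_ge0// lerBlDl (le_trans (ltW h2))//.
by rewrite -natr1 mulrDr mulr1.
Qed.

Let mu_cell N j : mu (cell N j) = (mesh N)%:E.
Proof.
rewrite lebesgue_measure_itv/= lte_fin ltr_pM2l ?mesh_gt0// ltr_nat ltnSn.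
by rewrite -EFinB -natr1 mulrDr mulr1 addrC addKr.
Qed.

Let measure_cells (V : set R) N J : measurable V ->
  V `<=` `[0, mesh N * J%:R[%classic ->
  (mu V = \sum_(j < J) mu (V `&` cell N j))%E.
Proof.
move=> mV; elim: J V mV => [|J IH] V mV hV.
  rewrite big_ord0 (_ : V = set0) ?measure0//; apply/seteqP; split => // s /hV /=.
  by rewrite mulr0 in_itv/= => /andP[h1 h2]; have := le_lt_trans h1 h2; rewrite ltxx.
have c0 : 0 <= mesh N * J%:R by rewrite mulr_ge0 ?(ltW (mesh_gt0 _ _)).
have VE : V = (V `&` `[0, mesh N * J%:R[) `|` (V `&` cell N J).
  apply/seteqP; split => s /=; last by case => -[].
  move=> Vs; have := hV s Vs; rewrite /= !in_itv/= => /andP[s0 s1].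
  have [h|h] := ltP s (mesh N * J%:R); [left|right]; split => //.
    by rewrite s0.
  by rewrite /cell /= in_itv/= h.
rewrite big_ord_recr /= {1}VE measureU//; last 3 first.
- by apply: measurableI => //; exact: measurable_itv.
- by apply: measurableI => //; exact: measurable_itv.
- apply/seteqP; split => s //= [[_ +] [_ +]]; rewrite /cell/= !in_itv/=.
  by move=> /andP[_ h1] /andP[h2 _]; have := lt_le_trans h1 h2; rewrite ltxx.
congr (_ + _)%E; apply: etrans.
  apply: IH; first by apply: measurableI => //; exact: measurable_itv.
  by move=> s /= [].
apply: eq_bigr => j _; congr (mu _); apply/seteqP; split => s /=; first by case => -[].
move=> [Vs Cs]; split=> //; split=> //; move: (hV s Vs) Cs; rewrite /cell /= !in_itv/=.
move=> /andP[-> _] /andP[_ h2]; apply: (lt_le_trans h2).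
by rewrite ler_wpM2l ?(ltW (mesh_gt0 _ _))// ler_nat.
Qed.

(** Uniform continuity: on fine grids g varies by less than rho within a cell, so its value at the
    left end decides the whole cell up to a change of eps by rho. The last term is the incomplete
    cell ending at t. *)
Lemma occupation_hits g eps rho : 0 < rho -> {within `[0, 1], continuous g} ->
  exists n0, forall N, (n0 <= N)%N -> forall t, 0 <= t <= 1 ->
    mesh N * (hits g N (Num.truncn (t * 2 ^+ N)) (eps - rho))%:R <= occupation g eps t /\
    occupation g eps t <=
      mesh N * (hits g N (Num.truncn (t * 2 ^+ N)) (eps + rho))%:R + mesh N.
Proof.
move=> rho0 cg; have [d d0 hd] := segment_uniform_continuous cg rho0.
have [n0 hn0] := mesh_small d0.
exists n0 => N /hn0 hN t /andP[t0 t1].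
have m0 := mesh_gt0 R N.
have tN : 0 <= t * 2 ^+ N by rewrite mulr_ge0// exprn_ge0.
have /andP[J1 J2] := truncn_itv tN; set J := Num.truncn _ in J1 J2 *.
have meshK : mesh N * 2 ^+ N = 1 by rewrite /mesh mulVf// expf_neq0.
have tE : t = mesh N * (t * 2 ^+ N) by rewrite mulrCA meshK mulr1.
have Jt : mesh N * J%:R <= t.
  by rewrite [leRHS]tE ler_pM2l.
have tJ : t < mesh N * J.+1%:R.
  by rewrite [ltLHS]tE ltr_pM2l.
set V := `[0, t] `&` [set s | `|g s| < eps].
have mV : measurable V by exact: measurable_occupation_set.
have VJ : V `<=` `[0, mesh N * J.+1%:R[%classic.
  move=> s [/=]; rewrite !in_itv/= => /andP[-> st] _ /=.
  exact: le_lt_trans tJ.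
have muV := measure_cells mV VJ.
have fin j : mu (V `&` cell N j) \is a fin_num.
  rewrite ge0_fin_numE// (@le_lt_trans _ _ (mu (cell N j)))//.
    by apply: le_measure; rewrite ?inE//; [apply: measurableI => //|]; exact: measurable_itv.
  by rewrite mu_cell ltry.
pose a j := fine (mu (V `&` cell N j)).
have occE : occupation g eps t = \sum_(j < J) a j + a J.
  rewrite /occupation -/V muV big_ord_recr /=.
  rewrite (eq_bigr (fun j : 'I_J => (a j)%:E)); last by move=> j _; rewrite fineK.
  by rewrite sumEFin -(fineK (fin J)) -EFinD.
have a0 j : 0 <= a j by exact: fine_ge0.
have ah j : a j <= mesh N.
  rewrite -lee_fin fineK// -(mu_cell N j); apply: le_measure; rewrite ?inE//.
    by apply: measurableI => //; exact: measurable_itv.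
  exact: measurable_itv.
have cl j s : s \in cell N j -> (j <= J)%N -> s <= 1 ->
    `|g (mesh N * j%:R) - g s| < rho.
  move=> sj jJ s1; have h1 := cellP sj; move: sj.
  rewrite inE /cell /= in_itv/= => /andP[s2 s3].
  have p0 : 0 <= mesh N * j%:R by rewrite mulr_ge0// ltW.
  apply: hd; last exact: le_lt_trans hN.
    by rewrite p0 (le_trans s2).
  by rewrite s1 (le_trans p0).
have hm c : mesh N * (hits g N J c)%:R =
    \sum_(j < J) (if `|g (mesh N * j%:R)| < c then mesh N else 0).
  rewrite /hits natr_sum mulr_sumr; apply: eq_bigr => j _.
  by case: ifP => _; rewrite ?mulr1 ?mulr0.
rewrite occE !hm; split.
  apply: (@le_trans _ _ (\sum_(j < J) a j)); last by rewrite lerDl.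
  apply: ler_sum => j _; case: ifPn => // gj.
  rewrite /a -lee_fin fineK// -(mu_cell N j); apply: le_measure; rewrite ?inE//.
  - exact: measurable_itv.
  - by apply: measurableI => //; exact: measurable_itv.
  move=> s sj; split=> //.
  have st : s <= t.
    move: (sj); rewrite /cell /= in_itv/= => /andP[_ s3].
    apply: (le_trans (ltW s3)); apply: le_trans Jt.
    by rewrite ler_pM2l// ler_nat.
  split.
    move: (sj); rewrite /cell /= !in_itv/= => /andP[s2 _].
    by rewrite st andbT (le_trans _ s2)// mulr_ge0// ltW.
  have := cl j s (mem_set sj) (ltnW (ltn_ord j)) (le_trans st t1).
  have := ler_normD (g s - g (mesh N * j%:R)) (g (mesh N * j%:R)).
  by rewrite subrK distrC /=; lra.
apply: lerD => //; apply: ler_sum => j _; case: ifPn => // gj.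
rewrite /a (_ : V `&` _ = set0) ?measure0//.
apply/seteqP; split => s //= [[/= sv sg] sj]; move: gj => /negP; apply.
have s1 : s <= 1 by move: sv; rewrite in_itv/= => /andP[_ h]; exact: le_trans h t1.
have := cl j s (mem_set sj) (ltnW (ltn_ord j)) s1.
have := ler_normD (g (mesh N * j%:R) - g s) (g s).
by rewrite subrK; lra.
Qed.

End occupation_time.

(** * Averaging the kernel over vertical shifts *)

Section averaged_kernel.
Context {R : realType}.
Implicit Types (eps rho u v y z delta : R).

(* The mean of |u - y| for y uniform on [-eps, eps]. *)
Definition cap eps u : R :=
  ((eps - u) * `|eps - u| + (eps + u) * `|eps + u|) / (4 * eps).

(** The derivative of [cap]. The second derivative is 1 / eps inside (-eps, eps) and 0 outside, so a
    centred Gaussian step of variance v raises [cap] on average by about v / (2 eps) times the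
    indicator of that interval: the occupation density of one time step. *)
Definition cap_slope eps u : R := (`|eps + u| - `|eps - u|) / (2 * eps).

(** The centre of the i-th of q equal cells of [-eps, eps]. *)
Definition midpoint eps (q i : nat) : R := - eps + (2 * i%:R + 1) * (eps / q%:R).

Lemma cap_remainder_norm eps u z : 0 < eps ->
  `|cap eps (u + z) - cap eps u - cap_slope eps u * z| <= z ^+ 2 / (2 * eps).
Proof.
move=> e0.
have hB (a b : R) : `|(a + b) * `|a + b| - a * `|a| - 2 * `|a| * b| <= b ^+ 2.
  rewrite ler_norml.
  by case: (ger0P a) => a0; case: (ger0P (a + b)) => ab; apply/andP; split; nra.
have h1 := hB (eps - u) (- z); have h2 := hB (eps + u) z.
rewrite sqrrN in h1.
have -> : cap eps (u + z) - cap eps u - cap_slope eps u * z =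
  (((eps - u + - z) * `|eps - u + - z| - (eps - u) * `|eps - u| - 2 * `|eps - u| * - z) +
   ((eps + u + z) * `|eps + u + z| - (eps + u) * `|eps + u| - 2 * `|eps + u| * z)) / (4 * eps).
  rewrite /cap /cap_slope opprD !addrA; field; exact: lt0r_neq0.
have e4 : 0 < 4 * eps by rewrite mulr_gt0.
rewrite normrM [`|(4 * eps)^-1|]gtr0_norm ?invr_gt0// ler_pdivrMr//.
have -> : z ^+ 2 / (2 * eps) * (4 * eps) = z ^+ 2 + z ^+ 2 by field; exact: lt0r_neq0.
exact: (le_trans (ler_normD _ _) (lerD h1 h2)).
Qed.

Lemma cap_remainder_out eps rho u z : 0 < eps -> eps + rho <= `|u| -> `|z| <= rho ->
  cap eps (u + z) - cap eps u - cap_slope eps u * z = 0.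
Proof.
move=> e0; rewrite /cap /cap_slope => hu; rewrite ler_norml => /andP[z1 z2].
have e1 := lt0r_neq0 e0.
move: hu; case: (ger0P u) => u0 hu.
  rewrite !(@ler0_norm _ (eps - _)) ?subr_le0; [|lra|lra].
  rewrite !(@ger0_norm _ (eps + _)); [|lra|lra].
  by field.
rewrite !(@ger0_norm _ (eps - _)) ?subr_ge0; [|lra|lra].
rewrite !(@ler0_norm _ (eps + _)); [|lra|lra].
by field.
Qed.

Lemma cap_remainder_in eps rho u z : 0 < eps -> `|u| < eps - rho -> `|z| <= rho ->
  cap eps (u + z) - cap eps u - cap_slope eps u * z = z ^+ 2 / (2 * eps).
Proof.
move=> e0; rewrite ltr_norml => /andP[u1 u2]; rewrite ler_norml => /andP[z1 z2].
rewrite /cap /cap_slope.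
rewrite !(@ger0_norm _ (eps - _)) ?subr_ge0; [|lra|lra].
rewrite !(@ger0_norm _ (eps + _)); [|lra|lra].
by field; exact: lt0r_neq0.
Qed.

(** Since a |a| / 2 is a primitive of |a|, differences of [B] give the exact mean over each cell;
    they telescope to [cap], and each midpoint value is off by at most the half-width [delta]. *)
Lemma midpoint_average eps q u : 0 < eps -> (0 < q)%N ->
  `|q%:R^-1 * \sum_(i < q) `|u - midpoint eps q i| - cap eps u| <= eps / q%:R.
Proof.
move=> e0 q0; have qR : 0 < q%:R :> R by rewrite ltr0n.
pose delta := eps / q%:R; have d0 : 0 < delta by rewrite divr_gt0.
have dq : delta * q%:R = eps by rewrite /delta divfK// gt_eqF.
pose B (a : R) := a * `|a|.
have cell (z : R) : `| `|z| - (B (z + delta) - B (z - delta)) / (4 * delta)| <= delta.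
  have d4 : 0 < 4 * delta by rewrite mulr_gt0.
  have -> : `|z| - (B (z + delta) - B (z - delta)) / (4 * delta) =
      (`|z| * (4 * delta) - (B (z + delta) - B (z - delta))) / (4 * delta).
    by field; exact: lt0r_neq0.
  rewrite normrM [`|(4 * delta)^-1|]gtr0_norm ?invr_gt0// ler_pdivrMr// /B ler_norml.
  case: (ger0P z) => z0; case: (ger0P (z + delta)) => z1; case: (ger0P (z - delta)) => z2;
    apply/andP; split; nra.
have tele k : (k <= q)%N -> \sum_(i < k) (B (u - midpoint eps q i + delta) -
    B (u - midpoint eps q i - delta)) = B (u + eps) - B (u + eps - 2 * k%:R * delta).
  elim: k => [|k IH] kq; first by rewrite big_ord0 mulr0 mul0r subr0 subrr.
  rewrite big_ord_recr /= IH 1?ltnW//.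
  have -> : u - midpoint eps q k + delta = u + eps - 2 * k%:R * delta.
    by rewrite /midpoint -/delta; ring.
  have -> : u - midpoint eps q k - delta = u + eps - 2 * k.+1%:R * delta.
    by rewrite /midpoint -/delta -natr1; ring.
  by ring.
have capE : cap eps u = q%:R^-1 * \sum_(i < q) ((B (u - midpoint eps q i + delta) -
    B (u - midpoint eps q i - delta)) / (4 * delta)).
  rewrite -mulr_suml tele//.
  have -> : u + eps - 2 * q%:R * delta = - (eps - u).
    by rewrite -mulrA [q%:R * delta]mulrC dq; ring.
  rewrite /B normrN /cap [u + eps]addrC -dq; field.
  by rewrite !gt_eqF.
rewrite capE -mulrBr -sumrB normrM gtr0_norm ?invr_gt0// mulrC ler_pdivrMr//.
apply: (le_trans (ler_norm_sum _ _ _)).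
apply: (@le_trans _ _ (\sum_(i < q) delta)); first by apply: ler_sum => i _; exact: cell.
by rewrite sumr_const card_ord -[leLHS]mulr_natr.
Qed.

Lemma measurable_cap eps : measurable_fun setT (cap eps).
Proof.
apply: measurable_funM => //; apply: measurable_funD; apply: measurable_funM.
- exact: measurable_funB.
- by apply: measurableT_comp => //; exact: measurable_funB.
- exact: measurable_funD.
- by apply: measurableT_comp => //; exact: measurable_funD.
Qed.

Definition cap_gain v eps u : R := \int[gauss v]_z (cap eps (u + z) - cap eps u).

Let rem eps u z := cap eps (u + z) - cap eps u - cap_slope eps u * z.

Let iz v : 0 < v -> (gauss v).-integrable setT (EFin \o (fun z : R => z)).
Proof. by move=> v0; exact: (@integrable_gauss_expn R v 1 v0). Qed.

Let irem v eps u : 0 < v -> 0 < eps -> (gauss v).-integrable setT (EFin \o rem eps u).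
Proof.
move=> v0 e0; apply: (@integrable_gauss _ _ (2 * (2 * eps)^-1) 1) => //.
  apply: measurable_funB; last exact: measurable_funM.
  apply: measurable_funB => //.
  by apply: (measurableT_comp (measurable_cap eps)); exact: measurable_funD.
move=> z; apply: (le_trans (cap_remainder_norm _ _ e0)).
rewrite mul1r [leRHS]mulrAC ler_pM2r ?invr_gt0 ?mulr_gt0//.
by rewrite -[leLHS]real_normK ?num_real//; exact: (exprn_le_fact_expR 2).
Qed.

Let icap v eps u : 0 < v -> 0 < eps ->
  (gauss v).-integrable setT (EFin \o (fun z => cap eps (u + z) - cap eps u)).
Proof.
move=> v0 e0.
rewrite (_ : (fun z => _) = (fun z => rem eps u z + cap_slope eps u * z)); last first.
  by apply/funext => z; rewrite /rem subrK.
by apply: integrableD_EFin; [exact: irem|apply: integrableZ_EFin; exact: iz].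
Qed.

Let gainE v eps u : 0 < v -> 0 < eps -> cap_gain v eps u = \int[gauss v]_z rem eps u z.
Proof.
move=> v0 e0; rewrite RintegralB//; last 2 first.
- exact: icap.
- by apply: integrableZ_EFin; exact: iz.
by rewrite RintegralZl//; [rewrite gauss_mean// mulr0 subr0|exact: iz].
Qed.

Let i2 v c : 0 < v -> (gauss v).-integrable setT (EFin \o (fun z : R => c * z ^+ 2)).
Proof. by move=> v0; apply: integrableZ_EFin; exact: integrable_gauss_expn. Qed.

Let i4 v c : 0 < v -> (gauss v).-integrable setT (EFin \o (fun z : R => c * z ^+ 4)).
Proof. by move=> v0; apply: integrableZ_EFin; exact: integrable_gauss_expn. Qed.

Lemma cap_gain_le v eps u : 0 < v -> 0 < eps -> cap_gain v eps u <= v / (2 * eps).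
Proof.
move=> v0 e0; rewrite gainE//.
rewrite -[X in _ <= X / _](gauss_variance v0) mulrC -RintegralZl//; last first.
  exact: integrable_gauss_expn.
apply: le_Rintegral => //; [exact: irem|exact: i2|].
move=> z _; apply: (le_trans (ler_norm _)); rewrite mulrC.
exact: cap_remainder_norm.
Qed.

Let sq_le_fourth rho z : 0 < rho -> rho <= `|z| -> z ^+ 2 <= rho ^- 2 * z ^+ 4.
Proof.
move=> r0 hz; rewrite mulrC ler_pdivlMr ?exprn_gt0//.
have -> : z ^+ 4 = z ^+ 2 * z ^+ 2 by ring.
rewrite ler_wpM2l ?sqr_ge0// -[leRHS]real_normK ?num_real//.
by rewrite ler_sqr ?nnegrE ?(ltW r0).
Qed.

(** For |z| <= rho the function [cap] is affine between u and u + z, so only larger z count, and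
    there z^2 <= z^4 / rho^2. The fourth moment gives an error O(v^2), harmless over the at most 1 /
    v steps. *)
Lemma cap_gain_out v eps rho u : 0 < v -> 0 < eps -> 0 < rho -> eps + rho <= `|u| ->
  cap_gain v eps u <= 96 * v ^+ 2 / (2 * eps * rho ^+ 2).
Proof.
move=> v0 e0 r0 hu; rewrite gainE//.
have c0 : 0 < (2 * eps)^-1 * rho ^- 2.
  by rewrite mulr_gt0// invr_gt0 ?mulr_gt0 ?exprn_gt0.
apply: (@le_trans _ _ (\int[gauss v]_z ((2 * eps)^-1 * rho ^- 2 * z ^+ 4))).
  apply: le_Rintegral => //; [exact: irem|exact: i4|].
  move=> z _; have [hz|hz] := leP `|z| rho.
    by rewrite /rem (cap_remainder_out e0 hu hz) mulr_ge0 ?(ltW c0)// exprn_even_ge0.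
  apply: (le_trans (ler_norm _)); apply: (le_trans (cap_remainder_norm _ _ e0)).
  rewrite mulrC -mulrA ler_wpM2l ?invr_ge0 ?mulr_ge0 ?(ltW e0)//.
  by apply: sq_le_fourth => //; exact: ltW.
rewrite RintegralZl//; last exact: integrable_gauss_expn.
have -> : 96 * v ^+ 2 / (2 * eps * rho ^+ 2) = (2 * eps)^-1 * rho ^- 2 * (96 * v ^+ 2).
  by field; rewrite !gt_eqF.
by rewrite ler_wpM2l ?(ltW c0)//; exact: gauss_fourth_moment_le.
Qed.

Lemma cap_gain_in v eps rho u : 0 < v -> 0 < eps -> 0 < rho -> `|u| < eps - rho ->
  v / (2 * eps) - 96 * v ^+ 2 / (eps * rho ^+ 2) <= cap_gain v eps u.
Proof.
move=> v0 e0 r0 hu; rewrite gainE//.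
have c0 : 0 < eps^-1 * rho ^- 2.
  by rewrite mulr_gt0// invr_gt0 ?exprn_gt0.
apply: (@le_trans _ _ (\int[gauss v]_z ((2 * eps)^-1 * z ^+ 2 - eps^-1 * rho ^- 2 * z ^+ 4))).
  rewrite RintegralB//; [|exact: i2|exact: i4].
  rewrite !RintegralZl//; [|exact: integrable_gauss_expn|exact: integrable_gauss_expn].
  rewrite gauss_variance// [v / _]mulrC lerD2l lerN2.
  have -> : 96 * v ^+ 2 / (eps * rho ^+ 2) = eps^-1 * rho ^- 2 * (96 * v ^+ 2).
    by field; rewrite !gt_eqF.
  by rewrite ler_wpM2l ?(ltW c0)//; exact: gauss_fourth_moment_le.
apply: le_Rintegral => //; [|exact: irem|].
  by apply: integrableB_EFin; [exact: i2|exact: i4].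
move=> z _; have [hz|hz] := leP `|z| rho.
  rewrite /rem (cap_remainder_in e0 hu hz) mulrC gerBl.
  by rewrite mulr_ge0 ?(ltW c0)// exprn_even_ge0.
have h1 := cap_remainder_norm u z e0; rewrite -/(rem eps u z) in h1.
have h2 : (2 * eps)^-1 * z ^+ 2 * 2 <= eps^-1 * rho ^- 2 * z ^+ 4.
  have -> : (2 * eps)^-1 * z ^+ 2 * 2 = eps^-1 * z ^+ 2 by field; exact: lt0r_neq0.
  rewrite -mulrA ler_wpM2l ?invr_ge0 ?(ltW e0)//.
  by apply: sq_le_fourth => //; exact: ltW.
move: h1; rewrite ler_norml [z ^+ 2 / _]mulrC => /andP[h1 _]; lra.
Qed.

(** The kernel is the mean gain of the absolute value over a Gaussian step; its average over shifts
    is that of [cap], up to the midpoint error at both ends of the step. *)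
Lemma tanaka_average v eps q u : 0 < v -> 0 < eps -> (0 < q)%N ->
  `|q%:R^-1 * \sum_(i < q) tanaka v (u - midpoint eps q i) - cap_gain v eps u|
    <= 2 * eps / q%:R.
Proof.
move=> v0 e0 q0; have qR : 0 < q%:R :> R by rewrite ltr0n.
pose psi u := q%:R^-1 * \sum_(i < q) `|u - midpoint eps q i|.
have isum k u' : (gauss v).-integrable setT
    (EFin \o (fun z => \sum_(i < k) `|u' + z - midpoint eps q i|)) /\
    \int[gauss v]_z \sum_(i < k) `|u' + z - midpoint eps q i| =
    \sum_(i < k) gauss_abs v (u' - midpoint eps q i).
  have sw i z : `|u' + z - midpoint eps q i| = `|u' - midpoint eps q i + z|.
    by rewrite addrAC.
  elim: k => [|k [IHi IHe]].
    rewrite (_ : (fun z => _) = cst 0); last by apply/funext => z; rewrite big_ord0.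
    split; first exact: integrable_gauss_cst.
    by rewrite big_ord0; exact: (Rintegral_gauss_cst v 0).
  rewrite (_ : (fun z => _) = (fun z => \sum_(i < k) `|u' + z - midpoint eps q i| +
      `|u' - midpoint eps q k + z|)); last first.
    by apply/funext => z; rewrite big_ord_recr /= sw.
  split; first by apply: integrableD_EFin => //; exact: integrable_gauss_abs.
  rewrite RintegralD//; last exact: integrable_gauss_abs.
  by rewrite IHe big_ord_recr.
have [ips eps_] := isum q u.
have ipsi : (gauss v).-integrable setT (EFin \o (fun z => psi (u + z))).
  exact: integrableZ_EFin.
have E1 : q%:R^-1 * \sum_(i < q) tanaka v (u - midpoint eps q i) =
    \int[gauss v]_z (psi (u + z) - psi u).
  rewrite RintegralB//; last exact: integrable_gauss_cst.
  rewrite Rintegral_gauss_cst /psi RintegralZl// eps_ -mulrBr -sumrB.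
  by congr (_ * _); apply: eq_bigr => i _; rewrite tanakaE.
rewrite E1 /cap_gain -RintegralB//; last 2 first.
- by apply: integrableB_EFin => //; exact: integrable_gauss_cst.
- exact: icap.
have i1 : (gauss v).-integrable setT (EFin \o (fun z =>
    psi (u + z) - psi u - (cap eps (u + z) - cap eps u))).
  apply: integrableB_EFin; last exact: icap.
  by apply: integrableB_EFin => //; exact: integrable_gauss_cst.
apply: (le_trans (le_normr_Rintegral _ i1)) => //.
rewrite -[leRHS](Rintegral_gauss_cst v); apply: le_Rintegral => //.
- exact: integrable_norm.
- exact: integrable_gauss_cst.
- move=> z _; have h1 := midpoint_average (u + z) e0 q0; have h2 := midpoint_average u e0 q0.
  rewrite -/(psi _) in h1; rewrite -/(psi _) in h2.
  have -> : psi (u + z) - psi u - (cap eps (u + z) - cap eps u) =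
     (psi (u + z) - cap eps (u + z)) - (psi u - cap eps u) by ring.
  apply: (le_trans (ler_normB _ _)); apply: (le_trans (lerD h1 h2)).
  by rewrite le_eqVlt; apply/orP; left; apply/eqP; ring.
Qed.

End averaged_kernel.

Section identification.
Context {R : realType}.
Local Notation mesh := (@mesh R).
Implicit Types (x f g : R -> R).

Lemma le_of_arbitrarily_small (a b c : R) :
  (forall e, 0 < e -> exists r, 0 < r < e /\ a <= b + r * c) -> a <= b.
Proof.
move=> h; rewrite leNgt; apply/negP => ba.
have c0 : 0 < 1 + `|c| by rewrite ltr_pwDl.
have [|r [/andP[r0 re] hr]] := h ((a - b) / (1 + `|c|)); first by rewrite divr_gt0// subr_gt0.
move: re; rewrite ltr_pdivlMr// => re.
have : r * c <= r * (1 + `|c|).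
  by rewrite ler_wpM2l ?(ltW r0)// (le_trans (ler_norm c))// lerDr.
lra.
Qed.

(** With 4^N shifts the midpoint error is 2 eps mesh(N)^2 per kernel, so that 2^N of them still add
    up to O(mesh N). *)
Definition shift_average x f eps N J : R :=
  (4 ^ N)%:R^-1 * \sum_(i < 4 ^ N) local_sum x (fun t => f t + midpoint eps (4 ^ N) i) N J.

Section fixed_scale.
Variables (x f : R -> R) (eps rho : R) (N J : nat).
Hypotheses (eps0 : 0 < eps) (rho0 : 0 < rho) (J_le : (J <= 2 ^ N)%N).
Let g s := x s - f s.
Let C := 96 / (eps * rho ^+ 2) + 2 * eps.

Let kernel j : R :=
  (4 ^ N)%:R^-1 * \sum_(i < 4 ^ N) tanaka (mesh N) (g (mesh N * j%:R) - midpoint eps (4 ^ N) i).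

Let v0 : 0 < mesh N. Proof. exact: mesh_gt0. Qed.

Let averageE : shift_average x f eps N J = \sum_(j < J) kernel j.
Proof.
rewrite /shift_average /local_sum exchange_big /= mulr_sumr.
by apply: eq_bigr => j _; congr (_ * _); apply: eq_bigr => i _; rewrite opprD addrA.
Qed.

Let four_mesh : (4 ^ N)%:R^-1 = mesh N ^+ 2 :> R.
Proof. by rewrite /mesh -exprVn -exprM mulnC exprM natrX -exprVn expr2 -invfM -natrM. Qed.

Let kernel_gain j : `|kernel j - cap_gain (mesh N) eps (g (mesh N * j%:R))| <= 2 * eps * mesh N ^+ 2.
Proof. by rewrite -four_mesh; apply: tanaka_average => //; rewrite expn_gt0. Qed.

Let c0 : 0 < 96 / (eps * rho ^+ 2).
Proof. by rewrite divr_gt0// mulr_gt0// exprn_gt0. Qed.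

Let outE : 96 * mesh N ^+ 2 / (2 * eps * rho ^+ 2) = 96 / (eps * rho ^+ 2) * mesh N ^+ 2 / 2.
Proof. by field; rewrite !gt_eqF. Qed.

Let inE : 96 * mesh N ^+ 2 / (eps * rho ^+ 2) = 96 / (eps * rho ^+ 2) * mesh N ^+ 2.
Proof. by field; rewrite !gt_eqF. Qed.

Let v2 : 0 < mesh N ^+ 2. Proof. exact: exprn_gt0. Qed.

Let kernel_le j : kernel j <=
  mesh N / (2 * eps) * (`|g (mesh N * j%:R)| < eps + rho)%R%:R + mesh N ^+ 2 * C.
Proof.
have := kernel_gain j; rewrite ler_norml => /andP[_].
have cv : 0 < 96 / (eps * rho ^+ 2) * mesh N ^+ 2 by rewrite mulr_gt0.
case: ltP => h.
  have := cap_gain_le (g (mesh N * j%:R)) v0 eps0.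
  by rewrite mulr1 /C mulrDr [mesh N ^+ 2 * (96 / _)]mulrC; lra.
have := cap_gain_out v0 eps0 rho0 h; rewrite outE.
by rewrite mulr0 /C mulrDr [mesh N ^+ 2 * (96 / _)]mulrC; lra.
Qed.

Let le_kernel j : mesh N / (2 * eps) * (`|g (mesh N * j%:R)| < eps - rho)%R%:R
  - mesh N ^+ 2 * C <= kernel j.
Proof.
have cv : 0 < 96 / (eps * rho ^+ 2) * mesh N ^+ 2 by rewrite mulr_gt0.
have ev : 0 < 2 * eps * mesh N ^+ 2 by rewrite !mulr_gt0.
rewrite /C mulrDr [mesh N ^+ 2 * (96 / _)]mulrC.
case: ltP => h.
  have := kernel_gain j; rewrite ler_norml => /andP[+ _].
  have := cap_gain_in v0 eps0 rho0 h; rewrite inE mulr1; lra.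
have : 0 <= kernel j.
  by rewrite mulr_ge0 ?invr_ge0// sumr_ge0// => i _; exact: tanaka_ge0.
by rewrite mulr0; lra.
Qed.

Let sum_const : \sum_(j < J) mesh N ^+ 2 * C <= mesh N * C.
Proof.
have C0 : 0 <= C by rewrite addr_ge0 ?(ltW c0)// mulr_ge0// ltW.
rewrite sumr_const card_ord -[leLHS]mulr_natl mulrA ler_wpM2r//.
rewrite expr2 mulrA -[leRHS]mul1r ler_wpM2r ?(ltW v0)//.
by rewrite /mesh ler_pdivrMr ?exprn_gt0// mul1r -natrX ler_nat.
Qed.

Lemma shift_average_le : shift_average x f eps N J <=
  mesh N * (hits g N J (eps + rho))%:R / (2 * eps) + mesh N * C.
Proof.
rewrite averageE; apply: (le_trans (ler_sum (index_enum 'I_J) (fun (j : 'I_J) _ => kernel_le j))).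
by rewrite big_split /= -mulr_sumr -natr_sum [leRHS]addrC mulrAC [leRHS]addrC lerD2l.
Qed.

Lemma le_shift_average :
  mesh N * (hits g N J (eps - rho))%:R / (2 * eps) - mesh N * C <= shift_average x f eps N J.
Proof.
rewrite averageE; apply: le_trans (ler_sum (index_enum 'I_J) (fun (j : 'I_J) _ => le_kernel j)).
by rewrite sumrB -mulr_sumr -natr_sum [leRHS]addrC mulrAC [leRHS]addrC lerD2l lerN2.
Qed.

Lemma midpoint_le (i : 'I_(4 ^ N)) : `|midpoint eps (4 ^ N) i| <= eps.
Proof.
have q0 : 0 < (4 ^ N)%:R :> R by rewrite ltr0n expn_gt0.
have d0 : 0 < eps / (4 ^ N)%:R by rewrite divr_gt0.
have h1 : 0 <= (2 * i%:R + 1) * (eps / (4 ^ N)%:R) by rewrite mulr_ge0 ?(ltW d0)// addr_ge0// mulr_ge0.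
have h2 : (2 * i%:R + 1) * (eps / (4 ^ N)%:R) <= 2 * (4 ^ N)%:R * (eps / (4 ^ N)%:R).
  rewrite ler_wpM2r ?(ltW d0)//.
  have : i.+1%:R <= (4 ^ N)%:R :> R by rewrite ler_nat.
  by rewrite -natr1; lra.
have h3 : 2 * (4 ^ N)%:R * (eps / (4 ^ N)%:R) = 2 * eps by field; rewrite gt_eqF.
by rewrite /midpoint ler_norml; apply/andP; split; lra.
Qed.

Lemma shift_average_close (L e : R) :
  (forall y, `|y| <= eps -> `|local_sum x (fun t => f t + y) N J - L| <= e) ->
  `|shift_average x f eps N J - L| <= e.
Proof.
move=> h; have q0 : 0 < (4 ^ N)%:R :> R by rewrite ltr0n expn_gt0.
have -> : shift_average x f eps N J - L = (4 ^ N)%:R^-1 *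
    \sum_(i < 4 ^ N) (local_sum x (fun t => f t + midpoint eps (4 ^ N) i) N J - L).
  rewrite sumrB mulrBr; congr (_ - _).
  by rewrite sumr_const card_ord -[L *+ _]mulr_natl mulrA mulVf ?mul1r// gt_eqF.
rewrite normrM gtr0_norm ?invr_gt0// mulrC ler_pdivrMr//.
apply: (le_trans (ler_norm_sum _ _ _)).
apply: (@le_trans _ _ (\sum_(i < 4 ^ N) e)).
  by apply: ler_sum => i _; apply: h; exact: midpoint_le.
by rewrite sumr_const card_ord -[leLHS]mulr_natr.
Qed.

End fixed_scale.

(** The occupation at eps is squeezed between hit counts at eps - rho and eps + rho, which are
    compared to shift averages of half-width eps - 2 rho and eps + 2 rho. First N tends to infinity,
    then rho to 0; the room for eps + 2 rho is why eps < r is strict. *)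
Lemma occupation_close x f (L e r eps t : R) M :
  {within `[0, 1], continuous (fun s => x s - f s)} -> 0 <= t <= 1 -> 0 < eps -> eps < r ->
  (forall y, `|y| <= r -> forall N, (M <= N)%N -> `|approx x (fun t => f t + y) N t - L| <= e) ->
  `|occupation (fun s => x s - f s) eps t / (2 * eps) - L| <= e.
Proof.
move=> cg t01 eps0 epsr hL; set g := fun s => x s - f s.
have [t0 t1] := andP t01.
pose J N := Num.truncn (t * 2 ^+ N).
have JN N : (J N <= 2 ^ N)%N.
  rewrite -(ler_nat R) natrX; apply: (@le_trans _ _ (t * 2 ^+ N)).
    by rewrite truncn_le mulr_ge0// exprn_ge0.
  by rewrite ler_piMl// exprn_ge0.
have close eps1 N : 0 < eps1 -> eps1 <= r -> (M <= N)%N ->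
    `|shift_average x f eps1 N (J N) - L| <= e.
  move=> e10 e1r MN; apply: shift_average_close => // y hy.
  by apply: hL => //; exact: le_trans e1r.
have e20 : 0 < 2 * eps by rewrite mulr_gt0.
have small (A B c : R) :
    (forall n0, exists2 N, (n0 <= N)%N & A <= B + mesh N * c) -> A <= B.
  move=> h; apply: (@le_of_arbitrarily_small _ _ c) => d d0.
  have [n0 hn0] := mesh_small d0; have [N /hn0 hN hA] := h n0.
  by exists (mesh N); rewrite mesh_gt0.
rewrite ler_norml; apply/andP; split.
  rewrite lerBrDl ler_pdivlMr//.
  (* The factor 4 accounts for 2 eps = 2 eps1 + 4 rho. *)
  apply: (@le_of_arbitrarily_small _ _ (4 * (L - e))) => d d0.
  pose rho := Num.min (d / 2) (eps / 4).
  have rho0 : 0 < rho by rewrite lt_min !divr_gt0.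
  have rd : rho < d by rewrite gt_min ltr_pdivrMr// ltr_pMr// ltr1n.
  have re : 2 * rho < eps.
    have : rho <= eps / 4 by rewrite ge_min lexx orbT.
    lra.
  exists rho; split; first by rewrite rho0.
  have [n0 hn0] := occupation_hits eps rho0 cg.
  pose eps1 := eps - 2 * rho; have e10 : 0 < eps1 by rewrite subr_gt0.
  pose C := 96 / (eps1 * rho ^+ 2) + 2 * eps1.
  apply: (small _ _ (2 * eps1 * C)) => n1.
  pose N := maxn (maxn n0 M) n1; exists N; first by rewrite leq_maxr.
  have n0N : (n0 <= N)%N by rewrite /N !leq_max leqnn.
  have MN : (M <= N)%N by rewrite /N !leq_max leqnn orbT.
  have [h1 _] := hn0 N n0N t t01; rewrite -/(J N) in h1.
  have h2 := shift_average_le x f e10 rho0 (JN N).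
  have h3 := close eps1 N e10 ltac:(rewrite /eps1; lra) MN.
  move: h2; rewrite (_ : eps1 + rho = eps - rho); last by rewrite /eps1; ring.
  rewrite -/g -/C => h2; move: h3; rewrite ler_norml => /andP[h3 _].
  have h4 : L - e - mesh N * C <= mesh N * (hits g N (J N) (eps - rho))%:R / (2 * eps1) by lra.
  rewrite ler_pdivlMr ?mulr_gt0// in h4.
  apply: (@le_trans _ _ (mesh N * (hits g N (J N) (eps - rho))%:R + rho * (4 * (L - e)) + mesh N * (2 * eps1 * C))); last by rewrite !lerD2r.
  apply: le_trans (lerD (lerD h4 (lexx _)) (lexx _)).
  by rewrite le_eqVlt; apply/orP; left; apply/eqP; rewrite /eps1; ring.
rewrite lerBlDr ler_pdivrMr//.
apply: (@le_of_arbitrarily_small _ _ (4 * (e + L))) => d d0.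
pose rho := Num.min (d / 2) ((r - eps) / 4).
have rho0 : 0 < rho by rewrite lt_min !divr_gt0// subr_gt0.
have rd : rho < d by rewrite gt_min ltr_pdivrMr// ltr_pMr// ltr1n.
have re : eps + 2 * rho <= r.
  have : rho <= (r - eps) / 4 by rewrite ge_min lexx orbT.
  lra.
exists rho; split; first by rewrite rho0.
have [n0 hn0] := occupation_hits eps rho0 cg.
pose eps1 := eps + 2 * rho; have e10 : 0 < eps1 by rewrite addr_gt0// mulr_gt0.
pose C := 96 / (eps1 * rho ^+ 2) + 2 * eps1.
apply: (small _ _ (2 * eps1 * C + 1)) => n1.
pose N := maxn (maxn n0 M) n1; exists N; first by rewrite leq_maxr.
have n0N : (n0 <= N)%N by rewrite /N !leq_max leqnn.
have MN : (M <= N)%N by rewrite /N !leq_max leqnn orbT.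
have [_ h1] := hn0 N n0N t t01; rewrite -/(J N) in h1.
have h2 := le_shift_average x f e10 rho0 (JN N).
have h3 := close eps1 N e10 re MN.
move: h2; rewrite (_ : eps1 - rho = eps + rho); last by rewrite /eps1; ring.
rewrite -/g -/C => h2; move: h3; rewrite ler_norml => /andP[_ h3].
have h4 : mesh N * (hits g N (J N) (eps + rho))%:R / (2 * eps1) <= e + L + mesh N * C by lra.
rewrite ler_pdivrMr ?mulr_gt0// in h4.
apply: (le_trans h1); apply: (le_trans (lerD h4 (lexx _))).
by rewrite le_eqVlt; apply/orP; left; apply/eqP; rewrite /eps1; ring.
Qed.

End identification.

(** * The limit on good paths: joint continuity and occupation densities *)

Section path_limits.
Context d (T : measurableType d) (R : realType) (P : probability T R).
Variables (W : R -> {RV P >-> R}) (alpha : R) (K : nat).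
Hypothesis alpha_gt : 1 / 2 < alpha.
Hypothesis alpha_le : alpha <= 1.
Hypothesis K_large : 20 <= (K%:R - 16) * (alpha - 1 / 2).
Hypothesis K16 : (16 <= K)%N.
Local Notation mesh := (@mesh R).
Local Notation mu := (@lebesgue_measure R).
Local Notation cauchy_const := (@cauchy_const R K).

Lemma cvg_of_cauchy_rate (u : R^nat) (C : R) N0 : (0 < N0)%N ->
  (forall M N, (N0 <= M)%N -> (M <= N)%N -> `|u N - u M| <= C / M%:R) ->
  cvgn u /\ forall M, (N0 <= M)%N -> `|u M - limn u| <= C / M%:R.
Proof.
move=> N00 hu.
have C0 : 0 <= C.
  by have := le_trans (normr_ge0 _) (hu N0 N0 (leqnn _) (leqnn _)); rewrite pmulr_lge0// invr_gt0 ltr0n.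
have cu : cvgn u.
  apply/cauchy_cvgP/cauchy_exP => e e0.
  pose M := maxn N0 (Num.truncn (C / e)).+1.
  exists (u M); exists M => // N /= MN; rewrite /ball /= distrC.
  have M0 : 0 < M%:R :> R by rewrite ltr0n (leq_trans N00)// leq_maxl.
  apply: (le_lt_trans (hu M N (leq_maxl _ _) MN)).
  rewrite ltr_pdivrMr// mulrC -ltr_pdivrMr//.
  have ce : 0 <= C / e by rewrite divr_ge0// ltW.
  have /andP[_ h] := truncn_itv ce.
  by apply: (lt_le_trans h); rewrite ler_nat leq_maxr.
split=> // M NM; apply/ler_addgt0Pr => e e0.
have /cvgrPdist_lt/(_ e e0)[N1 _ h1] := cu.
have := h1 (maxn M N1) (leq_maxr _ _); have := hu M (maxn M N1) NM (leq_maxl _ _).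
set v := u (maxn _ _) => h2 h3.
have -> : u M - limn u = (u M - v) + (v - limn u) by ring.
by apply: (le_trans (ler_normD _ _)); rewrite lerD// distrC// ltW.
Qed.

Definition curve_local_time f t w : R := limn (fun N => approx (fun t => bm W t w) f N t).

Lemma cauchy_rate_small N0 (e : R) : (0 < N0)%N -> 0 < e -> exists2 N, (N0 <= N)%N &
  cauchy_const N0 / N%:R < e /\ Num.sqrt (mesh N) < e.
Proof.
move=> N00 e0; have [n1 h1] := @mesh_small R (e ^+ 2) ltac:(by rewrite exprn_gt0).
pose c := cauchy_const N0 / e.
have c0 : 0 <= c by rewrite divr_ge0 ?(ltW e0)//; exact: cauchy_const_ge0.
pose N := maxn N0 (maxn n1 (Num.truncn c).+1); exists N; first exact: leq_maxl.
split; last first.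
  rewrite -(gtr0_norm e0) -sqrtr_sqr ltr_sqrt ?exprn_gt0//; apply: h1.
  by rewrite /N !leq_max leqnn orbT.
have N1 : (0 < N)%N by apply: leq_trans N00 _; exact: leq_maxl.
rewrite ltr_pdivrMr ?ltr0n// mulrC -ltr_pdivrMr//.
have /andP[_ h] := truncn_itv c0; apply: (lt_le_trans h).
by rewrite ler_nat /N !leq_max leqnn !orbT.
Qed.

Section good_path.
Variables (w : T) (N0 : nat).
Hypotheses (KN0 : (K <= N0)%N) (gw : eventually_good W K N0 w).
Let x t := bm W t w.

Let N00 : (0 < N0)%N. Proof. by apply: leq_trans KN0; exact: leq_trans K16. Qed.

Lemma approx_cvg f t : holder alpha f -> 0 <= t <= 1 ->
  cvgn (fun N => approx x f N t).
Proof.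
by move=> hf ht; have [] := @cvg_of_cauchy_rate (fun N => approx x f N t) _ N0 N00
  (fun M N h1 h2 => approx_cauchy alpha_gt alpha_le K_large K16 KN0 gw hf ht h1 h2).
Qed.

Lemma approx_limit f t N : holder alpha f -> 0 <= t <= 1 -> (N0 <= N)%N ->
  `|approx x f N t - curve_local_time f t w| <= cauchy_const N0 / N%:R.
Proof.
by move=> hf ht; have [_] := @cvg_of_cauchy_rate (fun N => approx x f N t) _ N0 N00
  (fun M N h1 h2 => approx_cauchy alpha_gt alpha_le K_large K16 KN0 gw hf ht h1 h2); exact.
Qed.

(** The factor 2^N, one Lipschitz bound per kernel, does no harm: the scale is fixed before the
    distance of the curves is chosen. *)
Lemma approx_curve_lipschitz f g N t (e : R) : 0 <= t <= 1 ->
  (forall s, 0 <= s <= 1 -> `|f s - g s| <= e) ->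
  `|approx x f N t - approx x g N t| <= 2 ^+ N * (2 * e).
Proof.
move=> /andP[t0 t1] fg; rewrite /approx /local_sum -sumrB.
have e0 : 0 <= e by rewrite (le_trans _ (fg 0 _))// lexx ler01.
set J := Num.truncn _.
have tN : 0 <= t * 2 ^+ N by rewrite mulr_ge0// exprn_ge0.
have JN : J%:R <= 2 ^+ N :> R.
  by apply: (@le_trans _ _ (t * 2 ^+ N)); rewrite ?truncn_le ?ler_piMl ?exprn_ge0.
apply: (le_trans (ler_norm_sum _ _ _)).
apply: (@le_trans _ _ (\sum_(j < J) 2 * e)).
  apply: ler_sum => j _; apply: (le_trans (tanaka_lipschitz _ _ (mesh_gt0 _ _))).
  rewrite ler_wpM2l// opprB addrC addrA subrK distrC; apply: fg.
  rewrite mulr_ge0 ?(ltW (mesh_gt0 _ _))//= /mesh mulrC ler_pdivrMr ?exprn_gt0// mul1r.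
  by apply: le_trans JN; rewrite ler_nat ltnW.
by rewrite sumr_const card_ord -[leLHS]mulr_natl ler_wpM2r// mulr_ge0.
Qed.

Lemma approx_time_continuous f N s t : 0 <= s -> 0 <= t -> `|s - t| <= mesh N ->
  `|approx x f N s - approx x f N t| <= Num.sqrt (mesh N).
Proof.
wlog st : s t / s <= t => [hw s0 t0 h|s0 t0].
  by case/orP: (le_total s t) => ?; [|rewrite distrC]; apply: hw => //; rewrite distrC.
rewrite distrC ger0_norm ?subr_ge0// => h.
have sN : 0 <= s * 2 ^+ N by rewrite mulr_ge0// exprn_ge0.
have tN : 0 <= t * 2 ^+ N by rewrite mulr_ge0// exprn_ge0.
have hN : t * 2 ^+ N <= s * 2 ^+ N + 1.
  by rewrite -lerBlDl -mulrBl -ler_pdivlMr ?exprn_gt0// mul1r.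
have stN : s * 2 ^+ N <= t * 2 ^+ N by rewrite ler_wpM2r// exprn_ge0.
rewrite /approx.
have /andP[a1 a2] := truncn_itv sN; have /andP[b1 b2] := truncn_itv tN.
move: a1 a2 b1 b2; set a := Num.truncn _; set b := Num.truncn _ => a1 a2 b1 b2.
have ab : (a <= b)%N by rewrite -ltnS -(ltr_nat R); lra.
have ba : (b <= a.+1)%N by rewrite -ltnS -(ltr_nat R) -[a.+2%:R]natr1; lra.
move: ba; rewrite leq_eqVlt ltnS => /predU1P[->|ba].
  rewrite /local_sum big_ord_recr /= opprD addrA subrr add0r normrN.
  by rewrite ger0_norm ?tanaka_ge0 ?tanaka_le ?mesh_gt0.
have -> : b = a by apply/eqP; rewrite eqn_leq ba ab.
by rewrite subrr normr0 sqrtr_ge0.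
Qed.

Lemma supnorm_lt_le (h : R -> R) (e : R) : (supnorm h < e%:E)%E ->
  forall s, 0 <= s <= 1 -> `|h s| <= e.
Proof.
move=> he s hs; rewrite -lee_fin; apply: le_trans (ltW he).
by apply: ereal_sup_ubound; exists s => //=; rewrite in_itv.
Qed.

(** Both curves share one rate of convergence, so their limits can be replaced by approximations at
    a single scale, where the crude bounds in the curve and in time suffice. *)
Lemma curve_local_time_modulus f t e : holder alpha f -> 0 <= t <= 1 -> 0 < e ->
  exists2 delta, 0 < delta & forall g s, holder alpha g -> 0 <= s <= 1 ->
    (forall u, 0 <= u <= 1 -> `|g u - f u| <= delta) -> `|s - t| < delta ->
    `|curve_local_time g s w - curve_local_time f t w| < e.
Proof.
move=> hf ht e0.
have e8 : 0 < e / 8 by rewrite divr_gt0.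
have [N N0N [h1 h2]] := cauchy_rate_small N00 e8.
pose c := e / 16 * mesh N.
have c0 : 0 < c by rewrite mulr_gt0 ?mesh_gt0// divr_gt0.
exists (Num.min (mesh N) c); first by rewrite lt_min mesh_gt0.
move=> g s hg hs gf st.
have gc u : 0 <= u <= 1 -> `|g u - f u| <= c.
  by move=> hu; apply: (le_trans (gf u hu)); rewrite ge_min lexx orbT.
have st' : `|s - t| <= mesh N.
  by apply: (le_trans (ltW st)); rewrite ge_min lexx.
have k1 := approx_limit hg hs N0N; have k2 := approx_limit hf ht N0N.
have k3 := approx_curve_lipschitz N hs gc.
have [s0 _] := andP hs; have [t0 _] := andP ht.
have k4 := approx_time_continuous f s0 t0 st'.
have cE : 2 ^+ N * (2 * c) = e / 8.
  rewrite /c (_ : _ * _ = e / 8 * (2 ^+ N * mesh N)); last by field.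
  by rewrite /mesh mulfV ?mulr1// expf_neq0.
rewrite cE in k3.
move: k1 k2 k3 k4.
set A := approx x g N s; set B := approx x f N s; set D := approx x f N t.
rewrite !ler_norml => /andP[] ? ? /andP[] ? ? /andP[] ? ? /andP[] ? ?.
by rewrite ltr_norml; apply/andP; split; lra.
Qed.

Lemma curve_local_time_continuous :
  jointly_continuous (holder_ball alpha) (fun f t => curve_local_time f t w).
Proof.
move=> f t [_ hf] ht e e0.
have [delta delta0 h] := curve_local_time_modulus hf ht e0.
exists delta => // g s [_ hg] hs gf st; apply: h => //.
exact: (@supnorm_lt_le (fun u => g u - f u)).
Qed.

End good_path.

(** The comparison passes through scale [M]: the shifted curve obeys the same Cauchy rate, and at
    scale [M] a shift by [r] costs at most e / 4. Neither [r] nor [M] depends on the outcome, the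
    curve or the time. *)
Lemma approx_shift_close N0 (e : R) : (K <= N0)%N -> 0 < e ->
  exists2 r, 0 < r & exists M, forall w, eventually_good W K N0 w -> forall f t,
  holder alpha f -> 0 <= t <= 1 -> forall y, `|y| <= r -> forall N, (M <= N)%N ->
  `|approx (fun t => bm W t w) (fun s => f s + y) N t - curve_local_time f t w| <= e.
Proof.
move=> KN0 e0; have e8 : 0 < e / 8 by rewrite divr_gt0.
have N00 : (0 < N0)%N by apply: leq_trans KN0; exact: leq_trans K16.
have [M N0M [h1 _]] := cauchy_rate_small N00 e8.
pose r := e / 8 * mesh M.
have r0 : 0 < r by rewrite mulr_gt0 ?mesh_gt0.
exists r => //; exists M => w gw f t hf ht y hy N MN; set x := fun t => bm W t w.
have k1 := approx_cauchy alpha_gt alpha_le K_large K16 KN0 gw (holder_shift y hf) ht N0M MN.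
have k2 := approx_limit KN0 gw hf ht N0M.
have k3 : `|approx x (fun s => f s + y) M t - approx x f M t| <= 2 ^+ M * (2 * r).
  by apply: approx_curve_lipschitz => // s _; rewrite addrAC subrr add0r.
have rE : 2 ^+ M * (2 * r) = e / 4.
  rewrite /r (_ : _ * _ = e / 4 * (2 ^+ M * mesh M)); last by field.
  by rewrite /mesh mulfV ?mulr1// expf_neq0.
rewrite rE in k3; move: k1 k2 k3; rewrite -/x.
set A := approx x _ N t; set B := approx x _ M t; set D := approx x f M t.
rewrite !ler_norml => /andP[] ? ? /andP[] ? ? /andP[] ? ?.
by apply/andP; split; lra.
Qed.

Lemma holder_continuous f : holder alpha f -> {within `[0, 1], continuous f}.
Proof.
move=> hf; apply/within_continuousP => s /=; rewrite in_itv /= => hs e e0.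
have a0 : 0 < alpha by apply: lt_trans alpha_gt; rewrite divr_gt0.
exists (e `^ alpha^-1); first exact: powR_gt0.
move=> t /=; rewrite in_itv /= => ht st; apply: (le_lt_trans (hf s t hs ht)).
have eE : (e `^ alpha^-1) `^ alpha = e.
  by rewrite -powRrM mulVf ?gt_eqF// powRr1// ltW.
by rewrite -[ltRHS]eE gt0_ltr_powR// nnegrE ?powR_ge0.
Qed.

Lemma occupation_densityE f eps t w : 0 < eps -> 0 <= t <= 1 ->
  {within `[0, 1], continuous (fun s => W s w - f s)} ->
  occupation_density W f eps t w = occupation (fun s => W s w - f s) eps t / (2 * eps).
Proof.
move=> e0 /andP[t0 t1] cg; rewrite /occupation_density mulrC; congr (_ * _).
have mV := measurable_occupation_set eps t1 cg.
rewrite /Rintegral /occupation; congr fine.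
rewrite -[RHS](_ : mu ((`[0, t] `&` [set s | `|W s w - f s| < eps]) `&` `[0, t]) = _); last first.
  by congr (mu _); apply/seteqP; split => s /=; [case|move=> [h1 h2]].
rewrite -integral_indic//; apply: eq_integral => s; rewrite inE /= => st.
congr EFin; rewrite !indicE; congr (_%:R); congr nat_of_bool.
apply/idP/idP; rewrite !inE /= !in_itv /= ltr_norml.
  move=> /andP[h1 h2]; split; first by move: st; rewrite in_itv.
  by apply/andP; split; lra.
by move=> [_ /andP[h1 h2]]; apply/andP; split; lra.
Qed.

(** The radius [r] is chosen before the outcome; this is what allows pathwise closeness to be
    integrated over an event for every small eps. *)
Lemma occupation_density_close N0 (e : R) : (K <= N0)%N -> 0 < e ->
  exists2 r, 0 < r & forall w, eventually_good W K N0 w ->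
    W 0 w = 0 -> {within `[0, +oo[, continuous (fun t => W t w)} ->
    forall f t eps, holder alpha f -> 0 <= t <= 1 -> 0 < eps < r ->
    `|occupation_density W f eps t w - curve_local_time f t w| <= e.
Proof.
move=> KN0 e0; have [r r0 [M h]] := approx_shift_close KN0 e0.
exists r => // w gw W0 cW f t eps hf ht /andP[eps0 epsr].
have cg : {within `[0, 1], continuous (fun s => W s w - f s)}.
  have cf := holder_continuous hf.
  have cW1 : {within `[0, 1], continuous (fun s => W s w)}.
    by apply: continuous_subspaceW cW => s /=; rewrite !in_itv /= => /andP[->].
  by move=> s; apply: cvgB; [exact: cW1|exact: cf].
have xW : (fun t => bm W t w) = (fun t => W t w).
  by apply/funext => s; rewrite /bm W0 subr0.
rewrite occupation_densityE//; apply: (occupation_close (r := r) (M := M)) => //.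
by move=> y hy N MN; rewrite -xW; exact: h.
Qed.

End path_limits.

(** * Almost sure statements *)

Section nonmeasurable_lower_bound.
Import HBNNSimple.

(* [F] need not be measurable: the integral of a nonnegative function is a
   supremum over the simple functions below it. *)
Lemma integral_ge_on d (T : measurableType d) (R : realType) (mu : {measure set T -> \bar R})
    (F : T -> \bar R) (B : set T) (c : R) : 0 <= c -> measurable B ->
  (forall w, 0 <= F w)%E -> (forall w, B w -> c%:E <= F w)%E ->
  (c%:E * mu B <= \int[mu]_w F w)%E.
Proof.
move=> c0 mB F0 FB; pose h := scale_nnsfun (indic_nnsfun R mB) c0.
have hE w : h w = c * \1_B w by [].
apply: (@le_trans _ _ (sintegral mu h)); last first.
  rewrite (ge0_integralTE mu F0); apply: ereal_sup_ubound; exists h => // w.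
  rewrite hE indicE; case: (boolP (w \in B)) => wB.
    by rewrite mulr1; apply: FB; rewrite inE in wB.
  by rewrite mulr0.
rewrite -integralT_nnsfun.
under eq_integral do rewrite hE EFinM.
rewrite ge0_integralZl//; last by apply/measurable_EFinP; exact: measurable_indic.
by rewrite integral_indic// setIT.
Qed.

End nonmeasurable_lower_bound.

Section almost_sure.
Context d (T : measurableType d) (R : realType) (P : probability T R).
Variables (W : R -> {RV P >-> R}) (alpha : R) (K : nat).
Hypothesis hW : brownian_motion W.
Hypothesis alpha_gt : 1 / 2 < alpha.
Hypothesis alpha_le : alpha <= 1.
Hypothesis K_large : 20 <= (K%:R - 16) * (alpha - 1 / 2).
Hypothesis K16 : (16 <= K)%N.
Local Notation mesh := (@mesh R).

Lemma measurable_eventually_good N0 : (K <= N0)%N -> measurable (eventually_good W K N0).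
Proof.
move=> KN0; rewrite (_ : eventually_good W K N0 = \bigcap_(N in [set N | (N0 <= N)%N]) good W K N)//.
apply: bigcap_measurable; [by exists N0 => /=|move=> N /= N0N].
by have [] := good_prob hW K16 (leq_trans KN0 N0N).
Qed.

Definition regular : set T := \bigcup_n eventually_good W K (n + K).

Lemma measurable_regular : measurable regular.
Proof. by apply: bigcup_measurable => n _; apply: measurable_eventually_good; exact: leq_addl. Qed.

Lemma ae_regular : {ae P, forall w, regular w}.
Proof.
pose F n := ~` good W K (n + K).
have mF n : measurable (F n).
  by apply: measurableC; have [] := good_prob hW K16 (leq_addl n K).
exists (lim_sup_set F); split.
- apply: bigcapT_measurable => n; apply: bigcup_measurable => j _; exact: mF.
- apply: lim_sup_set_cvg0 => //.
  (* 44 mesh n is 88 / 2^(n + 1), in the form summed by [epsilon_trick0]. *)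
  apply: (@le_lt_trans _ _ (\sum_(i <oo) (88 / (2 ^ i.+1)%:R)%:E)%E); last first.
    by apply: le_lt_trans (ltry 88); exact: epsilon_trick0.
  apply: lee_nneseries => // n _.
  have [_ h] := good_prob hW K16 (leq_addl n K).
  apply: (le_trans h); rewrite lee_fin.
  apply: (@le_trans _ _ (44 * mesh n)).
    by rewrite ler_wpM2l// mesh_le// leq_addr.
  rewrite le_eqVlt; apply/orP; left; apply/eqP.
  rewrite /mesh natrX exprS; field; exact: expf_neq0.
- move=> w /= hw n _; apply: contrapT => h; apply: hw.
  exists n => // N nN; apply: contrapT => hN; apply: h.
  have KN : (K <= N)%N by apply: leq_trans nN; exact: leq_addl.
  exists (N - K)%N => /=; first by rewrite leq_subRL// addnC.
  by rewrite /F /= subnK.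
Qed.

Lemma measurable_approx f N t : measurable_fun setT (fun w => approx (fun t => bm W t w) f N t).
Proof.
rewrite /approx /local_sum; apply: measurable_sum => j.
exact/measurable_tanaka_bm/mesh_gt0.
Qed.

(** Convergence is known on regular paths; with the indicator the approximations converge
    everywhere, and the limit is measurable. *)
Lemma measurable_curve_local_time f t : holder alpha f -> 0 <= t <= 1 ->
  measurable_fun setT (fun w => curve_local_time W f t w * \1_regular w).
Proof.
move=> hf ht.
apply: (@measurable_fun_cvg _ _ _ _
  (fun N w => approx (fun t => bm W t w) f N t * \1_regular w)).
  move=> N; apply: measurable_funM; first exact: measurable_approx.
  by apply: measurable_indic; exact: measurable_regular.
move=> w _; rewrite indicE; case: (boolP (w \in regular)); rewrite ?inE => wr.
  have [n _ gw] := wr.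
  have := @approx_cvg _ _ _ _ W alpha K alpha_gt alpha_le K_large K16 w _ (leq_addl n K) gw f t hf ht.
  move=> h; rewrite mulr1 (_ : (fun N => _) = (fun N => approx (fun t => bm W t w) f N t))//.
  by apply/funext => N; rewrite mulr1.
rewrite mulr0 (_ : (fun N => _) = (fun=> 0)); first exact: cvg_cst.
by apply/funext => N; rewrite mulr0.
Qed.

(** [L] supplies a default random variable at curves and times outside the range of interest. *)
Lemma exists_curve_local_time (L : (R -> R) -> R -> {RV P >-> R}) :
  exists Lt : (R -> R) -> R -> {RV P >-> R}, forall f t w,
    holder alpha f -> 0 <= t <= 1 -> regular w -> Lt f t w = curve_local_time W f t w.
Proof.
suff : forall p : (R -> R) * R, exists X : {RV P >-> R}, forall w,
    holder alpha p.1 -> 0 <= p.2 <= 1 -> regular w -> X w = curve_local_time W p.1 p.2 w.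
  by move=> /choice[F hF]; exists (fun f t => F (f, t)) => f t w; exact: (hF (f, t)).
move=> [f t] /=; have [[hf ht]|h] := pselect (holder alpha f /\ 0 <= t <= 1); last first.
  by exists (L f t) => w hf ht; exfalso; exact: h.
pose X : {RV P >-> R} := HB.pack (fun w => curve_local_time W f t w * \1_regular w)
  (isMeasurableFun.Build _ _ _ _ _ (measurable_curve_local_time hf ht)).
by exists X => w _ _ wr; rewrite /X /= indicE mem_set// mulr1.
Qed.

Section fixed_curve.
Variables (f : R -> R) (L : R -> {RV P >-> R}).
Hypothesis hf : holder alpha f.
Hypothesis hL : is_local_time W f L.

(** If the two differed by more than 2 c on an event of positive probability inside one good event,
    the occupation densities, within c of the pathwise limit there, would stay c away from [L] for
    all small eps, against the L^2 convergence. *)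
Lemma curve_local_time_eq t : 0 <= t <= 1 ->
  {ae P, forall w, curve_local_time W f t w = L t w}.
Proof.
move=> ht; have [ae0 _ _ [A [mA A0 hA]]] := hW; have [B [mB B0 hB]] := ae0.
have [_ _ cvL] := hL.
pose G := ~` A `&` ~` B.
have mG : measurable G by apply: measurableI; exact: measurableC.
pose D w := `|curve_local_time W f t w * \1_regular w - L t w|.
have mD : measurable_fun setT D.
  apply: measurableT_comp => //; apply: measurable_funB => //.
  exact: measurable_curve_local_time.
(* [G] discards measurable null sets that cover the bad paths, so that [E] is measurable although
   the conditions on the path need not be. *)
pose E (k n : nat) := [set w | 2 / k.+1%:R < D w] `&` eventually_good W K (n + K) `&` G.
have mE k n : measurable (E k n).
  apply: measurableI => //; apply: measurableI; first exact: measurable_gt.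
  by apply: measurable_eventually_good; exact: leq_addl.
have PE k n : P (E k n) = 0%E.
  pose c : R := k.+1%:R^-1; have c0 : 0 < c by rewrite invr_gt0.
  have [r r0 hr] := occupation_density_close W alpha_gt alpha_le K_large K16 (leq_addl n K) c0.
  have : ((c ^+ 2)%:E * P (E k n) <= 0)%E.
    apply: (cvge_to_ge cvL).
    near=> eps.
    have eps0 : 0 < eps by near: eps; exact: nbhs_right_gt.
    have epsr : eps < r by near: eps; exact: nbhs_right_lt.
    apply: integral_ge_on => //.
    - exact: exprn_ge0 (ltW c0).
    - by move=> w; rewrite expe2; exact: sqre_ge0.
    move=> w [[wD gw] [wA wB]].
    have W0 : W 0 w = 0 by apply: contrapT => h; apply: wB; exact: hB.
    have cW : {within `[0, +oo[, continuous (fun t => W t w)}.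
      by apply: contrapT => h; apply: wA; exact: hA.
    have wr : regular w by exists n.
    have := hr w gw W0 cW f t eps hf ht ltac:(by rewrite eps0 epsr).
    move: wD; rewrite /= /D indicE mem_set// mulr1 => wD close.
    have cs : (c%:E <= supnorm (fun t => occupation_density W f eps t w - L t w)%R)%E.
      apply: (@le_trans _ _ `|occupation_density W f eps t w - L t w|%:E).
        rewrite lee_fin; move: wD close.
        set a := curve_local_time _ _ _ _; set b := occupation_density _ _ _ _ _.
        have := ler_distD b a (L t w); rewrite [`|a - b|]distrC -/c; lra.
      by apply: ereal_sup_ubound; exists t => //=; rewrite in_itv.
    rewrite expr2 EFinM; apply: lee_pmul => //; rewrite lee_fin; exact: ltW.
  rewrite pmule_rle0 ?lte_fin ?exprn_gt0// => h; apply/eqP.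
  by rewrite eq_le h measure_ge0.
have aeE : {ae P, forall w, forall k n, ~ E k n w}.
  apply: ae_foralln => k; apply: ae_foralln => n.
  by exists (E k n); split; [exact: mE|exact: PE|move=> w /= /contrapT].
have aeG : {ae P, forall w, G w}.
  have aeA : {ae P, forall w, ~ A w} by exists A; split => // w /= /contrapT.
  have aeB : {ae P, forall w, ~ B w} by exists B; split => // w /= /contrapT.
  by apply: filterS2 aeA aeB => w.
apply: filterS3 ae_regular aeE aeG => w wr wE wG.
apply/eqP; rewrite -subr_eq0 -normr_eq0; apply: contrapT => /negP h.
have [n _ gw] := wr.
have D0 : 0 < D w by rewrite /D indicE mem_set// mulr1 lt_neqAle eq_sym h normr_ge0.
have d2 : 0 <= 2 / D w by rewrite divr_ge0// ltW.
apply: (wE (Num.truncn (2 / D w)) n); split=> //; split=> //=.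
have /andP[_ h2] := truncn_itv d2.
by rewrite ltr_pdivrMr// mulrC -ltr_pdivrMr.
Unshelve. all: by end_near. Qed.

(** The equality at a fixed time is collected over the countably many dyadic times and extended by
    continuity of both sides in t. *)
Lemma ae_curve_local_time_eq :
  {ae P, forall w, forall t, 0 <= t <= 1 -> curve_local_time W f t w = L t w}.
Proof.
have [cL _ _] := hL.
have aeD : {ae P, forall w, forall N j, mesh N * j%:R <= 1 ->
    curve_local_time W f (mesh N * j%:R) w = L (mesh N * j%:R) w}.
  apply: ae_foralln => N; apply: ae_foralln => j.
  have [h|h] := pselect (mesh N * j%:R <= 1); last by apply: aeW => w /h.
  have hs : 0 <= mesh N * j%:R <= 1 by rewrite h mulr_ge0// ltW// mesh_gt0.
  by apply: filterS (curve_local_time_eq hs) => w ->.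
apply: filterS3 ae_regular aeD cL => w [n _ gw] hD cLw t ht.
have /within_continuousP cLt := cLw.
apply/eqP; rewrite -subr_eq0 -normr_le0; apply/ler_addgt0Pr => e e0; rewrite add0r.
have e2 : 0 < e / 2 by rewrite divr_gt0.
have [d1 d10 h1] := curve_local_time_modulus alpha_gt alpha_le K_large K16
  (leq_addl n K) gw hf ht e2.
have [d2 d20 h2] := cLt t ltac:(by rewrite /= in_itv) _ e2.
have [N0 hN] := @mesh_small R (Num.min d1 d2) ltac:(by rewrite lt_min d10).
have := hN N0 (leqnn _); rewrite lt_min => /andP[m1 m2].
have [t0 t1] := andP ht.
have tN : 0 <= t * 2 ^+ N0 by rewrite mulr_ge0// exprn_ge0.
have /andP[] := truncn_itv tN; set j := Num.truncn _ => j1 j2.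
pose s := mesh N0 * j%:R.
have s0 : 0 <= s by rewrite mulr_ge0// ltW// mesh_gt0.
have st : s <= t by rewrite /s /mesh mulrC ler_pdivrMr ?exprn_gt0.
have ts : t < s + mesh N0.
  by rewrite /s -{2}[mesh N0]mulr1 -mulrDr natr1 /mesh mulrC ltr_pdivlMr ?exprn_gt0.
have s01 : 0 <= s <= 1 by rewrite s0 (le_trans st).
have k3 := hD N0 j (le_trans st t1); rewrite -/s in k3.
have ts' : `|t - s| < mesh N0 by rewrite ger0_norm ?subr_ge0// ltrBlDl.
have k1 : `|curve_local_time W f s w - curve_local_time W f t w| < e / 2.
  apply: h1 => //; last by rewrite distrC (lt_trans ts').
  by move=> u _; rewrite subrr normr0 ltW.
have k2 := h2 s ltac:(by rewrite /= in_itv) (lt_trans ts' m2).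
rewrite k3 in k1; move: k1 k2; rewrite !ltr_norml ler_norml => /andP[? ?] /andP[? ?].
by apply/andP; split; lra.
Qed.

End fixed_curve.
End almost_sure.

Theorem mainTheorem3 (R : realType) (d : measure_display)
    (T : measurableType d) (P : probability T R) (W : R -> {RV P >-> R})
    (hW : brownian_motion W) (alpha : R) (halpha : 1 / 2 < alpha <= 1)
    (L : (R -> R) -> R -> {RV P >-> R})
    (hL : forall f, holder_ball alpha f -> is_local_time W f (L f)) :
  exists Ltilde : (R -> R) -> R -> {RV P >-> R},
    (forall f, holder_ball alpha f ->
      {ae P, forall w, forall t, 0 <= t <= 1 -> Ltilde f t w = L f t w}) /\
    {ae P, forall w,
      jointly_continuous (holder_ball alpha) (fun f t => Ltilde f t w)}.
Proof.
have /andP[alpha_gt alpha_le] := halpha.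
pose c := 20 / (alpha - 1 / 2).
have a0 : 0 < alpha - 1 / 2 by rewrite subr_gt0.
have c0 : 0 <= c by rewrite divr_ge0// ltW.
(* K - 16 exceeds 20 / (alpha - 1/2), as [blk_pow] demands. *)
pose K := ((Num.truncn c).+1 + 16)%N.
have K16 : (16 <= K)%N by exact: leq_addl.
have K_large : 20 <= (K%:R - 16) * (alpha - 1 / 2).
  rewrite -ler_pdivrMr// -/c /K natrD addrK.
  by have /andP[_ /ltW] := truncn_itv c0.
have [Lt hLt] := exists_curve_local_time hW alpha_gt alpha_le K_large K16 L.
have reg := ae_regular hW K16.
exists Lt; split.
  move=> f fS; have [_ hf] := fS.
  have eqL := ae_curve_local_time_eq hW alpha_gt alpha_le K_large K16 hf (hL _ fS).
  by apply: filterS2 reg eqL => w wr wL t ht; rewrite hLt// wL.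
(* On a regular path [Lt] equals the pathwise limit at all curves and times simultaneously, so one
   null set serves them all. *)
apply: filterS reg => w wr f t fS ht e e0.
have [n _ gw] := wr.
have [delta delta0 h] := curve_local_time_continuous alpha_gt alpha_le K_large K16
  (leq_addl n K) gw fS ht e0.
exists delta => // g s gS hs gf st.
have [_ hf] := fS; have [_ hg] := gS.
by rewrite !hLt//; exact: h.
Qed.
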